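(* Let $n\ge 1$ and let $A$ be a subset of $\mathbb R^{n+1}$, where $\mathbb R^{n+1}=\mathbb R^n\times\mathbb R$ is equipped with the potential theory of the heat equation $\sum_{i=1}^n\frac{\partial^2u}{\partial x_i^2}-\frac{\partial u}{\partial t}=0$. 1. If $m_P(A)<\infty$, then $A$ is semipolar. 2. If $m_P(A)=0$, then $A$ is polar.
   Context: Parabolic Hausdorff measure $m_P$: for $\rho>0$ and $x'\in\mathbb R^{n+1}$ let $P(0,\rho):=[-\rho/2,\rho/2]^n\times[-\rho^2/2,\rho^2/2]$, $P(x',\rho):=x'+P(0,\rho)$. For $A\subset\mathbb R^{n+1}$ and $\delta>0$, $$m_P^\delta(A):=\inf\Big\{\sum_{j=1}^\infty(\operatorname{diam}P(x_j',\rho_j))^n:\ A\subset\bigcup_{j=1}^\infty P(x_j',\rho_j),\ \operatorname{diam}P(x_j',\rho_j)<\delta\Big\},\quad m_P(A):=\lim_{\delta\to0}m_P^\delta(A),$$ where $\operatorname{diam}$ is the Euclidean diameter. Potential theory of the heat equation on $X=\mathbb R^{n+1}$: let $\mathcal W$ be the cone of positive hyperharmonic functions for the heat equation on $\mathbb R^{n+1}$; equivalently, $\mathcal W$ is the set of Borel functions $u\colon\mathbb R^{n+1}\to[0,\infty]$ with $\sup_{t>0}P_t'u=u$, where $P_t'f(x,r):=\int_{\mathbb R^n}(4\pi t)^{-n/2}e^{-|x-y|^2/(4t)}f(y,r-t)\,dy$. For $A\subset X$ and $u\in\mathcal W$ let $R_u^A:=\inf\{v\in\mathcal W: v\ge u\text{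 on }A\}$ and let $\hat R_u^A$ be the greatest lower semicontinuous minorant of $R_u^A$. A function $u\in\mathcal W$ is superharmonic if, for every relatively compact open $U$, $R_u^{X\setminus U}$ is real and continuous on $U$. $A$ is polar if $\hat R_1^A=0$. $T$ is totally thin if for every $x\in X$ there is a superharmonic $u\ge0$ with $\hat R_u^T(x)<u(x)$. A set is semipolar if it is a countable union of totally thin sets. *)

(* Defs.v *)
From HB Require Import structures.
From mathcomp Require Import all_boot all_order all_algebra.
From mathcomp Require Import all_classical all_reals all_analysis.
From mathcomp Require Import measurable_realfun.

Set Implicit Arguments.
Unset Strict Implicit.
Unset Printing Implicit Defensive.

Import Order.TTheory GRing.Theory Num.Theory.
Import numFieldNormedType.Exports.

Local Open Scope classical_set_scope.
Local Open Scope ring_scope.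

Section TupleMeasure.
Context d (T : measurableType d) (R : realType).

Definition tuple_cons n (p : T * n.-tuple T) : n.+1.-tuple T :=
  [tuple of p.1 :: p.2].

Lemma measurable_tuple_cons n :
  measurable_fun [set: T * n.-tuple T] (@tuple_cons n).
Proof. exact: (measurable_cons measurable_fst measurable_snd). Qed.

Context (m : {sigma_finite_measure set T -> \bar R}).

Definition tuple_measure_step n (mu : set (n.-tuple T) -> \bar R) :
  set (n.+1.-tuple T) -> \bar R :=
  pushforward (m \x mu)%E (@tuple_cons n).

Section step.
Context (n : nat) (mu : {sigma_finite_measure set (n.-tuple T) -> \bar R}).

HB.instance Definition _ := Measure.copy (tuple_measure_step mu)
  (measure_function_pushforward__canonical__measure_function_Measure
    (m \x mu)%E (@measurable_tuple_cons n)).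

Lemma tuple_measure_step_sigma_finite :
  sigma_finite setT (tuple_measure_step mu).
Proof.
have /sigma_finiteP[F [TF ndF Foo]] := sigma_finiteT m.
have /sigma_finiteP[G [TG ndG Goo]] := sigma_finiteT mu.
pose u (t : n.+1.-tuple T) : T * n.-tuple T := (thead t, [tuple of behead t]).
have Ku p : u (tuple_cons p) = p.
  by case: p => a b; congr pair; apply: val_inj.
have measurable_u : measurable_fun setT u.
  apply/measurable_fun_pairP; split.
    exact: measurable_tnth.
  exact: measurable_behead.
exists (fun k => u @^-1` (F k `*` G k)).
  apply/esym; rewrite -preimage_bigcup -subTset => t _.
  have [k _ Fk] : (\bigcup_k F k) (u t).1 by rewrite -TF.
  have [l _ Gl] : (\bigcup_k G k) (u t).2 by rewrite -TG.
  exists (maxn k l) => //; split.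
  - by move: Fk; apply/subsetPset/ndF/leq_maxl.
  - by move: Gl; apply/subsetPset/ndG/leq_maxr.
move=> k; have [mF Fk] := Foo k; have [mG Gk] := Goo k.
have mFG : measurable (F k `*` G k) by exact: measurableX.
split; first by rewrite -[X in measurable X]setTI; exact: measurable_u.
rewrite /tuple_measure_step /pushforward -comp_preimage.
rewrite (_ : u \o _ = id); last by apply/funext => p; exact: Ku.
by rewrite preimage_id product_measure1E// lte_mul_pinfty// ge0_fin_numE.
Qed.

HB.instance Definition _ := @Measure_isSigmaFinite.Build _ _ _
  (tuple_measure_step mu) tuple_measure_step_sigma_finite.

End step.

(* The n-fold product m x (m x ( ... )), transported along [tuple_cons]; with
   m the Lebesgue measure of R this is the Lebesgue measure of R^n. *)
Fixpoint tuple_measure n : {sigma_finite_measure set (n.-tuple T) -> \bar R} :=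
  match n return {sigma_finite_measure set (n.-tuple T) -> \bar R} with
  | 0 => dirac ([tuple] : 0.-tuple T)
  | n'.+1 => tuple_measure_step (tuple_measure n')
  end.

End TupleMeasure.

Definition lebesgue_tuple (R : realType) n :
  {sigma_finite_measure set (n.-tuple (measurableTypeR R)) -> \bar R} :=
  tuple_measure lebesgue_measure n.

(* [spacetime R n] is R^n x R, a point being a pair (x, r) of a spatial row
   vector and a time; it carries the product topology.  The library norm on row
   vectors is the sup norm, hence the explicit Euclidean norm below. *)
Notation spacetime R n := ('rV[R]_n * R)%type.

Section Euclidean.
Context (R : realType) (n : nat).

Definition euclidean_norm (x : 'rV[R]_n) : R :=
  Num.sqrt (\sum_(i < n) (x ord0 i) ^+ 2).

Definition euclidean_dist (p q : spacetime R n) : R :=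
  Num.sqrt (euclidean_norm (p.1 - q.1) ^+ 2 + (p.2 - q.2) ^+ 2).

Definition euclidean_diam (A : set (spacetime R n)) : \bar R :=
  ereal_sup [set (euclidean_dist pq.1 pq.2)%:E | pq in A `*` A].

End Euclidean.

Section ParabolicMeasure.
Context (R : realType) (n : nat).
Local Notation X := (spacetime R n).

Definition parabolic_cube0 (rho : R) : set X :=
  [set p : X | (forall i, p.1 ord0 i \in `[- (rho / 2), rho / 2]) /\
               p.2 \in `[- (rho ^+ 2 / 2), rho ^+ 2 / 2]].

Definition parabolic_cube (x : X) (rho : R) : set X :=
  [set x + p | p in parabolic_cube0 rho].

Definition parabolic_covering (delta : R) (A : set X) (x : nat -> X)
    (rho : nat -> R) : Prop :=
  [/\ forall j, 0 < rho j,
      A `<=` \bigcup_j parabolic_cube (x j) (rho j) &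
      forall j, (euclidean_diam (parabolic_cube (x j) (rho j)) < delta%:E)%E].

Definition parabolic_premeasure (delta : R) (A : set X) : \bar R :=
  ereal_inf
    [set (\sum_(0 <= j <oo)
            euclidean_diam (parabolic_cube (xr.1 j) (xr.2 j)) ^+ n)%E
      | xr in [set xr : (nat -> X) * (nat -> R) |
                parabolic_covering delta A xr.1 xr.2]].

Definition parabolic_measure (A : set X) : \bar R :=
  lim (parabolic_premeasure delta A @[delta --> 0^'+]).

End ParabolicMeasure.

Section HeatPotentialTheory.
Context (R : realType) (n : nat).
Local Notation X := (spacetime R n).
Implicit Types (u v : X -> \bar R) (A T : set X).

Definition heat_kernel (t : R) (z : 'rV[R]_n) : R :=
  (4 * pi * t) `^ (- (n%:R / 2)) * expR (- (euclidean_norm z ^+ 2 / (4 * t))).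

(* Integration over R^n is with respect to [lebesgue_tuple], the points of R^n
   being transported from tuples to row vectors. *)
Definition heat_semigroup (t : R) u (z : X) : \bar R :=
  (\int[lebesgue_tuple R n]_(y in setT)
     let w : 'rV[R]_n := \row_(i < n) tnth y i in
     (heat_kernel t (z.1 - w)%R)%:E * u (w, (z.2 - t)%R))%E.

Definition borel u : Prop :=
  measurable_fun setT (u : g_sigma_algebraType (@open X) -> \bar R).

Definition hyperharmonic u : Prop :=
  [/\ borel u, forall z, (0 <= u z)%E &
      forall z, ereal_sup [set heat_semigroup t u z | t in [set t | 0 < t]]
                = u z].

Definition reduit u A (z : X) : \bar R :=
  ereal_inf [set v z | v in [set v | hyperharmonic v /\
                                     forall w, A w -> (u w <= v w)%E]].

(* A pointwise supremum of lower semicontinuous functions is lower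
   semicontinuous, so this is the greatest such minorant. *)
Definition lsc_regularization (f : X -> \bar R) (z : X) : \bar R :=
  ereal_sup [set g z | g in [set g : X -> \bar R | lower_semicontinuous g /\
                                     forall w, (g w <= f w)%E]].

Definition regularized_reduit u A : X -> \bar R :=
  lsc_regularization (reduit u A).

Definition superharmonic u : Prop :=
  hyperharmonic u /\
  forall U : set X, open U -> compact (closure U) ->
    (forall z, U z -> reduit u (~` U) z \is a fin_num) /\
    {within U, continuous (fun z => fine (reduit u (~` U) z))}.

Definition polar A : Prop := forall z, regularized_reduit (cst 1%E) A z = 0%E.

Definition totally_thin T : Prop :=
  forall z, exists2 u, superharmonic u & (regularized_reduit u T z < u z)%E.

Definition semipolar A : Prop :=
  exists2 T : nat -> set X, forall k, totally_thin (T k) & A = \bigcup_k T k.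

End HeatPotentialTheory.

(* Main.v *)
(* A set of finite parabolic measure has finite mass for the outer measure
   [mass] (same coverings, gauge side^n), which by Caratheodory is a measure on
   the Borel sets.  On a cube of side rho, rho^n times the heat kernel with
   pole rho^2 below the centre is bounded from below, so coverings of small total
   gauge give hyperharmonic functions that are small outside and large on the
   set: null sets are polar.

   For the first part, A is contained up to a null set in countably many compact
   sets K of finite mass.  Let N be the heat potential of the mass restricted to
   K; where N is infinite K is polar, so it remains to show that the closed sets
   T = K n {N <= m} are totally thin.  Fix z and put u = exp(a.x + |a|^2 t).
   As N_T(z) is finite, one may choose a time s just below that of z such that
   T charges the slice at time s little and the part of T between s and z is
   seen from z with small heat potential.  For a large drift a the part of T
   below s is covered by a potential v with v <= u/2 on most of the slice, so
   min(v, u), extended calorically above s, falls short of u by a definite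
   amount lam on a large subset Q of the slice.  Potentials of coverings of the
   part of T above s, weighted by the probability of coming from Q, restore the
   domination of u on T; by the Harnack inequality and the smallness of N_T(z)
   they cost at z only a fraction of the gain. *)

From HB Require Import structures.
Require Import Defs.
From mathcomp Require Import all_boot all_order all_algebra.
From mathcomp Require Import all_classical all_reals all_analysis.
From mathcomp Require Import measurable_realfun.
From mathcomp Require Import zify ring lra.

Set Implicit Arguments.
Unset Strict Implicit.
Unset Printing Implicit Defensive.

Import Order.TTheory GRing.Theory Num.Theory.
Import numFieldNormedType.Exports.

(** The obstacle is the part of [T] between [s] and [z], where the competitor must again reach [u].
    Covering it with weights comparable to [u] is too expensive: the gain at [z] is only [lam] times
    the probability of coming from [Q], and [lam] may be tiny against [u]. But the deficit at a
    point is just [lam] times that point's own probability of coming from [Q]. Repairing exactly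
    this deficit turns cost and gain into integrals over the same set [Q], which can be compared
    pointwise once the few points with a large density of return are removed from [Q]. The Harnack
    inequality lets one value of that probability serve a whole cube, but it breaks down for cubes
    too close to time [s]; a thin slab above [s] is therefore covered separately with the crude
    weight [lam], at a cost controlled by its small mass. The set [Q] cannot be a full ball of the
    slice, because the potential of the part of [T] just below [s] is small in integral only.
    Finally, the regularised reduit is tested through the semigroup at arbitrarily short times [k],
    so the gain must not depend on [k]; what happens after time [z.2 - k] is settled by the value
    [+oo]. *)

Local Open Scope classical_set_scope.
Local Open Scope ring_scope.

(** * Gaussian kernel *)

(* Unlike [ge0_le_integral], no measurability is required. *)
Lemma integral_le_pointwise d (T : measurableType d) (R : realType)
    (mu : {measure set T -> \bar R}) (f g : T -> \bar R) :
  (forall x, 0 <= f x)%E -> (forall x, f x <= g x)%E ->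
  (\int[mu]_x f x <= \int[mu]_x g x)%E.
Proof.
move=> f0 fg; have g0 x : (0 <= g x)%E by exact: le_trans (f0 x) (fg x).
rewrite !ge0_integralTE//; apply: ereal_sup_le => _ [h hf <-].
by exists h => // x; exact: le_trans (hf x) (fg x).
Qed.

Section tuple_integral.
Context (R : realType).
Local Notation leb := (lebesgue_tuple R).
Local Notation mR := (measurableTypeR R).

Lemma integral_lebesgue_tupleS n (f : n.+1.-tuple mR -> \bar R) :
  measurable_fun setT f -> (forall y, 0 <= f y)%E ->
  (\int[leb n.+1]_y f y =
   \int[lebesgue_measure]_a \int[leb n]_y f [tuple of a :: y])%E.
Proof.
move=> mf f0.
have := @ge0_integral_pushforward _ _ (mR * n.-tuple mR)%type (n.+1.-tuple mR) R
  (@tuple_cons _ mR n) (@measurable_tuple_cons _ mR n)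
  (@lebesgue_measure R \x leb n)%E setT f measurableT mf (fun y _ => f0 y).
rewrite preimage_setT => H.
transitivity (\int[(@lebesgue_measure R \x leb n)%E]_x (f \o @tuple_cons _ mR n) x)%E => //.
rewrite fubini_tonelli1//=.
  apply: measurableT_comp => //; exact: measurable_tuple_cons.
Qed.

Lemma integral_lebesgue_tuple0 (f : 0.-tuple mR -> \bar R) :
  measurable_fun setT f -> (\int[leb 0]_y f y = f [tuple])%E.
Proof. by move=> mf; rewrite integral_dirac// diracT mul1e. Qed.

Lemma integral_lebesgue_tuple_prod n (F : 'I_n -> R -> R) :
  (forall i, measurable_fun setT (F i)) -> (forall i x, 0 <= F i x) ->
  (forall i, (\int[lebesgue_measure]_x (F i x)%:E = 1)%E) ->
  (\int[leb n]_y (\prod_(i < n) F i (tnth y i))%:E = 1)%E.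
Proof.
elim: n F => [|n IH] F mF F0 F1.
  by under eq_integral do rewrite big_ord0; rewrite integral_lebesgue_tuple0.
rewrite integral_lebesgue_tupleS; first last.
- by move=> y; rewrite lee_fin prodr_ge0.
- apply/measurable_EFinP/measurable_prod => i _.
  exact: (measurableT_comp (mF i) (measurable_tnth i)).
have E (a : R) (y : n.-tuple mR) :
   (\prod_(i < n.+1) F i (tnth [tuple of (a : mR) :: y] i))%:E =
   ((F ord0 a)%:E * (\prod_(i < n) F (lift ord0 i) (tnth y i))%:E)%E.
  rewrite big_ord_recl -EFinM; congr (_ * _)%:E.
  by apply: eq_bigr => i _; rewrite tnthS.
under eq_integral => a _.
  under eq_integral => y _ do rewrite E.
  rewrite ge0_integralZl//; last 3 first.
  - apply/measurable_EFinP/measurable_prod => i _.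
    exact: (measurableT_comp (mF (lift ord0 i)) (measurable_tnth i)).
  - by move=> y _; rewrite lee_fin prodr_ge0.
  - by rewrite lee_fin.
  rewrite (IH (fun i => F (lift ord0 i)))// mule1.
  over.
exact: F1.
Qed.

End tuple_integral.

Section heat_kernel.
Context (R : realType) (n : nat).
Local Notation mR := (measurableTypeR R).
Local Notation leb := (lebesgue_tuple R n).
Implicit Types x y z a : 'rV[R]_n.

Definition row_of_tuple (y : n.-tuple mR) : 'rV[R]_n := \row_(i < n) tnth y i.

Lemma row_of_tupleE (y : n.-tuple mR) i : row_of_tuple y ord0 i = tnth y i.
Proof. by rewrite mxE. Qed.

Lemma sqr_euclidean_norm x : euclidean_norm x ^+ 2 = \sum_i x ord0 i ^+ 2.
Proof. by rewrite sqr_sqrtr// sumr_ge0// => i _; rewrite sqr_ge0. Qed.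

Lemma heat_kernelE t x : heat_kernel t x =
  (4 * pi * t) `^ (- (n%:R / 2)) * expR (- ((\sum_i x ord0 i ^+ 2) / (4 * t))).
Proof. by rewrite /heat_kernel sqr_euclidean_norm. Qed.

Lemma heat_kernel_ge0 t x : 0 <= heat_kernel t x.
Proof. by rewrite mulr_ge0 ?powR_ge0 ?expR_ge0. Qed.

Lemma heat_kernelN t x : heat_kernel t (- x) = heat_kernel t x.
Proof.
by rewrite !heat_kernelE; under eq_bigr do rewrite mxE sqrrN.
Qed.

Lemma heat_kernel_le t x : 0 < t -> heat_kernel t x <= (4 * pi * t) `^ (- (n%:R / 2)).
Proof.
move=> t0; rewrite ler_piMr ?powR_ge0// -[leRHS]expR0 ler_expR oppr_le0.
by rewrite divr_ge0 ?sqr_ge0// mulr_ge0// ltW.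
Qed.

(** Identifies the kernel with the density of [n] independent centred Gaussians of variance [2 * t];
    total mass 1 then follows coordinate by coordinate. *)
Lemma heat_kernel_prod t x : 0 < t ->
  heat_kernel t x = \prod_(i < n) normal_pdf 0 (Num.sqrt (2 * t)) (x ord0 i).
Proof.
move=> t0; have t20 : 0 < 2 * t by rewrite mulr_gt0.
have st0 : Num.sqrt (2 * t) != 0 by rewrite gt_eqF// sqrtr_gt0.
rewrite normal_pdfE// big_split/= /normal_peak prodr_const card_ord.
rewrite heat_kernelE; congr (_ * _).
  rewrite sqr_sqrtr ?ltW//.
  have -> : 2 * t * pi *+ 2 = 4 * pi * t by rewrite -mulr_natr; ring.
  have p0 : 0 <= 4 * pi * t by rewrite !mulr_ge0 ?pi_ge0// ltW.
  rewrite powRN exprVn; congr (_^-1).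
  by rewrite [n%:R / 2]mulrC powRrM powR12_sqrt// powR_mulrn ?sqrtr_ge0.
rewrite /normal_fun -expR_sum; congr expR.
rewrite mulr_suml -sumrN; apply: eq_bigr => i _.
rewrite subr0 sqr_sqrtr ?ltW// mulNr; congr (- (_ / _)).
by rewrite -mulr_natr; ring.
Qed.

Lemma measurable_heat_kernel t x :
  measurable_fun setT (fun y : n.-tuple mR => heat_kernel t (x - row_of_tuple y)).
Proof.
under eq_fun do rewrite heat_kernelE.
apply: measurable_funM => //; apply: measurableT_comp => //.
apply: measurableT_comp => //; apply: measurable_funM => //.
apply: measurable_sum => i; apply: measurable_funX.
under eq_fun do rewrite !mxE.
by apply: measurable_funB => //; exact: measurable_tnth.
Qed.

Lemma integral_heat_kernel t x : 0 < t ->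
  (\int[leb]_y (heat_kernel t (x - row_of_tuple y))%:E = 1)%E.
Proof.
move=> t0.
under eq_integral => y _.
  have -> : heat_kernel t (x - row_of_tuple y) =
    \prod_(i < n) normal_pdf (x ord0 i) (Num.sqrt (2 * t)) (tnth y i).
    rewrite heat_kernel_prod//; apply: eq_bigr => i _.
    rewrite !normal_pdfE ?gt_eqF ?sqrtr_gt0 ?mulr_gt0//.
    have -> : (x - row_of_tuple y) ord0 i = - (tnth y i - x ord0 i).
      by rewrite !mxE opprB.
    by rewrite /normal_fun subr0 sqrrN.
  over.
apply: (integral_lebesgue_tuple_prod (F := fun i => normal_pdf (x ord0 i) (Num.sqrt (2 * t)))).
- by move=> i; exact: measurable_normal_pdf.
- by move=> i a; exact: normal_pdf_ge0.
- by move=> i; exact: integral_normal_pdf.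
Qed.

(* Completing the square in the exponent. *)
Lemma heat_kernel_mul t s x y z : 0 < t -> 0 < s ->
  heat_kernel t (x - y) * heat_kernel s (y - z) =
  heat_kernel (t + s) (x - z) *
  heat_kernel (t * s / (t + s)) ((s / (t + s)) *: x + (t / (t + s)) *: z - y).
Proof.
move=> t0 s0; have ts0 : 0 < t + s by rewrite addr_gt0.
have t0' : t != 0 by rewrite gt_eqF.
have s0' : s != 0 by rewrite gt_eqF.
have ts0' : t + s != 0 by rewrite gt_eqF.
have p4 (r : R) : 0 < r -> 0 <= 4 * pi * r.
  by move=> r0; rewrite ltW// mulr_gt0// mulr_gt0// pi_gt0.
rewrite !heat_kernelE mulrACA [RHS]mulrACA -!powRM; last 3 first; try by rewrite p4// ?divr_gt0 ?mulr_gt0.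
congr (_ * _).
  by congr (_ `^ _); field.
rewrite -!expRD; congr expR; rewrite -!opprD; congr (- _).
rewrite !mulr_suml -!big_split/=; apply: eq_bigr => i _.
by rewrite !mxE; field; rewrite t0' s0' ts0'.
Qed.

Lemma chapman_kolmogorov t s x z : 0 < t -> 0 < s ->
  (\int[leb]_y ((heat_kernel t (x - row_of_tuple y))%:E *
                (heat_kernel s (row_of_tuple y - z))%:E) =
   (heat_kernel (t + s) (x - z))%:E)%E.
Proof.
move=> t0 s0.
under eq_integral do rewrite -EFinM heat_kernel_mul// EFinM.
rewrite ge0_integralZl//.
- by rewrite integral_heat_kernel ?mule1// divr_gt0 ?mulr_gt0 ?addr_gt0.
- by apply/measurable_EFinP; exact: measurable_heat_kernel.
- by move=> y _; rewrite lee_fin heat_kernel_ge0.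
- by rewrite lee_fin heat_kernel_ge0.
Qed.

(** Half of the exponent [|x|^2 / (4 t)] is spent on the factor in [b]; the other half is the
    exponent of the kernel at time [2 * t], whose normalisation is smaller by [2^(n/2)]. *)
Lemma heat_kernel_tail t b x : 0 < t -> b ^+ 2 <= \sum_i x ord0 i ^+ 2 ->
  heat_kernel t x <=
  2 `^ (n%:R / 2) * expR (- (b ^+ 2 / (8 * t))) * heat_kernel (2 * t) x.
Proof.
move=> t0 bx; have t0' : t != 0 by rewrite gt_eqF.
rewrite !heat_kernelE [leRHS]mulrACA.
have -> : (4 * pi * t) `^ (- (n%:R / 2)) =
   2 `^ (n%:R / 2) * (4 * pi * (2 * t)) `^ (- (n%:R / 2)).
  have -> : 4 * pi * (2 * t) = 2 * (4 * pi * t) by ring.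
  have p0 : 0 <= 4 * pi * t by rewrite ltW// mulr_gt0// mulr_gt0// pi_gt0.
  rewrite [(2 * _) `^ _]powRM// mulrA -powRD ?subrr ?powRr0 ?mul1r//.
  by apply/implyP => _; rewrite gt_eqF.
rewrite ler_wpM2l ?mulr_ge0 ?powR_ge0// -expRD ler_expR -opprD lerN2.
have -> : 4 * (2 * t) = 8 * t by ring.
rewrite -mulrDl ler_pdivrMr ?mulr_gt0//.
have -> : (\sum_i x ord0 i ^+ 2) / (4 * t) * (8 * t) = 2 * \sum_i x ord0 i ^+ 2.
  by field.
lra.
Qed.

End heat_kernel.

(** * Heat potentials *)

Section kernel.
Context (R : realType) (n : nat).
Local Notation mR := (measurableTypeR R).
Local Notation leb := (lebesgue_tuple R n).
Local Notation X := (spacetime R n).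

(* The fundamental solution with pole [p], evaluated at [z]. *)
Definition heat_pole (z p : X) : R :=
  if p.2 < z.2 then heat_kernel (z.2 - p.2) (z.1 - p.1) else 0.

Lemma heat_pole_ge0 z p : 0 <= heat_pole z p.
Proof. by rewrite /heat_pole; case: ifP => // _; exact: heat_kernel_ge0. Qed.

Lemma heat_poleE z p : p.2 < z.2 ->
  heat_pole z p = heat_kernel (z.2 - p.2) (z.1 - p.1).
Proof. by rewrite /heat_pole => ->. Qed.

Lemma heat_pole0 z p : z.2 <= p.2 -> heat_pole z p = 0.
Proof. by rewrite /heat_pole leNgt => /negbTE ->. Qed.

Lemma heat_kernel_expR t (x : 'rV[R]_n) : 0 < t ->
  heat_kernel t x =
  expR (- (n%:R / 2) * ln (4 * pi * t) - (\sum_i x ord0 i ^+ 2) / (4 * t)).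
Proof.
move=> t0; rewrite heat_kernelE /powR expRD gt_eqF// mulr_gt0// mulr_gt0//.
exact: pi_gt0.
Qed.

Lemma continuous_space_coord i : continuous (fun w : X => w.1 ord0 i).
Proof.
move=> z; apply: (@continuous_comp _ _ _ fst (fun M : 'rV[R]_n => M ord0 i)).
  exact: cvg_fst.
exact: coord_continuous.
Qed.

Lemma continuous_heat_pole (p z : X) : p.2 < z.2 ->
  {for z, continuous (fun w : X => heat_pole w p)}.
Proof.
move=> pz.
have c2 : (fun w : X => w.2 - p.2) @ z --> z.2 - p.2.
  by apply: cvgB; [exact: cvg_snd|exact: cvg_cst].
have zp0 : 0 < z.2 - p.2 by rewrite subr_gt0.
suff H : (fun w : X => heat_pole w p) @ z --> heat_pole z p by exact: H.
rewrite heat_poleE// heat_kernel_expR//.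
have A : (fun w : X => - (n%:R / 2) * ln (4 * pi * (w.2 - p.2)) -
     (\sum_i (w.1 - p.1) ord0 i ^+ 2) / (4 * (w.2 - p.2))) @ z -->
   - (n%:R / 2) * ln (4 * pi * (z.2 - p.2)) -
     (\sum_i (z.1 - p.1) ord0 i ^+ 2) / (4 * (z.2 - p.2)).
  apply: cvgB.
    apply: cvgMr; have lnc : {for 4 * pi * (z.2 - p.2), continuous (@ln R)}.
      by apply: continuous_ln; rewrite mulr_gt0// mulr_gt0// pi_gt0.
    have c3 : (fun w : X => 4 * pi * (w.2 - p.2)) @ z --> 4 * pi * (z.2 - p.2).
      by apply: cvgMr; exact: c2.
    exact: (cvg_comp _ _ c3 lnc).
  apply: cvgM.
    apply: cvg_big => //=.
      by move=> [a b]; exact: add_continuous.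
    move=> i _.
    have -> : (fun w : X => (w.1 - p.1) ord0 i ^+ 2) =
              (fun w : X => (w.1 ord0 i - p.1 ord0 i) ^+ 2).
      by apply/funext => w; rewrite !mxE.
    have -> : (z.1 - p.1) ord0 i ^+ 2 = (z.1 ord0 i - p.1 ord0 i) ^+ 2.
      by rewrite !mxE.
    apply: (@cvg_comp _ _ _ (fun w : X => w.1 ord0 i - p.1 ord0 i) (fun r => r ^+ 2) _ (nbhs (z.1 ord0 i - p.1 ord0 i)));
      last exact: exprn_continuous.
    apply: cvgB; last exact: cvg_cst.
    exact: continuous_space_coord.
  apply: cvgV; first by rewrite gt_eqF// mulr_gt0.
  by apply: cvgMr; exact: c2.
have B := cvg_comp _ _ A (@continuous_expR R _).
apply: cvg_trans; last exact: B.
apply: near_eq_cvg; near=> w.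
have pw : p.2 < w.2.
  rewrite -subr_gt0; near: w.
  by apply: (cvgr_gt (z.2 - p.2)).
by rewrite /= heat_poleE// heat_kernel_expR// subr_gt0.
Unshelve. all: by end_near. Qed.

(** Points of the space are parametrised by tuples, by indices and by the Caratheodory space. Asking
    for measurable coordinates avoids fixing a sigma-algebra on the target, and suffices for
    [heat_pole]. *)
Definition coord_measurable d (T : measurableType d) (f : T -> X) :=
  (forall i, measurable_fun setT (fun t => (f t).1 ord0 i)) /\
  measurable_fun setT (fun t => (f t).2).

Lemma coord_measurable_comp d d' (S : measurableType d) (T : measurableType d')
    (g : S -> T) (f : T -> X) : coord_measurable f ->
  measurable_fun setT g -> coord_measurable (f \o g).
Proof.
move=> [f1 f2] mg; split.
  by move=> i; exact: (measurableT_comp (f1 i) mg).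
exact: (measurableT_comp f2 mg).
Qed.

Lemma coord_measurable_cst d (T : measurableType d) (z : X) :
  coord_measurable (cst z : T -> X).
Proof. by split => [i|]; exact: measurable_cst. Qed.

Lemma coord_measurable_slice s :
  coord_measurable (fun y : n.-tuple mR => (row_of_tuple y, s) : X).
Proof.
split; last exact: measurable_cst.
by move=> i; under eq_fun do rewrite /= row_of_tupleE; exact: measurable_tnth.
Qed.

Lemma measurable_heat_pole d (T : measurableType d) (f g : T -> X) :
  coord_measurable f -> coord_measurable g ->
  measurable_fun setT (fun t => heat_pole (f t) (g t)).
Proof.
move=> [f1 f2] [g1 g2].
have mt : measurable_fun setT (fun t => (f t).2 - (g t).2).
  exact: measurable_funB.
(* The inverse is written as the power [-1] so that [measurable_powR] applies; on the branch taken
   the base is nonnegative, where the two agree. *)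
have -> : (fun t => heat_pole (f t) (g t)) = (fun t =>
  if (g t).2 < (f t).2 then (4 * pi * ((f t).2 - (g t).2)) `^ (- (n%:R / 2)) *
   expR (- ((\sum_i ((f t).1 ord0 i - (g t).1 ord0 i) ^+ 2) *
     (4 * ((f t).2 - (g t).2)) `^ (- 1))) else 0).
  apply/funext => t; rewrite /heat_pole; case: ifPn => // gf.
  rewrite heat_kernelE powR_inv1; last first.
    by rewrite mulr_ge0// subr_ge0 ltW.
  by under eq_bigr do rewrite !mxE.
apply: measurable_fun_ifT => //; first exact: measurable_fun_ltr.
apply: measurable_funM.
  apply: (measurableT_comp (measurable_powR _)).
  exact: measurable_funM.
apply: measurableT_comp => //; apply: measurableT_comp => //.
apply: measurable_funM.
  apply: measurable_sum => i; apply: measurable_funX.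
  exact: measurable_funB.
apply: (measurableT_comp (measurable_powR _)).
exact: measurable_funM.
Qed.

Lemma heat_semigroupE t (u : X -> \bar R) z : heat_semigroup t u z =
  (\int[leb]_y ((heat_kernel t (z.1 - row_of_tuple y))%:E *
                u (row_of_tuple y, (z.2 - t)%R)))%E.
Proof. by []. Qed.

(** Chapman-Kolmogorov with causality: the semigroup looks at time [z.2 - t], from which poles at
    that time or later are invisible. Exactly those poles are lost. *)
Lemma heat_semigroup_pole t z p : 0 < t ->
  heat_semigroup t (fun w => (heat_pole w p)%:E) z =
  (if p.2 < z.2 - t then heat_pole z p else 0)%:E.
Proof.
move=> t0; rewrite heat_semigroupE; case: ifPn => [pz|]; last first.
  rewrite -leNgt => zp; apply: integral0_eq => y _.
  by rewrite heat_pole0// mule0.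
have st : 0 < z.2 - t - p.2 by rewrite subr_gt0.
rewrite heat_poleE; last by rewrite (lt_le_trans pz)// gerBl ltW.
under eq_integral do rewrite heat_poleE//=.
rewrite chapman_kolmogorov//; congr (heat_kernel _ _)%:E; ring.
Qed.

End kernel.

Section potential.
Context (R : realType) (n : nat).
Local Notation mR := (measurableTypeR R).
Local Notation leb := (lebesgue_tuple R n).
Local Notation X := (spacetime R n).
Context d (Y : measurableType d) (nu : {sigma_finite_measure set Y -> \bar R}).
Context (b : Y -> R) (p : Y -> X).
Hypotheses (mb : measurable_fun setT b) (b0 : forall y, 0 <= b y).
Hypothesis mp : coord_measurable p.

(** One notion for three uses: [Y] is a time slice with Lebesgue measure, [nat] with the counting
    measure for a family of cubes, or the space itself with the parabolic mass. *)
Definition potential (z : X) : \bar R :=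
  (\int[nu]_y (b y * heat_pole z (p y))%:E)%E.

Lemma potential_ge0 z : (0 <= potential z)%E.
Proof. by apply: integral_ge0 => y _; rewrite lee_fin mulr_ge0 ?heat_pole_ge0. Qed.

Let mint z : measurable_fun setT (fun y => (b y * heat_pole z (p y))%:E).
Proof.
apply/measurable_EFinP/measurable_funM => //.
by apply: measurable_heat_pole => //; exact: coord_measurable_cst.
Qed.

Lemma heat_semigroup_potential t z : 0 < t ->
  heat_semigroup t potential z =
  (\int[nu]_y (b y * if (p y).2 < z.2 - t then heat_pole z (p y) else 0)%:E)%E.
Proof.
move=> t0; rewrite heat_semigroupE.
pose F (x : n.-tuple mR * Y) : \bar R :=
  (heat_kernel t (z.1 - row_of_tuple x.1) *
   (b x.2 * heat_pole (row_of_tuple x.1, z.2 - t) (p x.2)))%:E.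
have mF : measurable_fun setT F.
  apply/measurable_EFinP/measurable_funM.
    exact: (measurableT_comp (@measurable_heat_kernel R n t z.1) measurable_fst).
  apply: measurable_funM; first exact: (measurableT_comp mb measurable_snd).
  apply: measurable_heat_pole.
    exact: (coord_measurable_comp (@coord_measurable_slice R n (z.2 - t)) measurable_fst).
  exact: (coord_measurable_comp mp measurable_snd).
have F0 x : (0 <= F x)%E.
  by rewrite lee_fin mulr_ge0 ?heat_kernel_ge0// mulr_ge0// heat_pole_ge0.
transitivity (\int[leb]_x \int[nu]_y F (x, y))%E.
  apply: eq_integral => y _; rewrite /potential -ge0_integralZl//.
  - by move=> w _; rewrite lee_fin mulr_ge0 ?heat_pole_ge0.
  - by rewrite lee_fin heat_kernel_ge0.
rewrite fubini_tonelli//; apply: eq_integral => y _.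
rewrite /F/= EFinM -heat_semigroup_pole// heat_semigroupE -ge0_integralZl//.
- by apply: eq_integral => w _; rewrite -!EFinM; congr (_%:E); ring.
- apply/measurable_EFinP/measurable_funM; first exact: measurable_heat_kernel.
  apply: measurable_heat_pole; last exact: coord_measurable_cst.
  exact: coord_measurable_slice.
- by move=> w _; rewrite mule_ge0// lee_fin ?heat_kernel_ge0 ?heat_pole_ge0.
- by rewrite lee_fin.
Qed.

Lemma heat_semigroup_potential_le t z : 0 < t ->
  (heat_semigroup t potential z <= potential z)%E.
Proof.
move=> t0; rewrite heat_semigroup_potential//; apply: integral_le_pointwise.
  by move=> y; rewrite lee_fin mulr_ge0//; case: ifP => // _; exact: heat_pole_ge0.
move=> y; rewrite lee_fin ler_wpM2l//; case: ifP => // _; exact: heat_pole_ge0.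
Qed.

(** Fatou's lemma: the kernel is continuous at [z] for each pole strictly before [z], and for the
    other poles its value at [z] is 0. *)
Lemma potential_lim_le (w : nat -> X) (z : X) (a : R) : w @ \oo --> z ->
  (forall k, potential (w k) <= a%:E)%E -> (potential z <= a%:E)%E.
Proof.
move=> wz wa.
pose f k y := (b y * heat_pole (w k) (p y))%:E.
have f0 k y : (0 <= f k y)%E by rewrite lee_fin mulr_ge0 ?heat_pole_ge0.
have := @fatou _ Y R nu setT measurableT f (fun k => mint (w k)) (fun k y _ => f0 k y).
move=> fat; apply: (@le_trans _ _ (\int[nu]_y limn_einf (f^~ y))%E).
  apply: integral_le_pointwise.
    by move=> y; rewrite lee_fin mulr_ge0 ?heat_pole_ge0.
  move=> y; have [pz|zp] := ltP (p y).2 z.2; last first.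
    rewrite heat_pole0// mulr0 limn_einf_lim; apply: lime_ge.
      exact: is_cvg_einfs.
    near=> k; apply: le_ereal_inf_tmp => _ [m _ <-]; exact: f0.
  have : f^~ y @ \oo --> (b y * heat_pole z (p y))%:E.
    apply: cvg_EFin; first by near=> k.
    apply: cvgMr.
    have A := continuous_heat_pole pz.
    exact: (cvg_comp w (fun v : X => heat_pole v (p y)) wz A).
  by move=> /cvg_limn_einf_sup[-> _].
apply: (le_trans fat); rewrite limn_einf_lim; apply: lime_le.
  exact: is_cvg_einfs.
near=> k; apply: ge_ereal_inf; exists (\int[nu]_y f k y)%E; last exact: wa.
by exists k => /=.
Unshelve. all: by end_near. Qed.

Lemma measurable_potential d' (T : measurableType d') (f : T -> X) :
  coord_measurable f -> measurable_fun setT (potential \o f).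
Proof.
move=> mf; pose F (x : T * Y) : \bar R := (b x.2 * heat_pole (f x.1) (p x.2))%:E.
apply: (@measurable_fun_fubini_tonelli_F _ _ T Y R nu F).
  apply/measurable_EFinP/measurable_funM.
    exact: (measurableT_comp mb measurable_snd).
  apply: measurable_heat_pole.
    exact: (coord_measurable_comp mf measurable_fst).
  exact: (coord_measurable_comp mp measurable_snd).
by move=> x; rewrite lee_fin mulr_ge0 ?heat_pole_ge0.
Qed.

Lemma lower_semicontinuous_potential : lower_semicontinuous potential.
Proof.
move=> z a az; apply: contrapT => nV.
have H (k : nat) : exists w : X, ball z k.+1%:R^-1 w /\ (potential w <= a%:E)%E.
  apply: contrapT => nw; apply: nV.
  exists (ball z k.+1%:R^-1); first by apply: nbhsx_ballx.
  move=> w zw; rewrite ltNge; apply/negP => wa; apply: nw; by exists w.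
have [w Hw] := choice H.
have wz : w @ \oo --> z.
  apply/cvg_ballP => e e0; near=> k.
  apply: (@le_ball _ _ z k.+1%:R^-1); last by have [] := Hw k.
  by apply/ltW; near: k; exact: (near_infty_natSinv_lt (PosNum e0)).
have := potential_lim_le wz (fun k => (Hw k).2).
by rewrite leNgt az.
Unshelve. all: by end_near. Qed.

End potential.

(** * Supercaloric functions *)

Lemma ereal_between (R : realType) (x y : \bar R) :
  (0 <= x)%E -> (x < y)%E -> exists a : R, (x < a%:E)%E /\ (a%:E < y)%E.
Proof.
case: x => [x| |]//; case: y => [y| |]//= x0; last first.
  by move=> _; exists (x + 1); rewrite lte_fin ltrDl ltr01 ltry.
rewrite lte_fin => xy; exists ((x + y) / 2).
by rewrite !lte_fin; split; lra.
Qed.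

Section potential_theory.
Context (R : realType) (n : nat).
Local Notation mR := (measurableTypeR R).
Local Notation leb := (lebesgue_tuple R n).
Local Notation X := (spacetime R n).
Implicit Types (u v : X -> \bar R) (z : X) (a b c r s t : R).

Lemma nbhs_box z (V : set X) : nbhs z V -> exists2 e : R, 0 < e &
  forall w : X, (forall i, `|w.1 ord0 i - z.1 ord0 i| < e) ->
    `|w.2 - z.2| < e -> V w.
Proof.
move=> /nbhs_ballP[e /= e0 eV]; exists e => // w w1 w2; apply: eV; split.
  split => // i j; rewrite !ord1/= /ball/= distrC; exact: w1.
by rewrite /ball/= distrC.
Qed.

Lemma heat_semigroup_mono t u v z : (forall w, 0 <= u w)%E ->
  (forall y : 'rV[R]_n, u (y, z.2 - t)%R <= v (y, z.2 - t)%R)%E ->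
  (heat_semigroup t u z <= heat_semigroup t v z)%E.
Proof.
move=> u0 uv; rewrite !heat_semigroupE; apply: integral_le_pointwise => y.
  by rewrite mule_ge0// lee_fin heat_kernel_ge0.
by rewrite lee_wpmul2l// lee_fin heat_kernel_ge0.
Qed.

Lemma eq_heat_semigroup t u v z :
  (forall y : 'rV[R]_n, u (y, z.2 - t) = v (y, z.2 - t)) ->
  heat_semigroup t u z = heat_semigroup t v z.
Proof.
by move=> uv; rewrite !heat_semigroupE; apply: eq_integral => y _; rewrite uv.
Qed.

(** Comes from [expR (- y) <= 1 / y] with [y = b^2 / (8 t)] in [heat_kernel_tail]: the kernel at
    time [t] puts at most [tail_const b * t] of its mass outside the box of half-side [b]. *)
Definition tail_const (b : R) : R := 2 `^ (n%:R / 2) * 8 / b ^+ 2.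

Lemma tail_const_gt0 b : 0 < b -> 0 < tail_const b.
Proof. by move=> b0; rewrite divr_gt0 ?exprn_gt0// mulr_gt0// powR_gt0. Qed.

Lemma heat_kernel_far t b (x : 'rV[R]_n) i : 0 < t -> 0 < b ->
  b <= `|x ord0 i| -> heat_kernel t x <= tail_const b * t * heat_kernel (2 * t) x.
Proof.
move=> t0 b0 bi; have b2 : b ^+ 2 <= \sum_i x ord0 i ^+ 2.
  rewrite (bigD1 i)//= (@le_trans _ _ (x ord0 i ^+ 2))//.
    by rewrite -[leRHS]real_normK ?num_real// lerXn2r// nnegrE ltW.
  by rewrite lerDl sumr_ge0// => j _; rewrite sqr_ge0.
apply: (le_trans (heat_kernel_tail t0 b2)); rewrite ler_wpM2r ?heat_kernel_ge0//.
have -> : tail_const b * t = 2 `^ (n%:R / 2) * (8 * ((b ^+ 2)^-1 * t)).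
  by rewrite /tail_const !mulrA.
rewrite ler_wpM2l ?powR_ge0//.
rewrite expRN -[leRHS]invrK lef_pV2 ?posrE ?expR_gt0//; last first.
  by rewrite invr_gt0 mulr_gt0// mulr_gt0// invr_gt0 exprn_gt0.
have -> : (8 * ((b ^+ 2)^-1 * t))^-1 = b ^+ 2 / (8 * t).
  by rewrite !invfM invrK; field; rewrite !gt_eqF.
by apply: le_trans (expR_ge1Dx _); rewrite lerDr.
Qed.

Lemma heat_semigroup_ge_local t b c u z : 0 < t -> 0 < b -> 0 <= c ->
  (forall w, 0 <= u w)%E ->
  (forall y : 'rV[R]_n, (forall i, `|y ord0 i - z.1 ord0 i| < b) ->
     (c%:E <= u (y, (z.2 - t)%R))%E) ->
  ((c * (1 - tail_const b * t))%:E <= heat_semigroup t u z)%E.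
Proof.
move=> t0 b0 c0 u0 cu.
set C := tail_const b * t.
have C0 : 0 <= C by rewrite mulr_ge0 ?ltW// tail_const_gt0.
pose k s y : R := heat_kernel s (z.1 - row_of_tuple y).
have k0 s y : 0 <= k s y by exact: heat_kernel_ge0.
have mk s : measurable_fun setT (k s) by exact: measurable_heat_kernel.
(* As [u] is not assumed measurable, its integral is bounded below through an explicit measurable
   minorant: [g] is at most [c * k t] inside the box and vanishes outside, by the tail estimate. *)
pose g y : R := Num.max (c * k t y - c * C * k (2 * t) y) 0.
have mg : measurable_fun setT g.
  apply: measurable_maxr => //; apply: measurable_funB; exact: measurable_funM.
have g0 y : 0 <= g y by rewrite le_max lexx orbT.
have tail y i : b <= `|(row_of_tuple y) ord0 i - z.1 ord0 i| ->
    k t y <= C * k (2 * t) y.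
  move=> bi; apply: (heat_kernel_far (i := i)) => //.
  by rewrite !mxE distrC in bi *.
have gu y : ((g y)%:E <= (k t y)%:E * u (row_of_tuple y, z.2 - t)%R)%E.
  have [H|] := pselect (forall i, `|(row_of_tuple y) ord0 i - z.1 ord0 i| < b).
    apply: (@le_trans _ _ ((k t y)%:E * c%:E)%E); last first.
      by rewrite lee_wpmul2l ?lee_fin// cu.
    rewrite -EFinM lee_fin ge_max mulr_ge0// andbT mulrC lerBlDr lerDl.
    by rewrite mulr_ge0// mulr_ge0.
  move=> /existsNP[i /negP]; rewrite -leNgt => /tail Hk.
  have -> : g y = 0.
    by apply/max_idPr; rewrite subr_le0 -mulrA ler_wpM2l.
  by rewrite mule_ge0// lee_fin.
rewrite heat_semigroupE.
apply: (@le_trans _ _ (\int[leb]_y (g y)%:E)%E); last first.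
  by apply: integral_le_pointwise => // y; rewrite lee_fin.
have I1 : (\int[leb]_y (c * k t y)%:E = c%:E)%E.
  under eq_integral do rewrite EFinM.
  rewrite ge0_integralZl//.
  - by rewrite integral_heat_kernel// mule1.
  - exact/measurable_EFinP.
  - by move=> y _; rewrite lee_fin.
have I2 : (\int[leb]_y (c * C * k (2 * t) y)%:E = (c * C)%:E)%E.
  under eq_integral do rewrite EFinM.
  rewrite ge0_integralZl//.
  - by rewrite integral_heat_kernel ?mule1// mulr_gt0.
  - exact/measurable_EFinP.
  - by move=> y _; rewrite lee_fin.
  - by rewrite lee_fin mulr_ge0.
rewrite mulrBr mulr1 EFinB leeBlDr// -I2 -ge0_integralD//; first last.
- by apply/measurable_EFinP; exact: measurable_funM.
- by move=> y _; rewrite lee_fin mulr_ge0// mulr_ge0.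
- exact/measurable_EFinP.
- by move=> y _; rewrite lee_fin.
rewrite -[leLHS]I1; apply: integral_le_pointwise => y.
  by rewrite lee_fin mulr_ge0.
by rewrite -EFinD lee_fin -lerBlDr le_max lexx.
Qed.

(** By lower semicontinuity [u] stays above some [c] near [z], and for short times almost all of the
    Gaussian mass stays near [z]. *)
Lemma semigroup_sup_ge u z : (forall w, 0 <= u w)%E ->
  (forall a, a%:E < u z -> exists2 V, nbhs z V & forall w, V w -> a%:E < u w)%E ->
  (u z <= ereal_sup [set heat_semigroup t u z | t in [set t | (0 < t)%R]])%E.
Proof.
move=> u0 lscu; rewrite leNgt; apply/negP; set S := ereal_sup _ => Su.
have S0 : (0 <= S)%E.
  apply: le_ereal_sup_tmp; exists (heat_semigroup 1 u z).
    by exists 1 => //=; exact: ltr01.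
  rewrite heat_semigroupE; apply: integral_ge0 => y _.
  by rewrite mule_ge0// lee_fin heat_kernel_ge0.
have [a [Sa au]] := ereal_between S0 Su.
have [c [ac cu]] := ereal_between (ltW (le_lt_trans S0 Sa)) au.
have a0 : 0 <= a by rewrite -lee_fin ltW// (le_lt_trans S0).
have [V zV cV] := lscu _ cu.
have [e e0 eV] := nbhs_box zV.
rewrite lte_fin in ac; have c0 : 0 < c by exact: le_lt_trans ac.
pose K := tail_const e; have K0 : 0 < K by exact: tail_const_gt0.
(* The first bound keeps the time [z.2 - t] inside the box, the second gives
   [c * (1 - K * t) >= a]. *)
pose t := Num.min (e / 2) ((c - a) / (c * K)).
have t0 : 0 < t.
  rewrite lt_min; apply/andP; split; first by rewrite divr_gt0.
  by apply: divr_gt0; [rewrite subr_gt0|exact: mulr_gt0].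
have te : t < e by rewrite gt_min; apply/orP; left; lra.
have : (a%:E <= S)%E; last by rewrite leNgt Sa.
apply: le_ereal_sup_tmp; exists (heat_semigroup t u z); first by exists t.
apply: (@le_trans _ _ (c * (1 - K * t))%:E).
  rewrite lee_fin mulrBr mulr1 lerBrDr -lerBrDl mulrA.
  have : t <= (c - a) / (c * K) by rewrite ge_min lexx orbT.
  by rewrite ler_pdivlMr; [rewrite mulrC|exact: mulr_gt0].
apply: heat_semigroup_ge_local => //; first exact: ltW.
move=> y yz; apply/ltW/cV/eV => //=.
by rewrite addrAC subrr add0r normrN gtr0_norm.
Qed.

(** A sufficient condition for [hyperharmonic] that passes to minima and sums: lower semicontinuity
    yields both Borel measurability and the lower bound in the supremum formula. *)
Definition supercaloric u := [/\ lower_semicontinuous u, forall z, (0 <= u z)%E &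
  forall t z, 0 < t -> (heat_semigroup t u z <= u z)%E].

Lemma measurable_lsc u : lower_semicontinuous u ->
  measurable_fun setT (u : g_sigma_algebraType (@open X) -> \bar R).
Proof.
move=> scu; apply: (measurability _ (ErealGenOInfty.measurableE R)).
move=> /= _ [_ [a ->]] <-; rewrite setTI; apply: sub_sigma_algebra => /=.
by rewrite preimage_itvoy; move/lower_semicontinuousP : scu; exact.
Qed.

Lemma hyperharmonic_le t u z : hyperharmonic u -> 0 < t ->
  (heat_semigroup t u z <= u z)%E.
Proof. by move=> [_ _ <-] t0; apply: ereal_sup_ubound; exists t. Qed.

Lemma hyperharmonic_ge0 u z : hyperharmonic u -> (0 <= u z)%E.
Proof. by case. Qed.

Lemma supercaloric_hyperharmonic u : supercaloric u -> hyperharmonic u.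
Proof.
move=> [scu u0 Pu]; split => //; first exact: measurable_lsc.
move=> z; apply/eqP; rewrite eq_le; apply/andP; split.
  by apply: ge_ereal_sup => _ [t t0 <-]; exact: Pu.
by apply: semigroup_sup_ge => // a; exact: scu.
Qed.

Lemma supercaloric_min u v : supercaloric u -> supercaloric v ->
  supercaloric (fun z => Order.min (u z) (v z)).
Proof.
move=> [lu u0 Pu] [lv v0 Pv]; have m0 z : (0 <= Order.min (u z) (v z))%E.
  by rewrite le_min u0 v0.
split => //.
  move=> z a; rewrite lt_min => /andP[/lu[U zU aU] /lv[V zV aV]].
  exists (U `&` V); first exact: filterI.
  by move=> w [/aU ? /aV ?]; rewrite lt_min; apply/andP.
move=> t z t0; rewrite le_min; apply/andP; split.
  apply: le_trans (Pu t z t0); apply: heat_semigroup_mono => // y.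
  by rewrite ge_min lexx.
apply: le_trans (Pv t z t0); apply: heat_semigroup_mono => // y.
by rewrite ge_min lexx orbT.
Qed.

Definition infinite_after (r : R) z : \bar R := if r < z.2 then +oo%E else 0%E.

Lemma infinite_after_ge0 r z : (0 <= infinite_after r z)%E.
Proof. by rewrite /infinite_after; case: ifP; rewrite ?leey. Qed.

(* Adding [infinite_after r] makes every condition after time [r] void. *)
Lemma supercaloric_add_infinite_after r u : supercaloric u ->
  supercaloric (fun z => u z + infinite_after r z)%E.
Proof.
move=> [lu u0 Pu].
have m0 z : (0 <= u z + infinite_after r z)%E by rewrite adde_ge0 ?infinite_after_ge0.
split => //.
- move=> z a; have [rz _|zr] := ltP r z.2.
    exists [set w : X | r < w.2].
      by apply: (@open_comp _ _ snd [set x | r < x]) => //; first by move=> *; exact: cvg_snd.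
    by move=> w /= rw; rewrite /infinite_after rw addey ?ltry// gt_eqF// (lt_le_trans _ (u0 w)).
  have -> : infinite_after r z = 0%E by rewrite /infinite_after ltNge zr.
    rewrite adde0 => /lu[V zV aV].
  exists V => // w /aV /lt_le_trans; apply.
  by rewrite leeDl ?infinite_after_ge0.
- move=> t z t0; have [rz|zr] := ltP r z.2.
    have -> : infinite_after r z = +oo%E by rewrite /infinite_after rz.
    by rewrite addey ?leey// gt_eqF// (lt_le_trans _ (u0 z)).
  have -> : infinite_after r z = 0%E by rewrite /infinite_after ltNge zr.
  rewrite adde0.
  apply: le_trans (Pu t z t0); apply: heat_semigroup_mono => // y.
  rewrite /infinite_after/= ltNge (le_trans _ zr) ?adde0//.
  by rewrite gerBl ltW.
Qed.

Lemma supercaloric_add u v : supercaloric u -> supercaloric v ->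
  (forall s, measurable_fun setT (fun y : n.-tuple mR => u (row_of_tuple y, s))) ->
  (forall s, measurable_fun setT (fun y : n.-tuple mR => v (row_of_tuple y, s))) ->
  supercaloric (fun z => u z + v z)%E.
Proof.
move=> [lu u0 Pu] [lv v0 Pv] mu mv; split.
- move=> z a; case uz : (u z) (u0 z) => [x| |]// x0; last first.
    move=> _; have /lu[V zV aV] : (a%:E < u z)%E by rewrite uz ltry.
    by exists V => // w /aV /lt_le_trans; apply; rewrite leeDl.
  case vz : (v z) (v0 z) => [y| |]// y0; last first.
    move=> _; have /lv[V zV aV] : (a%:E < v z)%E by rewrite vz ltry.
    by exists V => // w /aV /lt_le_trans; apply; rewrite leeDr.
  rewrite -EFinD lte_fin => axy; pose e := (x + y - a) / 2.
  have e0 : 0 < e by rewrite divr_gt0// subr_gt0.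
  have /lu[U zU aU] : ((x - e)%:E < u z)%E by rewrite uz lte_fin ltrBlDr ltrDl.
  have /lv[V zV aV] : ((y - e)%:E < v z)%E by rewrite vz lte_fin ltrBlDr ltrDl.
  exists (U `&` V); first exact: filterI.
  move=> w [/aU uw /aV vw].
  have -> : a = (x - e) + (y - e) by rewrite /e; lra.
  by rewrite EFinD lteD.
- by move=> z; rewrite adde_ge0.
- move=> t z t0; rewrite heat_semigroupE.
  under eq_integral do rewrite ge0_muleDr//.
  rewrite ge0_integralD//; first by rewrite leeD//; [exact: Pu|exact: Pv].
  + by move=> y _; rewrite mule_ge0// lee_fin heat_kernel_ge0.
  + by apply: emeasurable_funM => //; apply/measurable_EFinP; exact: measurable_heat_kernel.
  + by move=> y _; rewrite mule_ge0// lee_fin heat_kernel_ge0.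
  + by apply: emeasurable_funM => //; apply/measurable_EFinP; exact: measurable_heat_kernel.
Qed.

(** The glued function may jump down across time [s], so lower semicontinuity can fail there and
    [supercaloric] is out of reach. The supremum formula survives by causality: up to time [s] only
    [u] is seen, and the times after [s] form an open set on which [v] is lower semicontinuous. *)
Lemma hyperharmonic_glue s u v : supercaloric u -> supercaloric v ->
  (forall t z, 0 < t -> s < z.2 -> z.2 - t <= s -> (heat_semigroup t u z <= v z)%E) ->
  hyperharmonic (fun z => if z.2 <= s then u z else v z).
Proof.
move=> [lu u0 Pu] [lv v0 Pv] uv; set w := fun _ => _.
have w0 z : (0 <= w z)%E by rewrite /w; case: ifP.
split => //.
- rewrite /borel.
  have ms : measurable ([set z | z.2 <= s] : set (g_sigma_algebraType (@open X))).
    rewrite -[X in measurable X]setCK; apply: measurableC.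
    apply: sub_sigma_algebra => /=.
    have -> : ~` [set z : X | z.2 <= s] = [set z : X | s < z.2].
      by apply/seteqP; split => z /=; rewrite ltNge; move/negP.
    by apply: (@open_comp _ _ snd [set x | s < x]) => //; move=> *; exact: cvg_snd.
  have -> : w = (fun z : g_sigma_algebraType (@open X) =>
      if (z : X).2 <= s then u z else v z) by [].
  apply: measurable_fun_ifT; [|exact: measurable_lsc|exact: measurable_lsc].
  apply: (measurable_fun_bool true).
  rewrite setTI (_ : _ @^-1` _ = [set z : X | z.2 <= s])//.
- move=> z; apply/eqP; rewrite eq_le; apply/andP; split.
    apply: ge_ereal_sup => _ [t /= t0 <-]; rewrite /w.
    have [zs|zs] := leP z.2 s.
      rewrite (eq_heat_semigroup (v := u)) ?Pu// => y /=.
      by rewrite (le_trans _ zs)// gerBl ltW.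
    have [zts|zts] := leP (z.2 - t) s.
      rewrite (eq_heat_semigroup (v := u)); first exact: uv.
      by move=> y; rewrite /= zts.
    rewrite (eq_heat_semigroup (v := v)) ?Pv// => y /=.
    by rewrite leNgt zts.
  have [zs|zs] := leP z.2 s.
    rewrite [leLHS]/w zs.
    apply: (@le_trans _ _ (ereal_sup [set heat_semigroup t u z | t in [set t | 0 < t]])).
      by apply: semigroup_sup_ge => // a; exact: lu.
    apply: ge_ereal_sup => _ [t /= t0 <-]; apply: le_ereal_sup_tmp.
    exists (heat_semigroup t w z); first by exists t.
    rewrite (@eq_heat_semigroup t w u)// => y; rewrite /w/=.
    by rewrite (le_trans _ zs)// gerBl ltW.
  apply: semigroup_sup_ge => // a; rewrite {1}/w leNgt zs/= => /lv[V zV aV].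
  exists (V `&` [set z | s < z.2]).
    apply: filterI => //.
    by apply: (@open_comp _ _ snd [set x | s < x]) => //; move=> *; exact: cvg_snd.
  by move=> y [/aV ay /= sy]; rewrite /w leNgt sy.
Qed.

(** A lower semicontinuous minorant of the reduit exceeding [C] at [z] would exceed some [c > C]
    nearby, hence so would every competitor [v], and [heat_semigroup k v z] would exceed [C] for
    small [k]. The competitor may depend on [k] and matters only through its values at time
    [z.2 - k]. *)
Lemma regularized_reduit_le u (T : set X) z (C : R) : 0 <= C ->
  (forall k0, 0 < k0 -> exists2 k, 0 < k < k0 & exists v, [/\ hyperharmonic v,
     forall w, T w -> (u w <= v w)%E & (heat_semigroup k v z <= C%:E)%E]) ->
  (regularized_reduit u T z <= C%:E)%E.
Proof.
move=> C0 H; apply: ge_ereal_sup => _ [g [lg gR] <-]; rewrite leNgt; apply/negP => Cg.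
have [c [Cc cg]] := ereal_between (C0 : (0 <= C%:E)%E) Cg.
rewrite lte_fin in Cc; have c0 : 0 < c by exact: le_lt_trans Cc.
have [V zV cV] := lg _ _ cg.
have [e e0 eV] := nbhs_box zV.
pose K := tail_const e; have K0 : 0 < K by exact: tail_const_gt0.
pose k0 := Num.min e ((c - C) / (c * K)).
have k00 : 0 < k0.
  rewrite lt_min; apply/andP; split; first by [].
  by apply: divr_gt0; [rewrite subr_gt0|exact: mulr_gt0].
have [k /andP[k_gt0 kk0] [v [hv uv Pv]]] := H _ k00.
have : ((c * (1 - K * k))%:E <= C%:E)%E.
  apply: le_trans Pv; apply: heat_semigroup_ge_local => //; first exact: ltW.
    by move=> w; exact: hyperharmonic_ge0.
  move=> y yz; apply: (@le_trans _ _ (g (y, z.2 - k))).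
    apply/ltW/cV/eV => //=; rewrite addrAC subrr add0r normrN gtr0_norm//.
    by move: kk0; rewrite lt_min => /andP[].
  by apply: (le_trans (gR _)); apply: ereal_inf_lbound; exists v.
rewrite lee_fin leNgt mulrBr mulr1 ltrBrDr -ltrBrDl mulrA.
move: kk0; rewrite lt_min => /andP[_].
by rewrite ltr_pdivlMr; [rewrite [k * _]mulrC => ->|exact: mulr_gt0].
Qed.

Lemma supercaloric_potential d (Y : measurableType d)
    (nu : {sigma_finite_measure set Y -> \bar R}) (b : Y -> R) (p : Y -> X) :
  measurable_fun setT b -> (forall y, 0 <= b y) -> coord_measurable p ->
  supercaloric (potential nu b p).
Proof.
move=> mb b0 mp; split.
- exact: lower_semicontinuous_potential.
- by move=> z; apply: potential_ge0.
- by move=> t z t0; apply: heat_semigroup_potential_le.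
Qed.

End potential_theory.

(** * Exponential caloric functions *)

Section caloric_exponential.
Context (R : realType) (n : nat).
Local Notation mR := (measurableTypeR R).
Local Notation leb := (lebesgue_tuple R n).
Local Notation X := (spacetime R n).
Implicit Types (u v : X -> \bar R) (z : X) (r s t : R) (a : 'rV[R]_n).

Definition exponential a z : R :=
  expR (\sum_i a ord0 i * z.1 ord0 i + (\sum_i a ord0 i ^+ 2) * z.2).

Lemma exponential_gt0 a z : 0 < exponential a z.
Proof. exact: expR_gt0. Qed.

Lemma exponential0 z : exponential 0 z = 1.
Proof.
rewrite /exponential !big1 ?mul0r ?addr0 ?expR0// => i _;
  by rewrite !mxE ?mul0r ?expr0n.
Qed.

(* Completing the square: an exponential weight shifts the Gaussian. *)
Lemma heat_kernel_exponential t a (x y : 'rV[R]_n) r : 0 < t ->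
  heat_kernel t (x - y) * exponential a (y, r - t) =
  heat_kernel t ((x + (2 * t) *: a) - y) * exponential a (x, r).
Proof.
move=> t0; have t0' : t != 0 by rewrite gt_eqF.
rewrite !heat_kernelE /exponential -!mulrA -!expRD; congr (_ * expR _) => /=.
rewrite !mulr_suml -!sumrN -!big_split/=; apply: eq_bigr => i _.
by rewrite !mxE; field.
Qed.

Lemma heat_semigroup_exponential t a z : 0 < t ->
  heat_semigroup t (fun w => (exponential a w)%:E) z = (exponential a z)%:E.
Proof.
move=> t0; rewrite heat_semigroupE; case: z => x r /=.
under eq_integral do rewrite -EFinM heat_kernel_exponential// mulrC EFinM.
rewrite ge0_integralZl//.
- by rewrite integral_heat_kernel ?mule1.
- by apply/measurable_EFinP; exact: measurable_heat_kernel.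
- by move=> y _; rewrite lee_fin heat_kernel_ge0.
- by rewrite lee_fin ltW// exponential_gt0.
Qed.

Lemma continuous_exponential a : continuous (exponential a).
Proof.
move=> z; apply: continuous_comp; last exact: continuous_expR.
apply: cvgD; last by apply: cvgMr; exact: cvg_snd.
apply: cvg_big => //=; first by move=> [b c]; exact: add_continuous.
by move=> i _; apply: cvgMr; exact: continuous_space_coord.
Qed.

Lemma supercaloric_exponential a : supercaloric (fun z : X => (exponential a z)%:E).
Proof.
split.
- move=> z b; rewrite lte_fin => bz; exists [set w | b < exponential a w]; last first.
    by move=> w /=; rewrite lte_fin.
  exact: (cvgr_gt _ (@continuous_exponential a z)).
- by move=> z; rewrite lee_fin ltW// exponential_gt0.
- by move=> t z t0; rewrite heat_semigroup_exponential.
Qed.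

(** A relatively compact [U] lies above some time [M]. The semigroup that leads from [z] down to
    time [M - 1] sees only points outside [U], where a competitor dominates the exponential; as the
    latter is caloric, the reduit on [U] is the function itself. *)
Lemma superharmonic_exponential a :
  superharmonic (fun z : X => (exponential a z)%:E).
Proof.
have H := supercaloric_hyperharmonic (supercaloric_exponential a).
split => // U oU cU.
have [M HM] : exists M : R, forall z, U z -> M <= z.2.
  have cs : compact (snd @` closure U : set R).
    apply: continuous_compact => //; apply: continuous_subspaceT => z.
    exact: cvg_snd.
  have [M [Mr HM]] := @compact_bounded R R^o _ cs.
  exists (- (M + 1)) => z Uz; rewrite lerNl.
  have : `|z.2| <= M + 1.
    apply: HM; first by rewrite ltrDl.
    by exists z => //; exact: subset_closure.
  by rewrite -normrN; apply: le_trans; exact: ler_norm.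
have RU z : U z -> reduit (fun z : X => (exponential a z)%:E) (~` U) z = (exponential a z)%:E.
  move=> Uz; apply/eqP; rewrite eq_le; apply/andP; split.
    by apply: ereal_inf_lbound; exists (fun z : X => (exponential a z)%:E).
  apply: le_ereal_inf_tmp => _ [v [hv uv] <-].
  pose t := z.2 - M + 1.
  have t0 : 0 < t by rewrite ltr_wpDl// subr_ge0 HM.
  apply: le_trans (hyperharmonic_le z hv t0).
  rewrite -(heat_semigroup_exponential a z t0); apply: heat_semigroup_mono.
    by move=> w; rewrite lee_fin ltW// exponential_gt0.
  move=> y; apply: uv => Uy; have := HM _ Uy.
  by rewrite /= /t; lra.
split; first by move=> z /RU ->.
apply: (@subspace_eq_continuous _ _ _ (exponential a)).
  by move=> z /set_mem Uz; rewrite /from_subspace /= RU.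
apply: continuous_subspaceT; exact: continuous_exponential.
Qed.

Lemma heat_semigroup_slice t z u (b : n.-tuple mR -> R) : 0 < t ->
  (forall y, u (row_of_tuple y, z.2 - t) = (b y)%:E) ->
  heat_semigroup t u z =
  potential leb b (fun y => (row_of_tuple y, z.2 - t)) z.
Proof.
move=> t0 ub; rewrite heat_semigroupE /potential; apply: eq_integral => y _.
rewrite ub heat_poleE/=; last by rewrite gtrBl.
have -> : z.2 - (z.2 - t) = t by ring.
by rewrite -EFinM mulrC.
Qed.

(** [P_t u = P_s (P_(t-s) u)] and [P_(t-s) u <= u]. The composition is read off from the potential
    [M] of the slice at time [z.2 - t], whose density has to be real valued. *)
Lemma heat_semigroup_nonincreasing s t z u (b : n.-tuple mR -> R) :
  supercaloric u -> 0 < s -> s < t -> measurable_fun setT b ->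
  (forall y, u (row_of_tuple y, z.2 - t) = (b y)%:E) ->
  (heat_semigroup t u z <= heat_semigroup s u z)%E.
Proof.
move=> [_ u0 Pu] s0 st mb ub; have t0 := lt_trans s0 st.
have b0 y : 0 <= b y by rewrite -lee_fin -ub.
have mp := @coord_measurable_slice R n (z.2 - t).
set M := potential leb b (fun y => (row_of_tuple y, z.2 - t)).
have Mz : heat_semigroup t u z = M z by exact: heat_semigroup_slice.
have -> : heat_semigroup t u z = heat_semigroup s M z.
  rewrite Mz heat_semigroup_potential//; apply: eq_integral => y _ /=.
  by rewrite ltrD2l ltrN2 st.
apply: heat_semigroup_mono; first by move=> w; exact: potential_ge0.
move=> y; have ts : 0 < t - s by rewrite subr_gt0.
apply: le_trans (Pu _ (y, z.2 - s) ts); rewrite (heat_semigroup_slice (b := b))//=.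
  by rewrite opprB addrA subrK.
by move=> y'; rewrite opprB addrA subrK.
Qed.

End caloric_exponential.

(** * Parabolic mass *)

Section merge.
Local Open Scope ereal_scope.

(** The function [f] is left free because coverings are summed with two gauges: the power of the
    side, and that power weighted by a heat kernel. *)
Lemma merge_sequences (R : realType) (Z : Type) (G : nat -> nat -> Z) :
  exists g : nat -> Z, [/\ forall i j, exists k, g k = G i j,
    forall k, exists i j, g k = G i j &
    forall f : Z -> \bar R, (forall z, 0 <= f z) ->
      \sum_(k <oo) f (g k) = \sum_(i <oo) \sum_(j <oo) f (G i j)].
Proof.
have /card_esym/ppcard_eqP[e] := card_nat2.
exists (uncurry G \o e); split.
- by move=> i j; exists (e^-1%FUN (i, j)); rewrite /= invK ?inE.
- by move=> k; exists (e k).1, (e k).2 => /=; case: (e k).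
move=> f f0; pose a := f \o uncurry G.
have a0 x : 0 <= a x by exact: f0.
transitivity (\esum_(i in setT) a i).
  rewrite -(esum_pred_image a _ xpredT) ?[fun=> _]set_true//.
  by rewrite image_eq.
rewrite (_ : esum _ _ = \sum_(i <oo) \sum_(j <oo) a (i, j)); last first.
  pose J : nat -> set (nat * nat) := fun i => [set (i, j) | j in setT].
  rewrite (_ : setT = \bigcup_k J k); last first.
    by rewrite predeqE => -[x b]; split => // _; exists x => //; exists b.
  rewrite esum_bigcupT /=; last 2 first.
    - apply/trivIsetP => i j _ _ ij.
      rewrite predeqE => -[x m] /=; split => //= -[] [_] _ [<-{x} _].
      by move=> [m' _] [] /esym/eqP; rewrite (negbTE ij).
    - by move=> /= x; exact: a0.
  rewrite -(image_id [set: nat]) -fun_true esum_pred_image//; last first.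
    by move=> x _; exact: esum_ge0.
  apply: eq_eseriesr => /= j _.
  rewrite -(esum_pred_image a (pair j) predT)//=; last first.
    by move=> ? ? _ _; exact: (@can_inj _ _ _ snd).
  by congr esum; rewrite predeqE => -[x b]; split; move=> [i _ <-]; exists i.
by [].
Qed.

End merge.

Section parabolic_mass.
Context (R : realType) (n : nat).
Local Notation X := (spacetime R n).
Implicit Types (A B Y : set X) (d e : R) (c : X * R) (g : nat -> X * R).

(* A cube is given by its centre and its side; side 0 encodes the empty set,
   so that countable families may be padded. *)
Definition cube c : set X :=
  [set w : X | [/\ 0 < c.2, forall i, `|w.1 ord0 i - c.1.1 ord0 i| <= c.2 / 2 &
               `|w.2 - c.1.2| <= c.2 ^+ 2 / 2]].

Definition cube_cover d A g :=
  (forall k, 0 <= (g k).2 <= d) /\ A `<=` \bigcup_k cube (g k).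

Definition cube_sum g : \bar R := (\sum_(k <oo) ((g k).2 ^+ n)%:E)%E.

Definition premass d A : \bar R := ereal_inf [set cube_sum g | g in cube_cover d A].

Definition mass A : \bar R := ereal_sup [set premass d A | d in [set d | 0 < d]].

Lemma cube_sum_ge0 d A g : cube_cover d A g -> (0 <= cube_sum g)%E.
Proof.
move=> [gd _]; apply: nneseries_ge0 => k _ _; rewrite lee_fin exprn_ge0//.
by have /andP[] := gd k.
Qed.

Lemma premass_ge0 d A : (0 <= premass d A)%E.
Proof. by apply: le_ereal_inf_tmp => _ [g hg <-]; exact: cube_sum_ge0 hg. Qed.

Lemma premass_mass d A : 0 < d -> (premass d A <= mass A)%E.
Proof. by move=> d0; apply: ereal_sup_ubound; exists d. Qed.

Lemma mass_ge0 A : (0 <= mass A)%E.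
Proof. exact: le_trans (premass_ge0 1 A) (premass_mass _ ltr01). Qed.

Lemma le_premass d A B : A `<=` B -> (premass d A <= premass d B)%E.
Proof.
move=> AB; apply: ereal_inf_le_tmp => _ [g [gd gB] <-]; exists g => //.
by split => //; exact: subset_trans gB.
Qed.

Lemma premass_antitone d e A : d <= e -> (premass e A <= premass d A)%E.
Proof.
move=> de; apply: ereal_inf_le_tmp => _ [g [gd gA] <-]; exists g => //.
by split => // k; have /andP[-> /le_trans->] := gd k.
Qed.

Lemma le_mass A B : A `<=` B -> (mass A <= mass B)%E.
Proof.
move=> AB; apply: ge_ereal_sup => _ [d d0 <-].
exact: le_trans (le_premass _ AB) (premass_mass _ d0).
Qed.

Lemma mass_cover A (M : R) d : 0 < d -> (mass A < M%:E)%E ->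
  exists2 g, cube_cover d A g & (cube_sum g < M%:E)%E.
Proof.
move=> d0 AM; have /ereal_inf_lt[_ [g hg <-] gM] := le_lt_trans (premass_mass A d0) AM.
by exists g.
Qed.

Hypothesis n_gt0 : (0 < n)%N.

Lemma mass0 : mass set0 = 0%E.
Proof.
apply/eqP; rewrite eq_le mass_ge0 andbT; apply: ge_ereal_sup => _ [d d0 <-].
apply: ereal_inf_lbound; exists (fun=> (0, 0)).
  by split => [k|//]; rewrite lexx ltW.
by apply: eseries0 => k _ _; rewrite expr0n gtn_eqF.
Qed.

Lemma premass_sigma_subadditive d (F : nat -> set X) : 0 < d ->
  (premass d (\bigcup_k F k) <= \sum_(k <oo) premass d (F k))%E.
Proof.
move=> d0; have [[i ioo]|] := pselect (exists i, premass d (F i) = +oo%E).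
  rewrite (eseries_pinfty _ _ ioo) ?leey// => k _.
  by rewrite -ltNye (lt_le_trans _ (premass_ge0 _ _)).
rewrite -forallNE => Foo; apply/lee_addgt0Pr => e e0.
rewrite (le_trans _ (epsilon_trick _ _ (ltW e0)))//; last first.
  by move=> k; exact: premass_ge0.
have [G HG] : {G : nat -> nat -> X * R & forall k, cube_cover d (F k) (G k) /\
    (cube_sum (G k) <= premass d (F k) + (e / (2 ^ k.+1)%:R)%:E)%E}.
  apply: (@choice _ _ (fun k g => cube_cover d (F k) g /\
    (cube_sum g <= premass d (F k) + (e / (2 ^ k.+1)%:R)%:E)%E)) => k.
  have pf : premass d (F k) \is a fin_num.
    by rewrite ge0_fin_numE ?premass_ge0// ltey; exact/eqP/Foo.
  have ek : 0 < e / (2 ^ k.+1)%:R by rewrite divr_gt0// ltr0n expn_gt0.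
  have [_ [g hg <-] gl] := lb_ereal_inf_adherent ek pf.
  by exists g; split => //; exact: ltW.
have [g [g1 g2 g3]] := merge_sequences R G.
(* The absolute value makes the gauge nonnegative on all pairs, as merging requires; on coverings it
   changes nothing. *)
pose f (c : X * R) : \bar R := (`|c.2| ^+ n)%:E.
have f0 c : (0 <= f c)%E by rewrite lee_fin exprn_ge0.
have fE g' A : cube_cover d A g' -> cube_sum g' = (\sum_(k <oo) f (g' k))%E.
  move=> [gd _]; apply: eq_eseriesr => k _; rewrite /f ger0_norm//.
  by have /andP[] := gd k.
have cg : cube_cover d (\bigcup_k F k) g.
  split => [k|w [i _ Fi]].
    by have [i [j ->]] := g2 k; have [[]] := HG i.
  have [j _ wj] := (HG i).1.2 _ Fi; have [k gk] := g1 i j.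
  by exists k => //; rewrite gk.
apply: (@le_trans _ _ (cube_sum g)); first by apply: ereal_inf_lbound; exists g.
rewrite (fE _ _ cg) g3//; apply: lee_nneseries => i _ //.
  by move=> _; apply: nneseries_ge0 => *; exact: f0.
by rewrite -(fE _ _ (HG i).1); exact: (HG i).2.
Qed.

Lemma mass_sigma_subadditive : sigma_subadditive mass.
Proof.
move=> F; apply: ge_ereal_sup => _ [d d0 <-].
apply: (le_trans (premass_sigma_subadditive _ d0)).
by apply: lee_nneseries => i *; [exact: premass_ge0|exact: premass_mass].
Qed.

(** On a cube of side at most 1 the function [phi] varies by at most the side, so a cube of side at
    most [(b - a) / 2] cannot meet both [B] and [C]; a fine covering of [Y] therefore splits into
    disjoint subfamilies covering [B] and [C]. *)
Lemma mass_separated (phi : X -> R) (a b : R) B C Y : a < b ->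
  (forall c w w', c.2 <= 1 -> cube c w -> cube c w' -> phi w - phi w' <= c.2) ->
  B `<=` Y -> C `<=` Y -> (forall w, B w -> phi w <= a) ->
  (forall w, C w -> b <= phi w) -> (mass B + mass C <= mass Y)%E.
Proof.
move=> ab lip BY CY Ba Cb.
have [Yoo|] := eqVneq (mass Y) +oo%E; first by rewrite Yoo leey.
rewrite -ltey => Yfin.
pose d0 := Num.min 1 ((b - a) / 2).
have d00 : 0 < d0 by rewrite lt_min ltr01 divr_gt0 ?subr_gt0.
have key d : 0 < d -> d <= d0 -> (premass d B + premass d C <= mass Y)%E.
  move=> d_gt0 dd0; apply: le_trans (premass_mass Y d_gt0).
  apply: le_ereal_inf_tmp => _ [g [gd gY] <-].
  (* Keeps the cubes that meet [A]; the others are replaced by the empty cube of side 0, which costs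
     nothing because [n > 0]. *)
  pose sel A k : X * R := if `[< exists w, A w /\ cube (g k) w >] then g k else (0, 0).
  have selc A : A `<=` Y -> cube_cover d A (sel A).
    move=> AY; split => [k|w Aw].
      by rewrite /sel; case: ifP => // _; rewrite lexx ltW.
    have [k _ kw] := gY _ (AY _ Aw); exists k => //.
    by rewrite /sel; case: ifP => // /asboolPn; case; exists w.
  apply: (@le_trans _ _ (cube_sum (sel B) + cube_sum (sel C))%E).
    by apply: leeD; apply: ereal_inf_lbound; [exists (sel B)|exists (sel C)] => //; exact: selc.
  have sel0 A : A `<=` Y -> forall k, 0 <= (sel A k).2.
    by move=> AY k; have [/(_ k)/andP[]] := selc _ AY.
  rewrite /cube_sum -nneseriesD//; last 2 first.
  - by move=> k _ _; rewrite lee_fin exprn_ge0// sel0.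
  - by move=> k _ _; rewrite lee_fin exprn_ge0// sel0.
  apply: lee_nneseries => [k _ _|k _].
    by rewrite adde_ge0// lee_fin exprn_ge0// sel0.
  rewrite -EFinD lee_fin; have /andP[gk0 gkd] := gd k.
  have z0 : (0 : R) ^+ n = 0 by rewrite expr0n gtn_eqF.
  rewrite /sel; case: ifPn => [/asboolP[w [Bw kw]]|_]; last first.
    by rewrite /= z0 add0r; case: ifP => //= _; rewrite z0 exprn_ge0.
  case: ifPn => [/asboolP[w' [Cw' kw']]|_]; last by rewrite /= z0 addr0.
  have gk1 : (g k).2 <= 1 by rewrite (le_trans gkd)// (le_trans dd0)// ge_min lexx.
  have gkab : (g k).2 <= (b - a) / 2.
    by rewrite (le_trans gkd)// (le_trans dd0)// ge_min lexx orbT.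
  have := lip _ _ _ gk1 kw' kw; have := Ba _ Bw; have := Cb _ Cw'.
  by move=> *; exfalso; lra.
have key2 d e : 0 < d -> 0 < e -> (premass d B + premass e C <= mass Y)%E.
  move=> d_gt0 e_gt0; pose m := Num.min d0 (Num.min d e).
  have m0 : 0 < m by rewrite lt_min d00 lt_min d_gt0 e_gt0.
  apply: le_trans (key m m0 _); last by rewrite ge_min lexx.
  by apply: leeD; apply: premass_antitone; rewrite !ge_min lexx ?orbT.
have fin_le A d : A `<=` Y -> 0 < d -> premass d A \is a fin_num.
  move=> AY d_gt0; rewrite ge0_fin_numE ?premass_ge0//.
  exact: le_lt_trans (premass_mass A d_gt0) (le_lt_trans (le_mass AY) Yfin).
have Bfin : mass B \is a fin_num.
  by rewrite ge0_fin_numE ?mass_ge0//; exact: le_lt_trans (le_mass BY) Yfin.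
rewrite addeC -leeBrDr//; apply: ge_ereal_sup => _ [e e_gt0 <-].
rewrite leeBrDr// addeC -leeBrDr ?fin_le//; apply: ge_ereal_sup => _ [d d_gt0 <-].
by rewrite leeBrDr ?fin_le// key2.
Qed.

Definition outer_mass : {outer_measure set X -> \bar R} :=
  HB.pack mass (isOuterMeasure.Build R X mass
    mass0 mass_ge0 le_mass mass_sigma_subadditive).

(** Caratheodory's argument for metric outer measures: the complement of the sublevel set is
    exhausted by the sets [D m], which are separated from it, and the remaining shells have summable
    mass. *)
Lemma mass_caratheodory (phi : X -> R) (a : R) :
  (forall c w w', c.2 <= 1 -> cube c w -> cube c w' -> phi w - phi w' <= c.2) ->
  forall Y, (mass (Y `&` [set w | (phi w <= a)%R]) +
             mass (Y `&` ~` [set w | (phi w <= a)%R]) <= mass Y)%E.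
Proof.
move=> lip Y; set H := [set w | _].
have [Yoo|] := eqVneq (mass Y) +oo%E; first by rewrite Yoo leey.
rewrite -ltey => Yfin.
pose t m : R := a + m.+1%:R^-1.
have t_lt m m' : (m < m')%N -> t m' < t m.
  by move=> mm; rewrite ltrD2l ltf_pV2 ?posrE// ltr_nat.
have at_ m : a < t m by rewrite ltrDl.
pose D m := Y `&` [set w | t m <= phi w].
(* Shells of one parity [j]: between two consecutive ones lies a shell of the other parity, so
   [mass_separated] makes their masses add up. *)
pose F j m := Y `&` [set w | t (2 * m + j).+2 <= phi w < t (2 * m + j).+1].
have sepD m : (mass (Y `&` H) + mass (D m) <= mass Y)%E.
  apply: (mass_separated (phi := phi) (at_ m)) => //.
  - by move=> w [].
  - by move=> w [].
  - by move=> w [].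
have sumF j N : (\sum_(0 <= m < N) mass (F j m) <= mass (D (2 * N + j)%N))%E.
  elim: N => [|N IH]; first by rewrite big_geq// mass_ge0.
  rewrite big_nat_recr//=; apply: (le_trans (leeD2r _ IH)); rewrite addeC.
  apply: (mass_separated (phi := phi) (t_lt (2 * N + j)%N (2 * N + j).+1 (ltnSn _))) => //.
  - move=> w [Yw /= /andP[tw _]]; split => //=; apply: le_trans tw.
    by rewrite le_eqVlt; apply/orP; left; apply/eqP; congr t; lia.
  - move=> w [Yw /= tw]; split => //=; apply: le_trans tw.
    by apply/ltW/t_lt; lia.
  - by move=> w [_ /= /andP[_ /ltW]].
  - by move=> w [].
have sumFoo j : (\sum_(m <oo) mass (F j m) < +oo)%E.
  apply: le_lt_trans Yfin; apply: lime_le.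
    by apply: is_cvg_nneseries => *; exact: mass_ge0.
  near=> N; apply: le_trans (sumF j N) _.
  by apply: le_mass => w [].
have tail j := nneseries_tail_cvg (sumFoo j) (fun k _ => mass_ge0 (F j k)).
apply/lee_addgt0Pr => e e0.
have e20 : 0 < e / 2 by rewrite divr_gt0.
have [N [N0 N1]] : exists N, (\sum_(N <= m <oo) mass (F 0%N m) <= (e / 2)%:E)%E /\
    (\sum_(N <= m <oo) mass (F 1%N m) <= (e / 2)%:E)%E.
  have ev j : \forall N \near \oo, (\sum_(N <= m <oo) mass (F j m) < (e / 2)%:E)%E.
    apply: (tail j [set x | (x < (e / 2)%:E)%E]); apply: open_nbhs_nbhs; split.
      exact: open_ereal_lt_ereal.
    by rewrite /= lte_fin.
  have [N [/ltW N0 /ltW N1]] := filter_ex (filterI (ev 0%N) (ev 1%N)).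
  exists N; split; [exact: N0|exact: N1].
have cov : Y `&` ~` H `<=` D (2 * N).+1 `|`
    ((\bigcup_m F 0%N (m + N)%N) `|` (\bigcup_m F 1%N (m + N)%N)).
  move=> w [Yw /negP]; rewrite -ltNge => aw.
  have [tw|wt] := leP (t (2 * N).+1) (phi w); first by left.
  right.
  have [m [Nm tm mt]] : exists m, [/\ (2 * N <= m)%N, t m.+2 <= phi w & phi w < t m.+1].
    have ex : exists m, t m.+2 <= phi w.
      have [m _ /(_ m (leqnn m)) /= mw] := near_infty_natSinv_lt (PosNum (etrans (subr_gt0 _ _) aw)).
      exists m; rewrite /t -lerBrDl; apply/ltW; apply: lt_trans mw.
      by rewrite ltf_pV2 ?posrE// ltr_nat; lia.
    case: (ex_minnP ex) => m tm minm.
    have [Nm|mN] := leqP (2 * N) m.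
      exists m; split => //; case: m tm minm Nm => [|m] tm minm Nm.
        have -> : 1%N = (2 * N).+1 by lia. 
        exact: wt.
      by rewrite ltNge; apply/negP => /minm; rewrite ltnn.
    have : t (2 * N).+1 <= t m.+2.
      rewrite le_eqVlt; have [->|ne] := eqVneq (2 * N).+1 m.+2; first by rewrite eqxx.
      by apply/orP; right; apply: t_lt; lia.
    by move=> /le_trans /(_ tm); rewrite leNgt wt.
  have mE := odd_double_half m.
  case: (odd m) mE => /= mE; [right|left]; exists (m./2 - N)%N => //; split => //=.
    have -> : (2 * (m./2 - N + N) + 1 = m)%N by lia.
    by rewrite tm mt.
  have -> : (2 * (m./2 - N + N) + 0 = m)%N by lia.
  by rewrite tm mt.
have tailS j : (mass (\bigcup_m F j (m + N)%N) <= \sum_(N <= m <oo) mass (F j m))%E.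
  rewrite -(nneseries_addn (f := fun m => mass (F j m))); last by move=> *; exact: mass_ge0.
  exact: mass_sigma_subadditive.
have sub2 (A B : set X) : (mass (A `|` B) <= mass A + mass B)%E := outer_measureU2 outer_mass A B.
have : (mass (Y `&` ~` H) <= mass (D (2 * N).+1) + e%:E)%E.
  apply: (le_trans (le_mass cov)); apply: (le_trans (sub2 _ _)); apply: leeD => //.
  apply: (le_trans (sub2 _ _)).
  have -> : e = e / 2 + e / 2 by lra.
  by rewrite EFinD; apply: leeD; [exact: le_trans (tailS 0%N) N0|exact: le_trans (tailS 1%N) N1].
move=> H1; apply: (le_trans (leeD2l _ H1)); rewrite addeA.
exact: leeD2r.
Unshelve. all: by end_near. Qed.

End parabolic_mass.

(** * Potentials of cubes and polar sets *)

Lemma expe_pinfty (R : realType) (n : nat) : (0 < n)%N -> (+oo ^+ n)%E = +oo%E :> \bar R.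
Proof.
case: n => // m _; elim: m => [|m IH]; first by rewrite expeS expe0 mule1.
by rewrite expeS IH mulyy.
Qed.

Section parabolic_comparison.
Context (R : realType) (n : nat).
Local Notation X := (spacetime R n).
Hypothesis n_gt0 : (0 < n)%N.

(** Opposite corners of the spatial box at the central time differ by [rho] in every coordinate, and
    [n_gt0] supplies one. As [mass] is gauged by sides, this bounds it by the parabolic measure. *)
Lemma parabolic_cube_diam (x : X) (rho : R) : 0 <= rho ->
  (rho%:E <= euclidean_diam (parabolic_cube x rho))%E.
Proof.
move=> r0; pose h : X := (const_mx (rho / 2), 0).
pose h' : X := (const_mx (- (rho / 2)), 0).
have r2 : 0 <= rho / 2 by rewrite divr_ge0.
have q2 : 0 <= rho ^+ 2 / 2 by rewrite divr_ge0// sqr_ge0.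
apply: le_ereal_sup_tmp; exists (euclidean_dist (x + h) (x + h'))%:E.
  exists (x + h, x + h') => //; split => /=.
    exists h => //; split => [i|] /=.
      by rewrite mxE in_itv/= lexx andbT; lra.
    by rewrite in_itv/=; apply/andP; split; lra.
  exists h' => //; split => [i|] /=.
    by rewrite mxE in_itv/= lexx/=; lra.
  by rewrite in_itv/=; apply/andP; split; lra.
rewrite lee_fin /euclidean_dist sqr_euclidean_norm /=.
rewrite -[leLHS]ger0_norm// -sqrtr_sqr ler_wsqrtr// ler_wpDr ?sqr_ge0//.
rewrite (bigD1 (Ordinal n_gt0))//= !mxE ler_wpDr ?sumr_ge0//.
  by move=> i _; rewrite sqr_ge0.
rewrite le_eqVlt; apply/orP; left; apply/eqP; congr (_ ^+ 2); lra.
Qed.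

Lemma premass_le_parabolic d (A : set X) :
  (premass d A <= parabolic_premeasure d A)%E.
Proof.
apply: le_ereal_inf_tmp => _ [[x rho] [/= r0 Acov dd] <-].
have rd k : rho k <= d.
  by rewrite -lee_fin; apply/ltW/(le_lt_trans _ (dd k))/parabolic_cube_diam/ltW.
pose g k : X * R := (x k, rho k).
apply: (@le_trans _ _ (cube_sum g)).
  apply: ereal_inf_lbound; exists g => //; split => [k|w /Acov[k _ [p [p1 p2] <-]]].
    by rewrite /= ltW//=.
  exists k => //; split => //= [i|].
    rewrite !mxE addrAC subrr add0r ler_norml.
    by have := p1 i; rewrite in_itv/=.
  rewrite addrAC subrr add0r ler_norml.
  by move: p2; rewrite in_itv/=.
apply: lee_nneseries => [k _ _|k _]; first by rewrite lee_fin /g/= exprn_ge0// ltW.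
have : ((rho k)%:E <= euclidean_diam (parabolic_cube (x k) (rho k)))%E.
  exact/parabolic_cube_diam/ltW.
case: (euclidean_diam _) => [e| |]//=; last by move=> _; rewrite expe_pinfty// leey.
by rewrite -EFin_expe !lee_fin => re; rewrite lerXn2r// nnegrE ?(le_trans _ re)// ltW.
Qed.

Lemma mass_le_parabolic (A : set X) : (mass A <= parabolic_measure A)%E.
Proof.
(* Monotonicity in [delta] makes the [lim] of the definition a genuine limit, equal to the supremum
   over [delta > 0]. *)
have nif : {in Interval (BRight (0:R)) +oo%O &, nonincreasing_fun (fun d => parabolic_premeasure d A)}.
  move=> d e _ _ de; apply: ereal_inf_le_tmp => _ [[x rho] [/= r0 Acov dd] <-].
  by exists (x, rho) => //; split => //= k; exact: lt_le_trans (dd k) _.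
have := @nonincreasing_at_right_cvge R _ 0 +oo%O isT nif.
move=> /cvg_lim; rewrite /parabolic_measure => -> //.
apply: ge_ereal_sup => _ [d d0 <-].
apply: (le_trans (premass_le_parabolic d A)); apply: ereal_sup_ubound.
by exists d => //=; rewrite in_itv/= d0.
Qed.

End parabolic_comparison.

(** * The Caratheodory measure of the parabolic mass *)

Section mass_measure.
Context (R : realType) (n : nat).
Local Notation X := (spacetime R n).
Hypothesis n_gt0 : (0 < n)%N.

Definition mass_type := caratheodory_type (outer_mass R n_gt0).

Definition mass_measure : {measure set mass_type -> \bar R} :=
  outer_mass R n_gt0 : set (caratheodory_type (outer_mass R n_gt0)) -> \bar R.

Lemma mass_measureE (A : set X) : mass_measure A = mass A.
Proof. by []. Qed.

Lemma measurable_mass_type_lipschitz (phi : X -> R) :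
  (forall c w w', c.2 <= 1 -> cube c w -> cube c w' -> phi w - phi w' <= c.2) ->
  measurable_fun setT (phi : mass_type -> R).
Proof.
move=> lip; apply: (measurability _ (RGenOInfty.measurableE R)).
move=> /= _ [_ [a ->]] <-; rewrite setTI.
have -> : phi @^-1` `]a, +oo[ = ~` [set w | phi w <= a].
  by apply/seteqP; split => w /=; rewrite in_itv/= andbT ltNge => /negP.
apply: measurableC; apply: le_caratheodory_measurable => Y.
exact: mass_caratheodory.
Qed.

(** On a cube a spatial coordinate varies by at most the side and time by at most its square; the
    square is below the side because only sides at most 1 are considered, whence that restriction in
    [mass_caratheodory]. *)
Lemma coord_measurable_mass_type : coord_measurable (id : mass_type -> X).
Proof.
split => [i|]; apply: measurable_mass_type_lipschitz => c w w' c1 [c0 cw ctw] [_ cw' ctw'].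
  have /= := cw i; have /= := cw' i; rewrite !ler_norml => /andP[? ?] /andP[? ?].
  lra.
have c2 : c.2 ^+ 2 <= c.2 by rewrite expr2 ler_piMl// ltW.
by move: ctw ctw'; rewrite !ler_norml => /andP[? ?] /andP[? ?]; lra.
Qed.

Lemma measurable_cube c : measurable (cube c : set mass_type).
Proof.
have [m1 m2] := coord_measurable_mass_type.
have mle (f : X -> R) (a b : R) : measurable_fun setT (f : mass_type -> R) ->
    measurable ([set w | `|f w - a| <= b] : set mass_type).
  move=> mf; have := mf measurableT _ (measurable_itv `[a - b, a + b]); rewrite setTI.
  congr (measurable _); apply/seteqP; split => w /=; by rewrite in_itv/= ler_distl.
have [c0|c0] := ltP 0 c.2; last first.
  rewrite (_ : cube c = set0)//.
  by apply/seteqP; split => w //= -[]; rewrite ltNge c0.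
have -> : cube c = (\bigcap_(i in [set: 'I_n]) [set w : X | `|w.1 ord0 i - c.1.1 ord0 i| <= c.2 / 2]) `&`
   [set w : X | `|w.2 - c.1.2| <= c.2 ^+ 2 / 2].
  apply/seteqP; split => w [].
    by move=> ? w1 w2; split => // i _; exact: w1.
  by move=> w1 w2; split => // i; exact: w1.
apply: measurableI; last exact: mle.
apply: fin_bigcap_measurable => // i _.
exact: (mle (fun w : X => w.1 ord0 i)).
Qed.

End mass_measure.

Lemma powR_antitone (R : realType) (p x y : R) : 0 <= p -> 0 < x -> x <= y ->
  y `^ (- p) <= x `^ (- p).
Proof.
move=> p0 x0 xy; have y0 := lt_le_trans x0 xy.
rewrite !powRN lef_pV2 ?posrE ?powR_gt0//.
by apply: ge0_ler_powR => //; rewrite nnegrE ltW.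
Qed.

Section cube_potential.
Context (R : realType) (n : nat).
Local Notation X := (spacetime R n).
Implicit Types (c : X * R) (g : nat -> X * R).

Definition base c : X := (c.1.1, c.1.2 - c.2 ^+ 2).

(** At most [3/2 * side^2] elapses between the base and a point of the cube, so
    [4 * pi * t <= 6 * pi * side^2]; at least [side^2 / 2] elapses and [|x|^2 <= n * side^2 / 4], so
    the exponent is at most [n / 8]. *)
Definition cube_const : R := (6 * pi) `^ (n%:R / 2) * expR (n%:R / 8).

Lemma cube_const_gt0 : 0 < cube_const.
Proof. by rewrite mulr_gt0 ?expR_gt0// powR_gt0// mulr_gt0// pi_gt0. Qed.

Lemma cube_base_time c w : cube c w ->
  c.2 ^+ 2 / 2 <= w.2 - (base c).2 <= 3 / 2 * c.2 ^+ 2.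
Proof.
by move=> [_ _]; rewrite ler_norml /= => /andP[? ?]; apply/andP; split; lra.
Qed.

Lemma cube_base_lt c w : cube c w -> (base c).2 < w.2.
Proof.
move=> cw; have [c0 _ _] := cw; have /andP[+ _] := cube_base_time cw.
by rewrite -subr_gt0; apply: lt_le_trans; rewrite divr_gt0// exprn_gt0.
Qed.

Lemma heat_pole_cube c w : cube c w ->
  1 <= cube_const * c.2 ^+ n * heat_pole w (base c).
Proof.
move=> cw; have [c0 cx _] := cw; have /andP[t1 t2] := cube_base_time cw.
have pt := cube_base_lt cw; rewrite heat_poleE// heat_kernelE.
set t := w.2 - _ in t1 t2 *; have t0 : 0 < t by rewrite subr_gt0.
have c20 : 0 < c.2 ^+ 2 by rewrite exprn_gt0.
have p6 : 0 < 6 * pi :> R by rewrite mulr_gt0// pi_gt0.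
have A1 : (6 * pi * c.2 ^+ 2) `^ (- (n%:R / 2)) <= (4 * pi * t) `^ (- (n%:R / 2)).
  have p0 := pi_gt0 R; apply: powR_antitone; first by rewrite divr_ge0.
    by rewrite mulr_gt0// mulr_gt0.
  have : pi * t <= pi * (3 / 2 * c.2 ^+ 2) by rewrite ler_pM2l.
  lra.
have A2 : cube_const * c.2 ^+ n * ((6 * pi * c.2 ^+ 2) `^ (- (n%:R / 2)) * expR (- (n%:R / 8))) = 1.
  rewrite /cube_const [(_ * c.2 ^+ 2) `^ _]powRM ?ltW// [(6 * pi) `^ (- _)]powRN [in X in _ * (X * _)]mulrC.
  have -> : (c.2 ^+ 2) `^ (- (n%:R / 2)) = (c.2 ^+ n)^-1.
    rewrite powRN -powR_mulrn ?ltW// -powRrM mulrCA divff// mulr1 powR_mulrn// ltW//.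
  rewrite expRN; have e0 : expR (n%:R / 8) != 0 :> R by rewrite gt_eqF// expR_gt0.
  have f0 : (6 * pi) `^ (n%:R / 2) != 0 :> R by rewrite gt_eqF// powR_gt0.
  have g0 : c.2 ^+ n != 0 by rewrite gt_eqF// exprn_gt0.
  by field; rewrite e0 f0 g0.
rewrite -[leLHS]A2 ler_pM2l; last first.
  by apply: mulr_gt0; [exact: cube_const_gt0|exact: exprn_gt0].
apply: ler_pM; rewrite ?powR_ge0 ?expR_ge0//.
rewrite ler_expR lerN2 ler_pdivrMr ?mulr_gt0//.
have S1 : \sum_i (w.1 - (base c).1) ord0 i ^+ 2 <= n%:R * (c.2 ^+ 2 / 4).
  rewrite mulr_natl -[X in _ *+ X]card_ord -sumr_const; apply: ler_sum => i _.
  have := cx i; rewrite !mxE => ci.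
  rewrite -[leLHS]real_normK ?num_real//.
  have -> : c.2 ^+ 2 / 4 = (c.2 / 2) ^+ 2 by field.
  by rewrite lerXn2r// nnegrE// divr_ge0// ltW.
apply: (le_trans S1); have -> : n%:R / 8 * (4 * t) = n%:R * (t / 2) by field.
by rewrite ler_wpM2l//; lra.
Qed.

Local Opaque cube_const.

Lemma heat_pole_le (k : R) (z p : X) : 0 < k -> k <= z.2 - p.2 ->
  heat_pole z p <= (4 * pi * k) `^ (- (n%:R / 2)) :> R.
Proof.
move=> k0 kz; have zp : 0 < z.2 - p.2 by exact: lt_le_trans kz.
rewrite heat_poleE; last by rewrite -subr_gt0.
apply: (le_trans (heat_kernel_le _ zp)).
have p0 := pi_gt0 R; apply: powR_antitone; first by rewrite divr_ge0.
  by rewrite mulr_gt0// mulr_gt0.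
by rewrite ler_pM2l// mulr_gt0.
Qed.

Definition sigma_finite_counting_measure : {sigma_finite_measure set nat -> \bar R} :=
  HB.pack (@counting nat R) (@Measure_isSigmaFinite.Build _ _ _ (@counting nat R)
    (sigma_finite_counting R)).

(** Normalised through [heat_pole_cube], so that the [k]-th term alone is at least [b k] on the
    [k]-th cube. *)
Definition cube_potential g (b : nat -> R) : X -> \bar R :=
  potential sigma_finite_counting_measure (fun k => cube_const * (g k).2 ^+ n * b k) (fun k => base (g k)).

Section fixed_family.
Variables (g : nat -> X * R) (b : nat -> R).
Hypotheses (g0 : forall k, 0 <= (g k).2) (b0 : forall k, 0 <= b k).

Let coeff_ge0 k : 0 <= cube_const * (g k).2 ^+ n * b k.
Proof.
apply: mulr_ge0 => //; apply: mulr_ge0; first exact/ltW/cube_const_gt0.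
exact: exprn_ge0.
Qed.

Let meas d (T : measurableType d) (f : nat -> T) : measurable_fun setT f.
Proof. by []. Qed.

Let mbase : coord_measurable (fun k => base (g k)).
Proof. by split. Qed.

Lemma cube_potentialE z : cube_potential g b z =
  (\sum_(k <oo) (cube_const * (g k).2 ^+ n * b k * heat_pole z (base (g k)))%:E)%E.
Proof.
rewrite /cube_potential /potential ge0_integral_count// => k.
by rewrite lee_fin mulr_ge0 ?coeff_ge0 ?heat_pole_ge0.
Qed.

Lemma supercaloric_cube_potential : supercaloric (cube_potential g b).
Proof. by apply: supercaloric_potential; [exact: meas|exact: coeff_ge0|exact: mbase]. Qed.

Lemma measurable_cube_potential d (T : measurableType d) (f : T -> X) :
  coord_measurable f -> measurable_fun setT (cube_potential g b \o f).
Proof. by apply: measurable_potential; [exact: meas|exact: coeff_ge0|exact: mbase]. Qed.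

Lemma heat_semigroup_cube_potential t z : 0 < t ->
  heat_semigroup t (cube_potential g b) z =
  (\sum_(k <oo) (cube_const * (g k).2 ^+ n * b k *
     if (base (g k)).2 < z.2 - t then heat_pole z (base (g k)) else 0)%:E)%E.
Proof.
move=> t0; rewrite heat_semigroup_potential; [|exact: meas|exact: coeff_ge0|exact: mbase|by []].
rewrite ge0_integral_count// => k.
rewrite lee_fin mulr_ge0 ?coeff_ge0//; case: ifP => // _; exact: heat_pole_ge0.
Qed.

Lemma cube_potential_ge k w : cube (g k) w -> ((b k)%:E <= cube_potential g b w)%E.
Proof.
move=> kw; rewrite cube_potentialE.
have F0 i : (0 <= (cube_const * (g i).2 ^+ n * b i * heat_pole w (base (g i)))%:E)%E.
  by rewrite lee_fin mulr_ge0 ?coeff_ge0 ?heat_pole_ge0.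
apply: le_trans (nneseries_lim_ge k.+1 (fun i _ _ => F0 i)).
rewrite big_nat_recr//=; apply: (@le_trans _ _ (cube_const * (g k).2 ^+ n * b k * heat_pole w (base (g k)))%:E).
  rewrite lee_fin [_ * b k * _]mulrAC -[leLHS]mul1r ler_wpM2r//.
  exact: heat_pole_cube.
by rewrite leeDr// sume_ge0.
Qed.

End fixed_family.

Lemma regularized_reduit_ge0 (u : X -> \bar R) A z : (0 <= regularized_reduit u A z)%E.
Proof.
apply: ereal_sup_ubound; exists (cst 0%E) => //; split.
  by move=> w a a0; exists setT => //; exact: filterT.
move=> w; apply: le_ereal_inf_tmp => _ [v [hv _] <-]; exact: hyperharmonic_ge0.
Qed.

(** The semigroup at time [k] discards the poles after [z.2 - k], and the others are seen from [z]
    with kernel at most [a]; the cost is thus at most [cube_const * a] times the total gauge,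
    wherever the cubes are. *)
Lemma mass0_polar (A : set X) : mass A = 0%E -> polar A.
Proof.
move=> A0 z; apply/eqP; rewrite eq_le regularized_reduit_ge0 andbT.
apply/lee_addgt0Pr => e e0; rewrite add0e.
apply: regularized_reduit_le; first exact: ltW.
move=> k0 k00; pose k := k0 / 2; have k_gt0 : 0 < k by rewrite divr_gt0.
exists k; first by rewrite k_gt0/= /k; lra.
pose a : R := (4 * pi * k) `^ (- (n%:R / 2)).
have a0 : 0 < a by rewrite powR_gt0// mulr_gt0// mulr_gt0// pi_gt0.
pose M := e / (cube_const * a).
have M0 : 0 < M by rewrite divr_gt0// mulr_gt0// cube_const_gt0.
have [g [gd Ag] gM] : exists2 g, cube_cover 1 A g & (cube_sum g < M%:E)%E.
  by apply: mass_cover => //; rewrite A0 lte_fin.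
have g0 j : 0 <= (g j).2 by have /andP[] := gd j.
exists (cube_potential g (fun=> 1)); split.
- exact/supercaloric_hyperharmonic/supercaloric_cube_potential.
- by move=> w /Ag[j _ jw]; apply: (cube_potential_ge (b := fun=> 1)) jw.
- rewrite heat_semigroup_cube_potential//.
  apply: (@le_trans _ _ (\sum_(j <oo) ((cube_const * a)%:E * ((g j).2 ^+ n)%:E))%E).
    apply: lee_nneseries => j _.
      rewrite lee_fin mulr_ge0//.
        by rewrite mulr1 mulr_ge0 ?exprn_ge0// (ltW cube_const_gt0).
      by case: ifP => // _; exact: heat_pole_ge0.
    rewrite -EFinM lee_fin mulr1 mulrAC -mulrA -[leRHS]mulrA.
    rewrite ler_wpM2l ?(ltW cube_const_gt0)// ler_wpM2r ?exprn_ge0//.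
    case: ifP => [bk|_]; last exact: ltW.
    by apply: heat_pole_le => //; rewrite lerBrDr -lerBrDl ltW.
  rewrite nneseriesZl; last by move=> j _; rewrite lee_fin exprn_ge0.
  apply: (@le_trans _ _ ((cube_const * a)%:E * M%:E)%E).
    apply: lee_wpmul2l; last exact: ltW gM.
    by rewrite lee_fin; apply: mulr_ge0; apply: ltW => //; exact: cube_const_gt0.
  by rewrite -EFinM lee_fin /M mulrC divfK// gt_eqF// mulr_gt0// cube_const_gt0.
Qed.

(** Any small multiple [b] of the potential is still infinite on the set, while after time [k] it
    costs at most [b * a] times the finite total mass. *)
Lemma potential_infinite_polar d (Y : measurableType d)
    (nu : {finite_measure set Y -> \bar R}) (p : Y -> X) : coord_measurable p ->
  polar [set z | potential nu (cst 1) p z = +oo%E].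
Proof.
move=> mp z; apply/eqP; rewrite eq_le regularized_reduit_ge0 andbT.
apply/lee_addgt0Pr => e e0; rewrite add0e.
apply: regularized_reduit_le; first exact: ltW.
move=> k0 k00; pose k := k0 / 2; have k_gt0 : 0 < k by rewrite divr_gt0.
exists k; first by rewrite k_gt0/= /k; lra.
pose a : R := (4 * pi * k) `^ (- (n%:R / 2)).
have a0 : 0 < a by rewrite powR_gt0// mulr_gt0// mulr_gt0// pi_gt0.
have nuf : nu setT \is a fin_num by exact: fin_num_measure.
pose m := fine (nu setT) + 1.
have m0 : 0 < m by rewrite ltr_wpDl// fine_ge0.
pose b := e / (a * m); have b0 : 0 < b by rewrite divr_gt0// mulr_gt0.
have b0' (y : Y) : 0 <= cst b y by exact: ltW.
exists (potential nu (cst b) p); split.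
- apply: supercaloric_hyperharmonic; split.
  + exact: lower_semicontinuous_potential.
  + by move=> w; exact: potential_ge0.
  + by move=> t w; exact: heat_semigroup_potential_le.
- move=> w /= wi; rewrite /potential.
  under eq_integral do rewrite /cst EFinM.
  rewrite ge0_integralZl//.
  + have -> : (\int[nu]_x (heat_pole w (p x))%:E = +oo)%E.
      by rewrite -wi; apply: eq_integral => y _; rewrite /= mul1r.
    by rewrite gt0_muley ?leey// lte_fin.
  + by apply/measurable_EFinP; apply: measurable_heat_pole.
  + by move=> y _; rewrite lee_fin heat_pole_ge0.
  + by rewrite lee_fin ltW.
- rewrite heat_semigroup_potential//.
  apply: (@le_trans _ _ (\int[nu]_y (b * a)%:E)%E).
    apply: integral_le_pointwise => y.
      rewrite lee_fin mulr_ge0// ?(ltW b0)//.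
      by case: ifP => // _; exact: heat_pole_ge0.
    rewrite lee_fin ler_wpM2l ?(ltW b0)//.
    case: ifP => [bk|_]; last exact: ltW.
    by apply: heat_pole_le => //; rewrite lerBrDr -lerBrDl ltW.
  rewrite integral_cst//.
  apply: (@le_trans _ _ ((b * a)%:E * (fine (nu setT))%:E)%E); first by rewrite fineK.
  rewrite -EFinM lee_fin.
  apply: (@le_trans _ _ (b * a * m)).
    by apply: ler_wpM2l; [apply: mulr_ge0; exact: ltW|rewrite /m lerDl].
  by rewrite /b -mulrA divfK// gt_eqF// mulr_gt0.
Qed.

Lemma polar_totally_thin (A : set X) : polar A -> totally_thin A.
Proof.
move=> pA z; exists (cst 1%E).
  have := superharmonic_exponential (0 : 'rV[R]_n).
  by under eq_fun do rewrite exponential0.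
by rewrite pA.
Qed.

End cube_potential.

(** * Efficient coverings *)

Section efficient_cover.
Context (R : realType) (n : nat).
Local Notation X := (spacetime R n).
Local Notation mR := (measurableTypeR R).
Local Notation leb := (lebesgue_tuple R n).
Hypothesis n_gt0 : (0 < n)%N.
Local Notation mu := (mass_measure R n_gt0).
Implicit Types (c : X * R) (g : nat -> X * R) (A : set X).

(** A cube that meets [A] lies near a point of [A]; this is how estimates at points of [A] are
    transferred to the bases of the cubes. *)
Definition meeting A g := forall k, (g k).2 = 0 \/ exists2 w, A w & cube (g k) w.

Lemma cover_meeting A (M : R) d : 0 < d -> (mass A < M%:E)%E ->
  exists g, [/\ cube_cover d A g, meeting A g & (cube_sum g < M%:E)%E].
Proof.
move=> d0 AM; have [g [gd Ag] gM] := mass_cover d0 AM.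
pose h k : X * R := if `[< exists2 w, A w & cube (g k) w >] then g k else (0, 0).
have hg k : 0 <= (h k).2 <= (g k).2.
  rewrite /h; have /andP[g0 _] := gd k.
  by case: ifP => _ /=; rewrite ?lexx ?g0.
exists h; split.
- split => [k|w Aw].
    by have /andP[-> /le_trans->//] := hg k; have /andP[] := gd k.
  have [k _ kw] := Ag _ Aw; exists k => //.
  by rewrite /h; case: ifPn => // /asboolPn; case; exists w.
- by move=> k; rewrite /h; case: ifPn => [/asboolP|_]; [right|left].
- apply: le_lt_trans gM; apply: lee_nneseries => [k _ _|k _].
    by rewrite lee_fin exprn_ge0//; have /andP[] := hg k.
  rewrite lee_fin; have /andP[h0 hk] := hg k.
  by rewrite lerXn2r// nnegrE// (le_trans h0).
Qed.

(** As [s >= 2 t], the exponent on the right is at most [|y|^2 / (8 t)], and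
    [|y|^2 / 2 <= |x|^2 + |x - y|^2]; the last term contributes at most [n] to the exponent. As
    [s <= 4 t], the normalisations differ by at most [4^(n/2)]. *)
Lemma heat_kernel_harnack t s (x y : 'rV[R]_n) : 0 < t -> 2 * t <= s -> s <= 4 * t ->
  \sum_i (x ord0 i - y ord0 i) ^+ 2 <= n%:R * t ->
  heat_kernel t x <= 4 `^ (n%:R / 2) * expR n%:R * heat_kernel s y.
Proof.
move=> t0 ts st xy; have s0 : 0 < s by lra.
rewrite !heat_kernelE [leRHS]mulrACA; have p0 := pi_gt0 R.
have p4 : 0 < 4 * pi * t by rewrite mulr_gt0// mulr_gt0.
apply: ler_pM; rewrite ?powR_ge0 ?expR_ge0//.
  have -> : (4 * pi * t) `^ (- (n%:R / 2)) =
    4 `^ (n%:R / 2) * (4 * (4 * pi * t)) `^ (- (n%:R / 2)).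
    rewrite [(4 * (4 * _ * _)) `^ _]powRM ?ltW// mulrA -powRD ?subrr ?powRr0 ?mul1r//.
    by apply/implyP => _; rewrite gt_eqF.
  rewrite ler_wpM2l ?powR_ge0//; apply: powR_antitone; first by rewrite divr_ge0.
    by rewrite mulr_gt0// mulr_gt0.
  by rewrite -!mulrA ler_pM2l// mulrCA ler_pM2l.
rewrite -expRD ler_expR.
have key : (\sum_i y ord0 i ^+ 2) / (4 * s) <=
    (\sum_i x ord0 i ^+ 2) / (4 * t) + (\sum_i (x ord0 i - y ord0 i) ^+ 2) / (4 * t).
  rewrite -mulrDl -big_split/=.
  apply: (@le_trans _ _ ((\sum_i y ord0 i ^+ 2) / (8 * t))).
    rewrite ler_wpM2l ?sumr_ge0//; first by move=> i _; rewrite sqr_ge0.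
    by rewrite lef_pV2 ?posrE ?mulr_gt0//; lra.
  have -> : (\sum_i y ord0 i ^+ 2) / (8 * t) = ((\sum_i y ord0 i ^+ 2) / 2) / (4 * t).
    by field; rewrite gt_eqF.
  rewrite ler_wpM2r ?invr_ge0 ?mulr_ge0 ?(ltW t0)// mulr_suml; apply: ler_sum => i _.
  have := sqr_ge0 (2 * x ord0 i - y ord0 i).
  move=> H; rewrite -subr_ge0.
  have -> : x ord0 i ^+ 2 + (x ord0 i - y ord0 i) ^+ 2 - y ord0 i ^+ 2 / 2 =
    (2 * x ord0 i - y ord0 i) ^+ 2 / 2 by field.
  by rewrite divr_ge0.
have : (\sum_i (x ord0 i - y ord0 i) ^+ 2) / (4 * t) <= n%:R.
  rewrite ler_pdivrMr ?mulr_gt0//; apply: (le_trans xy).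
  rewrite ler_wpM2l//; lra.
by lra.
Qed.

(** Moving a pole from a point of a cube to its base costs an amount linear in the side, uniformly
    as long as the pole is at least [k] in the past. The elapsed time only grows, so the
    normalisation decreases and only the exponent has to be estimated. *)
Lemma heat_kernel_perturb t s rho D k (x y : 'rV[R]_n) :
  0 < k -> k <= t -> t <= s -> s <= t + 3 / 2 * rho ^+ 2 -> 0 <= rho <= 1 ->
  0 <= D -> (forall i, `|x ord0 i| <= D) ->
  (forall i, `|x ord0 i - y ord0 i| <= rho / 2) ->
  heat_kernel s y <= heat_kernel t x +
    (4 * pi * k) `^ (- (n%:R / 2)) * n%:R * ((2 * D + 1) / (8 * k) + 3 * D ^+ 2 / (8 * k ^+ 2)) * rho.
Proof.
move=> k0 kt ts st /andP[r0 r1] D0 xD xy.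
have t0 := lt_le_trans k0 kt; have s0 := lt_le_trans t0 ts.
have p0 := pi_gt0 R; rewrite !heat_kernelE.
set a := (4 * pi * s) `^ _; set b := (4 * pi * t) `^ _; set e := (4 * pi * k) `^ _.
set u := (_ / (4 * s)); set v := (_ / (4 * t)); set L := (_ + _ / (8 * k ^+ 2)).
have ab : a <= b.
  apply: powR_antitone; first by rewrite divr_ge0.
    by rewrite mulr_gt0// mulr_gt0.
  by rewrite ler_pM2l// mulr_gt0.
have ae : a <= e.
  apply: powR_antitone; first by rewrite divr_ge0.
    by rewrite mulr_gt0// mulr_gt0.
  by rewrite ler_pM2l ?mulr_gt0//; lra.
have a0 : 0 <= a by rewrite powR_ge0.
have L0 : 0 <= L.
  rewrite addr_ge0// divr_ge0 ?mulr_ge0 ?sqr_ge0 ?addr_ge0 ?mulr_ge0//; exact: ltW.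
have uv : v - u <= n%:R * (L * rho).
  rewrite /u /v !mulr_suml -sumrB.
  have -> : n%:R * (L * rho) = \sum_(i < n) (L * rho).
    by rewrite sumr_const card_ord mulr_natl.
  apply: ler_sum => i _.
  have hi := xD i; have hd := xy i; set xi := x ord0 i in hi hd *; set yi := y ord0 i in hd *.
  (* Separates the spatial displacement from the displacement in time. *)
  have -> : xi ^+ 2 / (4 * t) - yi ^+ 2 / (4 * s) =
     (xi - yi) * (xi + yi) / (4 * s) + xi ^+ 2 * (s - t) / (4 * s * t).
    by field; rewrite !gt_eqF.
  have h1 : (xi - yi) * (xi + yi) / (4 * s) <= (2 * D + 1) / (8 * k) * rho.
    have -> : (2 * D + 1) / (8 * k) * rho = (rho / 2 * (2 * D + 1)) / (4 * k).
      by field; rewrite gt_eqF.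
    apply: (@le_trans _ _ ((rho / 2 * (2 * D + 1)) / (4 * s))).
      rewrite ler_pM2r ?invr_gt0 ?mulr_gt0//; apply: (le_trans (ler_norm _)).
      rewrite normrM ler_pM//.
      have -> : xi + yi = 2 * xi - (xi - yi) by ring.
      apply: (le_trans (ler_normB _ _)); rewrite normrM ger0_norm//.
      have : rho / 2 <= 1 by lra.
      by lra.
    rewrite ler_wpM2l//; first by rewrite mulr_ge0 ?divr_ge0 ?addr_ge0 ?mulr_ge0.
    rewrite lef_pV2 ?posrE ?mulr_gt0//; lra.
  have h2 : xi ^+ 2 * (s - t) / (4 * s * t) <= 3 * D ^+ 2 / (8 * k ^+ 2) * rho.
    have -> : 3 * D ^+ 2 / (8 * k ^+ 2) * rho = D ^+ 2 * (3 / 2 * rho) / (4 * k ^+ 2).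
      by field; rewrite gt_eqF.
    apply: ler_pM.
    - by rewrite mulr_ge0 ?sqr_ge0// subr_ge0.
    - by rewrite invr_ge0 !mulr_ge0// ltW.
    - apply: ler_pM; rewrite ?sqr_ge0 ?subr_ge0//.
        by rewrite -[leLHS]real_normK ?num_real// lerXn2r// nnegrE.
      have : rho ^+ 2 <= rho by rewrite expr2 ler_piMl.
      by lra.
    rewrite lef_pV2 ?posrE ?mulr_gt0 ?exprn_gt0// -mulrA ler_pM2l// expr2.
    by apply: ler_pM => //; rewrite ?(ltW k0)//; lra.
  by rewrite /L mulrDl; lra.
have euv : expR (- u) <= expR (- v) + n%:R * (L * rho).
  have [uv0|vu] := leP v u.
    have : expR (- u) <= expR (- v) by rewrite ler_expR lerN2.
    have : 0 <= n%:R * (L * rho) by rewrite !mulr_ge0.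
    by lra.
  have e1 : expR (- u) <= 1.
    rewrite -[leRHS]expR0 ler_expR oppr_le0 divr_ge0 ?sumr_ge0//.
      by move=> i _; rewrite sqr_ge0.
    by rewrite mulr_ge0// ltW.
  have e2 : 1 - (v - u) <= expR (u - v).
    by have := expR_ge1Dx (u - v); lra.
  have e3 : expR (- v) = expR (- u) * expR (u - v) by rewrite -expRD; congr expR; ring.
  have : expR (- u) * (1 - expR (u - v)) <= 1 * (v - u).
    apply: ler_pM; rewrite ?expR_ge0//; last by lra.
    by rewrite subr_ge0 -[leRHS]expR0 ler_expR; lra.
  by rewrite e3; lra.
apply: (@le_trans _ _ (a * (expR (- v) + n%:R * (L * rho)))); first by rewrite ler_wpM2l.
rewrite mulrDr; apply: lerD; first by rewrite ler_wpM2r ?expR_ge0.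
rewrite -!mulrA ler_wpM2r// !mulr_ge0//.
Qed.

(** A Lebesgue sum: [S] is cut into level sets [L i] of the kernel of height [eta], each covered
    almost optimally for the mass by cubes so small that the kernel at a base exceeds the level by
    at most one further [eta]. *)
Lemma efficient_cover (S : set X) (mS : measurable (S : set (mass_type R n_gt0)))
    (z : X) (k D e d : R) : 0 < k -> 0 < e -> 0 < d -> 0 <= D -> (mass S < +oo)%E ->
  (forall w, S w -> k <= z.2 - w.2 /\ forall i, `|z.1 ord0 i - w.1 ord0 i| <= D) ->
  exists g, [/\ cube_cover d S g, meeting S g &
    (\sum_(j <oo) ((g j).2 ^+ n * heat_pole z (base (g j)))%:E <=
      \int[mu]_(w in S) (heat_pole z w)%:E + e%:E)%E].
Proof.
move=> k0 e0 d0 D0 Sfin Sbd.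
have Sf : mass S \is a fin_num by rewrite ge0_fin_numE ?mass_ge0.
set m := fine (mass S); have m0 : 0 <= m by rewrite fine_ge0 ?mass_ge0.
pose eta := e / (4 * (m + 1)); have eta0 : 0 < eta by rewrite divr_gt0// mulr_gt0// ltr_wpDl.
pose K := (4 * pi * k) `^ (- (n%:R / 2)) * n%:R * ((2 * D + 1) / (8 * k) + 3 * D ^+ 2 / (8 * k ^+ 2)).
have K0 : 0 <= K.
  rewrite mulr_ge0 ?mulr_ge0 ?powR_ge0// addr_ge0// divr_ge0 ?mulr_ge0 ?sqr_ge0 ?addr_ge0 ?mulr_ge0//; exact: ltW.
(* Side at most [eta / (K + 1)] makes the error [K * side] of [heat_kernel_perturb] at most
   [eta]. *)
pose d1 := Num.min d (Num.min 1 (eta / (K + 1))).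
have K1 : 0 < K + 1 by rewrite ltr_wpDl.
have d10 : 0 < d1 by rewrite !lt_min d0 ltr01 divr_gt0.
pose L (i : nat) := S `&` [set w | i%:R * eta <= heat_pole z w < i.+1%:R * eta].
have mf : measurable_fun setT (fun w : mass_type R n_gt0 => heat_pole z w).
  apply: measurable_heat_pole; first exact: coord_measurable_cst.
  exact: coord_measurable_mass_type.
have mL i : measurable (L i : set (mass_type R n_gt0)).
  apply: measurableI => //.
  have := mf measurableT _ (measurable_itv `[i%:R * eta, i.+1%:R * eta[); rewrite setTI.
  by congr (measurable _); apply/seteqP; split => w /=; rewrite in_itv.
(* Compensates the factor [i.+2%:R * eta] put on the [i]-th covering, so that the excesses add up to
   [e / 2]. *)
pose ei i := e / (2 * (i.+2%:R * eta)) / (2 ^ i.+1)%:R.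
have ei0 i : 0 < ei i.
  apply: divr_gt0; last by rewrite ltr0n expn_gt0.
  by apply: divr_gt0 => //; apply: mulr_gt0 => //; exact: mulr_gt0.
have Lfin i : mass (L i) \is a fin_num.
  rewrite ge0_fin_numE ?mass_ge0//; apply: le_lt_trans Sfin; apply: le_mass.
  exact: subIsetl.
have [G HG] : {G : nat -> nat -> X * R & forall i, [/\ cube_cover d1 (L i) (G i),
    meeting (L i) (G i) & (cube_sum (G i) <= mass (L i) + (ei i)%:E)%E]}.
  apply: (@choice _ _ (fun i g => [/\ cube_cover d1 (L i) g,
    meeting (L i) g & (cube_sum g <= mass (L i) + (ei i)%:E)%E])) => i.
  have : (mass (L i) < (fine (mass (L i)) + ei i)%:E)%E.
    by rewrite EFinD fineK// lteDl// lte_fin.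
  move=> /(cover_meeting d10)[g [g1 g2 g3]]; exists g; split => //.
  by apply/ltW; rewrite EFinD fineK in g3.
have [g [g1 g2 g3]] := merge_sequences R G.
have gG j : 0 <= (g j).2 <= d1.
  by have [i [l ->]] := g2 j; have [[]] := HG i.
pose f (c : X * R) : \bar R := (`|c.2| ^+ n * heat_pole z (base c))%:E.
have f0 c : (0 <= f c)%E by rewrite lee_fin mulr_ge0 ?exprn_ge0// heat_pole_ge0.
exists g; split.
- split => [j|w Sw].
    have /andP[-> /le_trans->//] := gG j; by rewrite /d1 ge_min lexx.
  pose i := Num.truncn (heat_pole z w / eta).
  have Liw : L i w.
    split => //=; have h0 : 0 <= heat_pole z w / eta by rewrite divr_ge0 ?heat_pole_ge0// ltW.
    have := truncn_itv h0; rewrite -/i => /andP[].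
    by rewrite ler_pdivlMr// ltr_pdivrMr// => -> ->.
  have [[_ Lc] _ _] := HG i; have [l _ lw] := Lc _ Liw.
  by have [j gj] := g1 i l; exists j => //; rewrite gj.
- move=> j; have [i [l gj]] := g2 j; rewrite gj.
  have [_ /(_ l)[->|[w [Sw _] lw]] _] := HG i; first by left.
  by right; exists w.
have -> : (\sum_(j <oo) ((g j).2 ^+ n * heat_pole z (base (g j)))%:E = \sum_(j <oo) f (g j))%E.
  apply: eq_eseriesr => j _; rewrite /f ger0_norm//; by have /andP[] := gG j.
rewrite g3//.
have step i : (\sum_(j <oo) f (G i j) <=
    (i%:R * eta)%:E * mass (L i) + (2 * eta)%:E * mass (L i) + (e / 2 / (2 ^ i.+1)%:R)%:E)%E.
  have [Gd Gm Gs] := HG i; have Gi l : 0 <= (G i l).2 <= d1 by have [] := Gd.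
  (* The kernel is below [i.+1%:R * eta] on the level, and the passage to the base adds one more
     [eta]. *)
  apply: (@le_trans _ _ (\sum_(l <oo) (i.+2%:R * eta)%:E * ((G i l).2 ^+ n)%:E)%E).
    apply: lee_nneseries => [l _ _|l _]; first exact: f0.
    have /andP[Gl0 Gl1] := Gi l; rewrite /f ger0_norm// -EFinM lee_fin mulrC.
    have [->|[w [Sw /andP[_ /= wi]] lw]] := Gm l.
      by rewrite expr0n gtn_eqF// !mulr0.
    apply: ler_wpM2r; first by rewrite exprn_ge0.
    have [kw wD] := Sbd _ Sw; have bw := cube_base_lt lw.
    have /andP[b1 b2] := cube_base_time lw; have [l0 lx _] := lw.
    have zw : w.2 < z.2 by rewrite -subr_gt0; exact: lt_le_trans kw.
    move: wi; rewrite !heat_poleE//; last exact: lt_trans zw.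
    move=> wi; apply: (@le_trans _ _ (heat_kernel (z.2 - w.2) (z.1 - w.1) + K * (G i l).2)).
      apply: (@heat_kernel_perturb _ _ _ D) => //.
      - by rewrite lerD2l lerN2 ltW.
      - by lra.
      - rewrite Gl0 (le_trans Gl1)//; by rewrite /d1 !ge_min lexx !orbT.
      - by move=> j; rewrite !mxE.
      - move=> j; rewrite !mxE; have := lx j.
        have -> : z.1 ord0 j - w.1 ord0 j - (z.1 ord0 j - (G i l).1.1 ord0 j) =
          - (w.1 ord0 j - (G i l).1.1 ord0 j) by ring.
        by rewrite normrN.
    have : K * (G i l).2 <= eta.
      apply: (@le_trans _ _ ((K + 1) * (eta / (K + 1)))); last first.
        by rewrite mulrC divfK// gt_eqF.
      apply: ler_pM => //; first by rewrite lerDl.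
      by rewrite (le_trans Gl1)// /d1 !ge_min lexx !orbT.
    by rewrite -[i.+2]addn1 natrD mulrDl mul1r; lra.
  rewrite nneseriesZl; last by move=> l _; rewrite lee_fin exprn_ge0//; have /andP[] := Gi l.
  apply: (@le_trans _ _ ((i.+2%:R * eta)%:E * (mass (L i) + (ei i)%:E))%E).
    by apply: lee_wpmul2l => //; rewrite lee_fin mulr_ge0// ltW.
  rewrite -(fineK (Lfin i)) -!(EFinM, EFinD) lee_fin.
  have -> : i.+2%:R = i%:R + 2 :> R by rewrite -addn2 natrD.
  have P0 : (2 ^ i.+1)%:R != 0 :> R by rewrite pnatr_eq0 expn_eq0.
  have i20 : (i%:R + 2 : R) != 0 by rewrite gt_eqF// ltr_wpDl.
  rewrite /ei; have -> : i.+2%:R = i%:R + 2 :> R by rewrite -addn2 natrD.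
  rewrite le_eqVlt; apply/orP; left; apply/eqP.
  by field; rewrite i20 P0 gt_eqF.
have I0 i : (0 <= (i%:R * eta)%:E * mass (L i))%E.
  by rewrite mule_ge0 ?mass_ge0// lee_fin mulr_ge0// ltW.
have I1 i : (0 <= (2 * eta)%:E * mass (L i))%E.
  by rewrite mule_ge0 ?mass_ge0// lee_fin mulr_ge0// ltW.
have tL : trivIset setT L.
  apply/trivIsetP => i j _ _ ij; apply/seteqP; split => // w [[_ /= /andP[a1 a2]] [_ /= /andP[b1 b2]]].
  move: ij; have [ij _|ji _|_ //] := ltngtP i j.
    have : (i.+1%:R * eta <= j%:R * eta) by rewrite ler_pM2r// ler_nat.
    by lra.
  have : (j.+1%:R * eta <= i%:R * eta) by rewrite ler_pM2r// ler_nat.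
  by lra.
have SL : S = \bigcup_i L i.
  apply/seteqP; split => [w Sw|w [i _ []]//].
  exists (Num.truncn (heat_pole z w / eta)) => //; split => //=.
  have h0 : 0 <= heat_pole z w / eta by rewrite divr_ge0 ?heat_pole_ge0// ltW.
  have := truncn_itv h0 => /andP[].
  by rewrite ler_pdivlMr// ltr_pdivrMr// => -> ->.
apply: (@le_trans _ _ (\sum_(i <oo) ((i%:R * eta)%:E * mass (L i)) +
    \sum_(i <oo) ((2 * eta)%:E * mass (L i)) + (e / 2)%:E)%E).
  have le1 : (\sum_(i <oo) ((i%:R * eta)%:E * mass (L i) + (2 * eta)%:E * mass (L i)) =
    \sum_(i <oo) ((i%:R * eta)%:E * mass (L i)) +
    \sum_(i <oo) ((2 * eta)%:E * mass (L i)))%E by rewrite nneseriesD.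
  rewrite -le1.
  apply: le_trans (epsilon_trick _ _ _); last first.
  - by rewrite divr_ge0// ltW.
  - by move=> i; rewrite adde_ge0.
  apply: lee_nneseries => [i _ _|i _]; last exact: step.
  by apply: nneseries_ge0 => l _ _; exact: f0.
rewrite -[in leRHS](_ : (e / 2 + e / 2) = e); last by lra.
rewrite EFinD addeA; apply: leeD => //; apply: leeD.
  have mfL : measurable_fun (\bigcup_i L i : set (mass_type R n_gt0)) (fun w => (heat_pole z w)%:E).
    by apply/measurable_EFinP; exact: measurable_funTS.
  have hp0 (w : mass_type R n_gt0) : (\bigcup_i L i) w -> (0 <= (heat_pole z w)%:E)%E.
    by rewrite lee_fin heat_pole_ge0.
  have -> := congr1 (fun D : set X => \int[mu]_(w in D) (heat_pole z w)%:E)%E SL.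
  rewrite (@ge0_integral_bigcup _ _ _ mu L _ mL mfL hp0 tL).
  apply: lee_nneseries => [i _ _|i _]; first exact: I0.
  have -> : ((i%:R * eta)%:E * mass (L i) = \int[mu]_(w in L i) (i%:R * eta)%:E)%E.
    by rewrite integral_cst.
  apply: ge0_le_integral.
  - exact: mL.
  - by move=> w _; rewrite lee_fin mulr_ge0// ltW.
  - exact: measurable_cst.
  - by apply/measurable_EFinP; exact: measurable_funTS.
  - by move=> w [_ /= /andP[+ _]]; rewrite lee_fin.
rewrite nneseriesZl; last by move=> i _; exact: mass_ge0.
have -> : (\sum_(i <oo) mass (L i) = mass S)%E.
  have := @measure_bigcup _ _ _ mu setT L (fun i _ => mL i) tL; move=> H.
  transitivity (mu (\bigcup_i L i)); last exact: (congr1 mu (esym SL)).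
  rewrite H; by apply: eq_eseriesl => i; rewrite in_setT.
rewrite -(fineK Sf) -EFinM lee_fin -/m /eta.
have -> : 2 * (e / (4 * (m + 1))) * m = e / 2 * (m / (m + 1)).
  by field; rewrite gt_eqF// ltr_wpDl.
rewrite ler_piMr ?divr_ge0 ?(ltW e0)// ler_pdivrMr ?ltr_wpDl// mul1r; lra.
Qed.

End efficient_cover.

Lemma ereal_le_residue (R : realType) (e : R) (a b c : \bar R) :
  b \is a fin_num -> c \is a fin_num ->
  (a + b <= c)%E -> (c - e%:E < b)%E -> (a <= e%:E)%E.
Proof.
move=> bf cf H Hm; rewrite -(leeD2rE _ _ bf); apply: (le_trans H); apply/ltW.
by rewrite addeC -lteBlDr.
Qed.

(** * Continuity of the mass and of its heat potential on thin time slabs *)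

Section slabs.
Context (R : realType) (n : nat).
Local Notation X := (spacetime R n).
Hypothesis n_gt0 : (0 < n)%N.
Local Notation mu := (mass_measure R n_gt0).
Local Notation U := (mass_type R n_gt0).
Variables (T : set X) (mT : measurable (T : set U)) (Tfin : (mass T < +oo)%E).

Lemma measurable_time_itv (i : interval R) :
  measurable ([set w : X | w.2 \in i] : set U).
Proof.
have [_ m2] := coord_measurable_mass_type R n_gt0.
have := m2 measurableT _ (measurable_itv i); rewrite setTI.
by congr (measurable _).
Qed.

Lemma mass_nonincreasing_lt (F : nat -> set X) (e : \bar R) :
  (forall m, measurable (F m : set U)) -> (forall m, F m.+1 `<=` F m) ->
  (forall m, F m `<=` T) -> (mass (\bigcap_m F m) < e)%E ->
  exists m, (mass (F m) < e)%E.
Proof.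
move=> mF Fm FT Fe.
have nF : nonincreasing_seq F.
  by apply/nonincreasing_seqP => m; apply/subsetPset; exact: Fm.
have F0 : (mu (F 0%N) < +oo)%E by exact: le_lt_trans (le_mass (FT 0%N)) Tfin.
have := nonincreasing_cvg_mu F0 mF (bigcapT_measurable mF) nF.
move=> /(_ [set x | (x < e)%E]) H.
have [|m _ Hm] := H; last by exists m; exact: (Hm m (leqnn m)).
by apply: open_nbhs_nbhs; split; [exact: open_ereal_lt_ereal|exact: Fe].
Qed.

Lemma mass_slab_below s (e : \bar R) :
  (mass (T `&` [set w : X | w.2 = s]) < e)%E ->
  exists2 h : R, 0 < h & (mass (T `&` [set w : X | (s - h <= w.2 <= s)%R]) < e)%E.
Proof.
move=> Ts; pose F m := T `&` [set w : X | s - m.+1%:R^-1 <= w.2 <= s].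
have [m Hm] : exists m, (mass (F m) < e)%E.
  apply: mass_nonincreasing_lt.
  - move=> m; apply: measurableI => //.
    have := measurable_time_itv `[s - m.+1%:R^-1, s].
    by congr (measurable _); apply/seteqP; split => w /=; rewrite in_itv.
  - move=> m w [Tw /= /andP[a1 a2]]; split => //=; rewrite a2 andbT.
    apply: le_trans a1; rewrite lerD2l lerN2 lef_pV2 ?posrE// ler_nat.
    exact: leqnSn.
  - by move=> m w [].
  - apply: le_lt_trans Ts; apply: le_mass => w Fw.
    have [Tw /= _] := Fw 0%N I; split => //=; apply/eqP; rewrite eq_le.
    have [_ /= /andP[_ ->]] := Fw 0%N I; rewrite leNgt; apply/negP => ws.
    have sw : 0 < s - w.2 by rewrite subr_gt0.
    have [m _ /(_ m (leqnn m)) /= mw] := near_infty_natSinv_lt (PosNum sw).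
    have [_ /= /andP[h _]] := Fw m I.
    by move: mw h; move: (m.+1%:R^-1 : R) => q; lra.
by exists m.+1%:R^-1.
Qed.

(** The slabs are open at [s], so they shrink to the empty set, whatever the mass of the slice at
    [s]. *)
Lemma mass_slab_above s (e : \bar R) h0 : (0 < e)%E -> 0 < h0 ->
  exists2 h : R, 0 < h <= h0 & (mass (T `&` [set w : X | (s < w.2 <= s + h)%R]) < e)%E.
Proof.
move=> e0 h00; pose F m := T `&` [set w : X | s < w.2 <= s + h0 / m.+1%:R].
have [m Hm] : exists m, (mass (F m) < e)%E.
  apply: mass_nonincreasing_lt.
  - move=> m; apply: measurableI => //.
    have := measurable_time_itv `]s, s + h0 / m.+1%:R].
    by congr (measurable _); apply/seteqP; split => w /=; rewrite in_itv.
  - move=> m w [Tw /= /andP[a1 a2]]; split => //=; rewrite a1/=.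
    apply: (le_trans a2); rewrite lerD2l ler_pM2l// lef_pV2 ?posrE// ler_nat.
    exact: leqnSn.
  - by move=> m w [].
  - suff -> : \bigcap_m F m = set0 by rewrite mass0.
    apply/seteqP; split => // w Fw.
    have [Tw /= /andP[ws _]] := Fw 0%N I.
    have sw : 0 < (w.2 - s) / h0 by rewrite divr_gt0// subr_gt0.
    have [m _ /(_ m (leqnn m)) /= mw] := near_infty_natSinv_lt (PosNum sw).
    have [_ /= /andP[_ h]] := Fw m I.
    move: mw; rewrite /= ltr_pdivlMr// mulrC; move: h.
    by move: (h0 / m.+1%:R : R) => q; lra.
exists (h0 / m.+1%:R) => //; rewrite divr_gt0//= ler_pdivrMr// ler_peMr//.
  exact: ltW.
by rewrite ler1n.
Qed.

(** Slices at distinct times are disjoint, and a finite mass leaves room for only finitely many of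
    mass at least [e]. *)
Lemma mass_small_slice (a b e : R) : a < b -> 0 < e ->
  exists2 s, a < s < b & (mass (T `&` [set w : X | w.2 = s]) < e%:E)%E.
Proof.
move=> ab e0; apply: contrapT => nex.
pose s i : R := a + (b - a) / i.+2%:R.
have sab i : a < s i < b.
  rewrite ltrDl divr_gt0 ?subr_gt0//= /s -ltrBrDl ltr_pdivrMr//.
  by rewrite ltr_pMr ?subr_gt0// ltr1n.
pose F i := T `&` [set w : X | w.2 = s i].
have Fe i : (e%:E <= mass (F i))%E.
  by rewrite leNgt; apply/negP => h; apply: nex; exists (s i).
have mF i : measurable (F i : set U).
  apply: measurableI => //; have := measurable_time_itv `[s i, s i].
  congr (measurable _); apply/seteqP; split => w /=; rewrite in_itv/=.
    by move=> /andP[? ?]; apply/eqP; rewrite eq_le; apply/andP.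
  by move=> ->; rewrite lexx.
have tF : trivIset setT F.
  apply/trivIsetP => i j _ _ ij; apply/seteqP; split => // w [[_ /= wi] [_ /= wj]].
  move: wj; rewrite wi => /addrI/mulfI; rewrite subr_eq0 gt_eqF//.
  by move=> /(_ isT)/invr_inj/eqP; rewrite eqr_nat eqSS eqSS (negbTE ij).
have Tf : mass T \is a fin_num by rewrite ge0_fin_numE ?mass_ge0.
have H : (\sum_(i <oo) mass (F i) <= mass T)%E.
  have -> : (\sum_(i <oo) mass (F i) = mu (\bigcup_i F i))%E.
    have -> := @measure_bigcup _ _ _ mu setT F (fun i _ => mF i) tF.
    by apply: eq_eseriesl => i; rewrite in_setT.
  by apply: le_mass => w [i _ []].
pose N := (Num.truncn (fine (mass T) / e)).+1.
have : ((N%:R * e)%:E <= mass T)%E.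
  apply: le_trans H; apply: le_trans (nneseries_lim_ge N (fun i _ _ => mass_ge0 (F i))).
  rewrite mulr_natl -[X in _ *+ X]subn0 -sumr_const_nat -sumEFin.
  by apply: lee_sum => i _; exact: Fe.
rewrite -(fineK Tf) lee_fin leNgt; apply/negP; rewrite negbK -ltr_pdivrMr//.
by have /andP[] := truncn_itv (divr_ge0 (fine_ge0 (mass_ge0 T)) (ltW e0)).
Qed.

(** The integrals over the sets [F m] increase to the finite integral over the part of [T] before
    [z]; beyond a suitable [m] only [e] is left, and [S] is disjoint from [F m]. *)
Lemma heat_window (z : X) (e : R) : 0 < e ->
  (\int[mu]_(w in T) (heat_pole z w)%:E < +oo)%E ->
  exists2 h : R, 0 < h & forall S : set X, measurable (S : set U) -> S `<=` T ->
    (forall w, S w -> z.2 - h <= w.2 < z.2) ->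
    (\int[mu]_(w in S) (heat_pole z w)%:E <= e%:E)%E.
Proof.
move=> e0 Ifin; pose F m := T `&` [set w : X | w.2 < z.2 - m.+1%:R^-1].
have mF m : measurable (F m : set U).
  apply: measurableI => //; have := measurable_time_itv `]-oo, z.2 - m.+1%:R^-1[.
  by congr (measurable _); apply/seteqP; split => w /=; rewrite in_itv.
have nF : nondecreasing_seq F.
  apply/nondecreasing_seqP => m; apply/subsetPset => w [Tw /= wm]; split => //=.
  apply: (lt_le_trans wm); rewrite lerD2l lerN2 lef_pV2 ?posrE// ler_nat.
  exact: leqnSn.
have mf : measurable_fun setT (fun w : U => (heat_pole z w)%:E).
  apply/measurable_EFinP; apply: measurable_heat_pole; first exact: coord_measurable_cst.
  exact: coord_measurable_mass_type.
have f0 (w : U) : (0 <= (heat_pole z w)%:E)%E by rewrite lee_fin heat_pole_ge0.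
have mfS (S : set U) : measurable_fun S (fun w : U => (heat_pole z w)%:E).
  exact: measurable_funTS.
have subI (A B : set U) : measurable A -> measurable B -> A `<=` B ->
    (\int[mu]_(w in A) (heat_pole z w)%:E <= \int[mu]_(w in B) (heat_pole z w)%:E)%E.
  by move=> mA mB; apply: (ge0_subset_integral mu mA mB (mfS B)) => w _; exact: f0.
have I_ge0 (A : set U) : (0 <= \int[mu]_(w in A) (heat_pole z w)%:E)%E.
  by apply: integral_ge0 => w _; exact: f0.
pose T0 := T `&` [set w : X | w.2 < z.2].
have mT0 : measurable (T0 : set U).
  apply: measurableI => //; have := measurable_time_itv `]-oo, z.2[.
  by congr (measurable _); apply/seteqP; split => w /=; rewrite in_itv.
have UF : \bigcup_m F m = T0.
  apply/seteqP; split => [w [m _ [Tw /= wm]]|w [Tw /= wz]].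
    by split => //=; apply: (lt_le_trans wm); rewrite gerBl.
  have zw : 0 < z.2 - w.2 by rewrite subr_gt0.
  have [m _ /(_ m (leqnn m)) /= mw] := near_infty_natSinv_lt (PosNum zw).
  exists m => //; split => //=; move: mw => /=.
  by move: (m.+1%:R^-1 : R) => q; lra.
have I0fin : (\int[mu]_(w in T0) (heat_pole z w)%:E < +oo)%E.
  by apply: le_lt_trans Ifin; apply: subI; [exact: mT0|exact: mT|exact: subIsetl].
have I0f : (\int[mu]_(w in T0) (heat_pole z w)%:E)%E \is a fin_num.
  by rewrite ge0_fin_numE ?I_ge0.
have cvF : (\int[mu]_(w in F m) (heat_pole z w)%:E)%E @[m --> \oo] -->
    (\int[mu]_(w in \bigcup_m F m) (heat_pole z w)%:E)%E.
  apply: ge0_nondecreasing_set_cvg_integral.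
  - exact: nF.
  - exact: mF.
  - by move=> m; exact: mfS.
  - by move=> m w _; exact: f0.
rewrite UF in cvF.
have I0e : (\int[mu]_(w in T0) (heat_pole z w)%:E - e%:E < \int[mu]_(w in T0) (heat_pole z w)%:E)%E.
  by rewrite -(fineK I0f) -EFinB lte_fin ltrBlDr ltrDl.
have [m Hm] : exists m, (\int[mu]_(w in T0) (heat_pole z w)%:E - e%:E < \int[mu]_(w in F m) (heat_pole z w)%:E)%E.
  have [|m _ Hm] := cvF [set x | (\int[mu]_(w in T0) (heat_pole z w)%:E - e%:E < x)%E].
    apply: open_nbhs_nbhs; split; [exact: open_ereal_gt_ereal|exact: I0e].
  by exists m; exact: (Hm m (leqnn m)).
exists m.+1%:R^-1; first by [].
move=> S mS ST Sz.
have dis : [disjoint S & F m].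
  apply/disj_setPS => w [/Sz/andP[a1 _] [_ /=]].
  by rewrite ltNge a1.
have : (\int[mu]_(w in S) (heat_pole z w)%:E + \int[mu]_(w in F m) (heat_pole z w)%:E <=
    \int[mu]_(w in T0) (heat_pole z w)%:E)%E.
  have fSF (w : U) : (S `|` F m) w -> (0 <= (heat_pole z w)%:E)%E by move=> _; exact: f0.
  have <- := ge0_integral_setU mu mS (mF m) (mfS (S `|` F m)) fSF dis.
  apply: subI; [by apply: measurableU; [exact: mS|exact: mF]|exact: mT0|].
  - move=> w [Sw|]; last by rewrite -UF => Fw; exists m.
    by split; [exact: ST|have /andP[] := Sz _ Sw].
move=> H; have Ff : (\int[mu]_(w in F m) (heat_pole z w)%:E)%E \is a fin_num.
  rewrite ge0_fin_numE ?I_ge0//; apply: le_lt_trans I0fin.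
  by apply: le_trans H; rewrite leeDr ?I_ge0.
exact: ereal_le_residue Ff I0f H Hm.
Qed.

End slabs.

(** * Competitors *)

Section lower_competitor.
Context (R : realType) (n : nat).
Local Notation X := (spacetime R n).
Local Notation mR := (measurableTypeR R).
Local Notation leb := (lebesgue_tuple R n).
Hypothesis n_gt0 : (0 < n)%N.
Local Notation mu := (mass_measure R n_gt0).
Local Notation U := (mass_type R n_gt0).

(* With the weight [exponential (drift alpha)], the Gaussian seen at time [s]
   from a pole [t] earlier is centred at distance [2 * alpha * t] from the pole
   along each axis: a large [alpha] makes the old part of a bounded set
   invisible from a given ball. *)
Definition drift (alpha : R) : 'rV[R]_n := const_mx alpha.

Lemma exponential_driftE alpha (z : X) : exponential (drift alpha) z =
  expR (alpha * (\sum_i z.1 ord0 i) + n%:R * alpha ^+ 2 * z.2).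
Proof.
have S1 : \sum_i drift alpha ord0 i * z.1 ord0 i = alpha * \sum_i z.1 ord0 i.
  by rewrite mulr_sumr; apply: eq_bigr => i _; rewrite mxE.
have S2 : \sum_i drift alpha ord0 i ^+ 2 = n%:R * alpha ^+ 2.
  rewrite (eq_bigr (fun=> alpha ^+ 2)); last by move=> i _; rewrite mxE.
  by rewrite sumr_const card_ord mulr_natl.
by rewrite /exponential S1 S2.
Qed.

(** The bound on the side keeps the exponent from growing by more than 1 between the base and a
    point of the cube. *)
Lemma exponential_cube alpha (c : X * R) w : 0 <= alpha -> c.2 <= 1 ->
  (2 * n%:R * alpha + 2 * n%:R * alpha ^+ 2) * c.2 <= 1 -> cube c w ->
  exponential (drift alpha) w <= expR 1 * exponential (drift alpha) (base c).
Proof.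
move=> a0 c1 ca cw; have [c0 cx _] := cw; have /andP[t1 t2] := cube_base_time cw.
rewrite !exponential_driftE -expRD ler_expR.
have S1 : \sum_i w.1 ord0 i <= \sum_i c.1.1 ord0 i + n%:R * (c.2 / 2).
  have -> : n%:R * (c.2 / 2) = \sum_(i < n) (c.2 / 2) by rewrite sumr_const card_ord mulr_natl.
  rewrite -big_split/=; apply: ler_sum => i _.
  by have := cx i; rewrite ler_norml => /andP[_ h]; lra.
have c2 : c.2 ^+ 2 <= c.2 by rewrite expr2 ler_piMl// ltW.
have na : 0 <= n%:R * alpha ^+ 2 by rewrite mulr_ge0// sqr_ge0.
have h1 : alpha * (\sum_i w.1 ord0 i) <= alpha * (\sum_i c.1.1 ord0 i) + alpha * (n%:R * (c.2 / 2)).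
  by rewrite -mulrDr ler_wpM2l.
have h2 : n%:R * alpha ^+ 2 * w.2 <= n%:R * alpha ^+ 2 * (base c).2 + n%:R * alpha ^+ 2 * (3 / 2 * c.2).
  by rewrite -mulrDr ler_wpM2l//; lra.
have h3 : alpha * (n%:R * (c.2 / 2)) + n%:R * alpha ^+ 2 * (3 / 2 * c.2) <= 1.
  have p1 : 0 <= n%:R * alpha * c.2 by rewrite !mulr_ge0// ltW.
  have p2 : 0 <= n%:R * alpha ^+ 2 * c.2 by rewrite !mulr_ge0// ltW.
  by move: ca; rewrite mulrDl; lra.
by rewrite /= in h2 *; lra.
Qed.

(** Doob's transform of the heat kernel by [exponential (drift alpha)]: for a base before [s] a
    probability density in [y], its centre displaced by the drift. A potential with weights [u] at
    the bases is [u] times a sum of such densities. *)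
Definition drift_kernel alpha s (c : X * R) (y : n.-tuple mR) : R :=
  if (base c).2 < s then
    heat_kernel (s - (base c).2)
      (((base c).1 - (2 * (s - (base c).2)) *: drift alpha) - row_of_tuple y)
  else 0.

Lemma drift_kernel_ge0 alpha s c y : 0 <= drift_kernel alpha s c y.
Proof. by rewrite /drift_kernel; case: ifP => // _; exact: heat_kernel_ge0. Qed.

Lemma measurable_drift_kernel alpha s c : measurable_fun setT (drift_kernel alpha s c).
Proof.
rewrite /drift_kernel; case: ((base c).2 < s); first exact: measurable_heat_kernel.
exact: measurable_cst.
Qed.

Lemma drift_kernelE alpha s c y :
  exponential (drift alpha) (base c) * heat_pole (row_of_tuple y, s) (base c) =
  exponential (drift alpha) (row_of_tuple y, s) * drift_kernel alpha s c y.
Proof.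
rewrite /drift_kernel; have [ts|ts] := ltP (base c).2 s; last first.
  by rewrite heat_pole0//= !mulr0.
have t0 : 0 < s - (base c).2 by rewrite subr_gt0.
have := heat_kernel_exponential (drift alpha) (row_of_tuple y) (base c).1 s t0.
have -> : ((base c).1, s - (s - (base c).2)) = base c.
  by rewrite subKr -surjective_pairing.
have -> : heat_pole (row_of_tuple y, s) (base c) =
    heat_kernel (s - (base c).2) (row_of_tuple y - (base c).1) by rewrite heat_poleE.
rewrite mulrC => ->.
rewrite mulrC; congr (_ * _); rewrite -[LHS]heat_kernelN; congr heat_kernel.
by rewrite opprB opprD addrA addrAC.
Qed.

Lemma integral_drift_kernel alpha s c :
  (\int[leb]_y (drift_kernel alpha s c y)%:E <= 1)%E.
Proof.
rewrite /drift_kernel; have [ts|ts] := ltP (base c).2 s.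
  by rewrite integral_heat_kernel// subr_gt0.
by rewrite integral0.
Qed.

Variables (T : set X) (mT : measurable (T : set U)) (Tfin : (mass T < +oo)%E).

(** After division by [u], the potentials of the part of [T] in a slab of height [h] below [s] and
    of the older part become [En g1] and [En g2]. The first is small in integral, being a small mass
    of probability densities; the second is at most [1 / 4] on the whole box because the drift
    carries its centres away. Hence [v <= u / 2] except where [4 * En g1], the function [E], reaches
    1. *)
Lemma lower_competitor (D b s e : R) (x : 'rV[R]_n) : 0 < e -> 0 <= b -> 0 <= D ->
  (forall w, T w -> (forall i, `|w.1 ord0 i| <= D) /\ `|w.2| <= D) ->
  (mass (T `&` [set w : X | w.2 = s]) < (e / (4 * cube_const R n * expR 1))%:E)%E ->
  exists2 alpha : R, 0 <= alpha & exists v : X -> \bar R,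
    [/\ supercaloric v,
        forall s', measurable_fun setT (fun y : n.-tuple mR => v (row_of_tuple y, s')),
        forall w, T w -> w.2 <= s -> ((exponential (drift alpha) w)%:E <= v w)%E &
        exists E : n.-tuple mR -> \bar R, [/\ measurable_fun setT E,
          forall y, (0 <= E y)%E, (\int[leb]_y E y <= e%:E)%E &
          forall y, (forall i, `|row_of_tuple y ord0 i - x ord0 i| <= b) ->
            (v (row_of_tuple y, s) <= (exponential (drift alpha) (row_of_tuple y, s) / 2)%:E)%E \/
            (1 <= E y)%E]].
Proof.
move=> e0 b0 D0 Tbd slice.
have [h h0 slab] := mass_slab_below mT Tfin slice.
have C0 := cube_const_gt0 R n; set C := cube_const R n in C0 slice slab *.
have e1 : 0 < expR 1 :> R by exact: expR_gt0.
pose T2 := T `&` [set w : X | w.2 < s - h].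
have Tf : mass T \is a fin_num by rewrite ge0_fin_numE ?mass_ge0.
pose M := fine (mass T) + 1; have M0 : 0 < M by rewrite ltr_wpDl// fine_ge0 ?mass_ge0.
have T2M : (mass T2 < M%:E)%E.
  apply: (@le_lt_trans _ _ (mass T)); first by apply: le_mass => w [].
  by rewrite /M EFinD fineK// lteDl// lte_fin.
have p0 := pi_gt0 R.
pose A := (4 * pi * h) `^ (- (n%:R / 2)); have A0 : 0 < A by rewrite powR_gt0// mulr_gt0// mulr_gt0.
(* Bounds the time from a base to [s]: points of [T] are after [-D], and a base lies at most [3 / 2]
   below a point of its cube. *)
pose tm := `|s| + D + 2; have tm0 : 0 < tm by rewrite ltr_wpDl// addr_ge0.
pose K := 16 * C * expR 1 * M * A * tm.
have K0 : 0 < K by rewrite /K; do 5 (apply: mulr_gt0 => //).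
(* [L] is the distance to be reached between the displaced centres and the box. The Gaussian there
   is at most [A * 4 * tm / L^2], so [K <= L^2] leaves [1 / 4] of the total. *)
pose L := 1 + K; have L0 : 0 < L by rewrite addr_gt0.
have KL : K <= L ^+ 2.
  have : 0 <= K ^+ 2 by exact: sqr_ge0.
  by rewrite /L sqrrD; lra.
pose i0 := Ordinal n_gt0.
(* After a time at least [h] the displacement [2 * alpha * t] exceeds [L] plus all distances between
   the box around [x] and the bounded set [T], in the first coordinate. *)
pose alpha := (L + b + `|x ord0 i0| + D + 1) / (2 * h).
have Lbx0 : 0 <= L + b + `|x ord0 i0| + D + 1.
  by move: L0 b0 D0 (normr_ge0 (x ord0 i0)); lra.
have al0 : 0 <= alpha by apply: divr_ge0 => //; apply: mulr_ge0 => //; exact: ltW.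
exists alpha => //.
set u := exponential (drift alpha).
have u0 w : 0 < u w by exact: exponential_gt0.
pose Kd := 2 * n%:R * alpha + 2 * n%:R * alpha ^+ 2.
have Kd0 : 0 <= Kd.
  by apply: addr_ge0; (apply: mulr_ge0; [exact: mulr_ge0|]) => //; exact: sqr_ge0.
pose d := Num.min 1 (Kd + 1)^-1.
have d0 : 0 < d by rewrite lt_min ltr01 invr_gt0 ltr_wpDl.
have dcube (c : X * R) (w : X) : 0 <= c.2 <= d -> cube c w -> u w <= expR 1 * u (base c).
  move=> /andP[c0]; rewrite le_min => /andP[c1 c2]; apply: exponential_cube => //.
  apply: (@le_trans _ _ ((Kd + 1) * (Kd + 1)^-1)).
    by apply: ler_pM => //; rewrite lerDl.
  by rewrite mulfV// gt_eqF// ltr_wpDl.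
have [g1 [g1c _ g1s]] := cover_meeting d0 slab.
have [g2 [g2c g2m g2s]] := cover_meeting d0 T2M.
(* The factor [expR 1] pays for the growth of [u] from the base to the cube, so that the potential
   dominates [u] there. *)
pose wt (g : nat -> X * R) k := expR 1 * u (base (g k)).
have wt0 g k : 0 <= wt g k by rewrite mulr_ge0// ltW.
have g10 k : 0 <= (g1 k).2 by have /andP[] := g1c.1 k.
have g20 k : 0 <= (g2 k).2 by have /andP[] := g2c.1 k.
have S1 := supercaloric_cube_potential g10 (wt0 g1).
have S2 := supercaloric_cube_potential g20 (wt0 g2).
have M1 s' : measurable_fun setT (fun y : n.-tuple mR => cube_potential g1 (wt g1) (row_of_tuple y, s')).
  exact: (measurable_cube_potential g10 (wt0 g1) (coord_measurable_slice n s')).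
have M2 s' : measurable_fun setT (fun y : n.-tuple mR => cube_potential g2 (wt g2) (row_of_tuple y, s')).
  exact: (measurable_cube_potential g20 (wt0 g2) (coord_measurable_slice n s')).
pose En (g : nat -> X * R) (y : n.-tuple mR) : \bar R :=
  (\sum_(k <oo) (C * expR 1 * (g k).2 ^+ n * drift_kernel alpha s (g k) y)%:E)%E.
have Ent (g : nat -> X * R) k y : (forall k, 0 <= (g k).2) ->
    (0 <= (C * expR 1 * (g k).2 ^+ n * drift_kernel alpha s (g k) y)%:E)%E.
  move=> g0; rewrite lee_fin; apply: mulr_ge0; last exact: drift_kernel_ge0.
  by apply: mulr_ge0; [exact/ltW/mulr_gt0|exact: exprn_ge0].
have vE (g : nat -> X * R) y : (forall k, 0 <= (g k).2) ->
    cube_potential g (wt g) (row_of_tuple y, s) = ((u (row_of_tuple y, s))%:E * En g y)%E.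
  move=> g0; rewrite (cube_potentialE g0 (wt0 g)) -nneseriesZl; last by move=> k _; exact: Ent.
  apply: eq_eseriesr => k _; rewrite -EFinM; congr (_%:E).
  have := drift_kernelE alpha s (g k) y; rewrite -/u => H.
  transitivity (C * expR 1 * (g k).2 ^+ n * (u (base (g k)) * heat_pole (row_of_tuple y, s) (base (g k)))).
    by rewrite /wt -/C; ring.
  by rewrite H; ring.
have mEn (g : nat -> X * R) : (forall k, 0 <= (g k).2) -> measurable_fun setT (En g).
  move=> g0; apply: ge0_emeasurable_sum => [k y _ _|k _]; first exact: Ent.
  apply/measurable_EFinP; apply: measurable_funM; first exact: measurable_cst.
  exact: measurable_drift_kernel.
exists (fun w => cube_potential g1 (wt g1) w + cube_potential g2 (wt g2) w)%E; split.
- exact: supercaloric_add.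
- by move=> s'; apply: emeasurable_funD.
- move=> w Tw ws.
  have P0 g : (forall k, 0 <= (g k).2) -> (0 <= cube_potential g (wt g) w)%E.
    by move=> g0; have [_ h1 _] := supercaloric_cube_potential g0 (wt0 g).
  have [hw|hw] := leP (s - h) w.2.
    have [k _ kw] := g1c.2 w (conj Tw (introT andP (conj hw ws))).
    apply: (@le_trans _ _ (wt g1 k)%:E); first by rewrite lee_fin dcube// g1c.1.
    by apply: le_trans (cube_potential_ge g10 (wt0 g1) kw) _; rewrite leeDl// P0.
  have [k _ kw] := g2c.2 w (conj Tw hw).
  apply: (@le_trans _ _ (wt g2 k)%:E); first by rewrite lee_fin dcube// g2c.1.
  by apply: le_trans (cube_potential_ge g20 (wt0 g2) kw) _; rewrite leeDr// P0.
exists (fun y => 4%:E * En g1 y)%E; split.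
- by apply: emeasurable_funM => //; exact: mEn.
- by move=> y; rewrite mule_ge0// nneseries_ge0// => k _ _; exact: Ent.
- rewrite ge0_integralZl//; last 2 first.
  + exact: mEn.
  + by move=> y _; rewrite nneseries_ge0// => k _ _; exact: Ent.
  rewrite integral_nneseries//; last 2 first.
  + move=> k; apply/measurable_EFinP; apply: measurable_funM; first exact: measurable_cst.
    exact: measurable_drift_kernel.
  + by move=> k y _; exact: Ent.
  apply: (@le_trans _ _ (4%:E * ((C * expR 1)%:E * cube_sum g1))%E).
    rewrite lee_wpmul2l// /cube_sum -nneseriesZl; last by move=> k _; rewrite lee_fin exprn_ge0.
    apply: lee_nneseries => [k _ _|k _].
      by apply: integral_ge0 => y _; exact: Ent.
    under eq_integral do rewrite EFinM.
    rewrite ge0_integralZl//.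
    * rewrite -EFinM -[leRHS]mule1; apply: lee_wpmul2l; last exact: integral_drift_kernel.
      by rewrite lee_fin; apply: mulr_ge0; [exact/ltW/mulr_gt0|exact: exprn_ge0].
    * by apply/measurable_EFinP; exact: measurable_drift_kernel.
    * by move=> y _; rewrite lee_fin drift_kernel_ge0.
    * by rewrite lee_fin; apply: mulr_ge0; [exact/ltW/mulr_gt0|exact: exprn_ge0].
  rewrite muleA -EFinM; apply: (@le_trans _ _ ((4 * (C * expR 1))%:E * (e / (4 * C * expR 1))%:E)%E).
    apply: lee_wpmul2l; last exact: ltW g1s.
    by rewrite lee_fin; apply: mulr_ge0 => //; exact/ltW/mulr_gt0.
  rewrite -EFinM lee_fin mulrC mulrA divfK//.
  by rewrite gt_eqF// mulr_gt0// mulr_gt0.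
- move=> y yb.
  have E2 : (En g2 y <= (1 / 4)%:E)%E.
    apply: (@le_trans _ _ ((C * expR 1 * (A * (4 * tm) / L ^+ 2))%:E * cube_sum g2)%E).
      rewrite /cube_sum -nneseriesZl; last by move=> k _; rewrite lee_fin exprn_ge0.
      apply: lee_nneseries => [k _ _|k _]; first exact: Ent.
      rewrite -EFinM lee_fin mulrAC; have [->|[w [Tw /= wsh] kw]] := g2m k.
        by rewrite expr0n gtn_eqF// !mulr0.
      apply: ler_wpM2r; first by rewrite exprn_ge0.
      apply: ler_wpM2l; first exact/ltW/mulr_gt0.
      have bw := cube_base_lt kw; have /andP[t1 t2] := cube_base_time kw.
      have [k0 kx _] := kw; have [wD wtD] := Tbd _ Tw.
      have k1 : (g2 k).2 <= 1.
        by have /andP[_] := g2c.1 k; rewrite le_min => /andP[].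
      have k2 : (g2 k).2 ^+ 2 <= 1 by rewrite expr_le1.
      rewrite /drift_kernel (lt_trans bw) ?(lt_le_trans wsh) ?gerBl ?(ltW h0)//.
      set t := s - _; have ht : h <= t by rewrite /t; lra.
      have t0 : 0 < t by exact: lt_le_trans ht.
      have ttm : t <= tm.
        move: wtD; rewrite ler_norml => /andP[wtD _].
        by have := ler_norm s; rewrite /t /tm; lra.
      rewrite heat_kernelE.
      set Z := _ - row_of_tuple y.
      have Z0 : L ^+ 2 <= \sum_i Z ord0 i ^+ 2.
        rewrite (bigD1 i0)//=; apply: ler_wpDr; first by rewrite sumr_ge0// => i _; rewrite sqr_ge0.
        have LZ : L <= `|Z ord0 i0|.
          rewrite -normrN; apply: le_trans (ler_norm _); rewrite /Z !mxE.
          have := yb i0; rewrite row_of_tupleE ler_norml => /andP[y1 _].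
          have := kx i0; rewrite ler_norml => /andP[kx1 _].
          have := wD i0; rewrite ler_norml => /andP[_ wD1].
          have al : (L + b + `|x ord0 i0| + D + 1) <= 2 * t * alpha.
            rewrite /alpha mulrA ler_pdivlMr ?mulr_gt0// mulrC.
            by apply: ler_wpM2r; [exact: Lbx0|lra].
          have := ler_norm (- x ord0 i0); rewrite normrN => x1.
          by rewrite /=; lra.
        rewrite -[leRHS]real_normK ?num_real// lerXn2r// nnegrE ltW//.
      rewrite -[leRHS]mulrA; apply: ler_pM; rewrite ?powR_ge0 ?expR_ge0//.
        apply: powR_antitone; first by rewrite divr_ge0.
          by rewrite mulr_gt0// mulr_gt0.
        by rewrite ler_pM2l// mulr_gt0.
      have Lt : 0 < L ^+ 2 / (4 * tm) by rewrite divr_gt0 ?exprn_gt0// mulr_gt0.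
      rewrite expRN -[leRHS]invrK lef_pV2 ?posrE ?expR_gt0//; last by rewrite invr_gt0 divr_gt0 ?exprn_gt0// mulr_gt0.
      have -> : (4 * tm / L ^+ 2)^-1 = L ^+ 2 / (4 * tm) by rewrite invf_div.
      apply: (@le_trans _ _ ((\sum_i Z ord0 i ^+ 2) / (4 * t))).
        apply: ler_pM => //; first by rewrite sqr_ge0.
          by rewrite invr_ge0 mulr_ge0// ltW.
        by rewrite lef_pV2 ?posrE ?mulr_gt0// ler_pM2l.
      by apply: le_trans (expR_ge1Dx _); rewrite lerDr.
    apply: (@le_trans _ _ ((C * expR 1 * (A * (4 * tm) / L ^+ 2))%:E * M%:E)%E).
      apply: lee_wpmul2l; last exact: ltW g2s.
      rewrite lee_fin; apply: mulr_ge0; first exact/ltW/mulr_gt0.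
      by apply: divr_ge0; [apply: mulr_ge0; [exact: ltW|apply: mulr_ge0 => //; exact: ltW]|exact: sqr_ge0].
    rewrite -EFinM lee_fin.
    have -> : C * expR 1 * (A * (4 * tm) / L ^+ 2) * M = (K / L ^+ 2) / 4.
      by rewrite /K; field; rewrite gt_eqF.
    rewrite ler_wpM2r ?invr_ge0// ler_pdivrMr ?exprn_gt0// mul1r//.
  rewrite !vE//.
  have [E1|E1] := leP (En g1 y) (1 / 4)%:E; [left|right].
    apply: (@le_trans _ _ ((u (row_of_tuple y, s))%:E * (1 / 4)%:E + (u (row_of_tuple y, s))%:E * (1 / 4)%:E)%E).
      by apply: leeD; apply: lee_wpmul2l => //; rewrite lee_fin ltW.
    by rewrite -!EFinM -EFinD lee_fin; lra.
  apply: (@le_trans _ _ (4%:E * (1 / 4)%:E)%E); first by rewrite -EFinM lee_fin; lra.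
  by apply: lee_wpmul2l => //; exact: ltW.
Qed.

End lower_competitor.

(** * Lowering the data on a slice, and the cost of repairing the deficit *)

Section slice_cut.
Context (R : realType) (n : nat).
Local Notation X := (spacetime R n).
Local Notation mR := (measurableTypeR R).
Local Notation leb := (lebesgue_tuple R n).

Lemma measurable_exponential_slice (a : 'rV[R]_n) s :
  measurable_fun setT (fun y : n.-tuple mR => exponential a (row_of_tuple y, s)).
Proof.
pose F (y : n.-tuple mR) := \sum_i a ord0 i * tnth y i.
have -> : (fun y : n.-tuple mR => exponential a (row_of_tuple y, s)) =
    (fun y => expR (F y + (\sum_i a ord0 i ^+ 2) * s)).
  apply/funext => y; have FE : \sum_i a ord0 i * (row_of_tuple y, s).1 ord0 i = F y.
    by apply: eq_bigr => i _; rewrite row_of_tupleE.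
  by rewrite /exponential FE.
apply: measurableT_comp; first exact: measurable_expR.
apply: measurable_funD; last exact: measurable_cst.
apply: measurable_sum => i; apply: measurable_funM; first exact: measurable_cst.
exact: measurable_tnth.
Qed.

Lemma integral_heat_pole_slice (p : X) s :
  (\int[leb]_y (heat_pole p (row_of_tuple y, s))%:E <= 1)%E.
Proof.
have [sp|ps] := ltP s p.2.
  rewrite (eq_integral (fun y => (heat_kernel (p.2 - s) (p.1 - row_of_tuple y))%:E)).
    by rewrite integral_heat_kernel// subr_gt0.
  by move=> y _; rewrite heat_poleE.
rewrite (eq_integral (fun=> 0%E)); first by rewrite integral0.
by move=> y _; rewrite heat_pole0.
Qed.

Lemma measurable_heat_pole_slice (p : X) s :
  measurable_fun setT (fun y : n.-tuple mR => heat_pole p (row_of_tuple y, s)).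
Proof.
by apply: measurable_heat_pole; [exact: coord_measurable_cst|exact: coord_measurable_slice].
Qed.

(** For [p] after [s], the probability that the backward heat path from [p] is in [Q] at time
    [s]. *)
Definition slice_mass s (Q : set (n.-tuple mR)) : X -> \bar R :=
  potential leb \1_Q (fun y => (row_of_tuple y, s)).

(** The caloric extension of the lowered data, written as a potential of the slice; it is
    supercaloric as soon as the density is nonnegative, that is, under [Qu]. *)
Definition caloric_cut a s lam (Q : set (n.-tuple mR)) : X -> \bar R :=
  potential leb (fun y => exponential a (row_of_tuple y, s) - lam * \1_Q y)
    (fun y => (row_of_tuple y, s)).

Lemma slice_mass_ge0 s Q p : (0 <= slice_mass s Q p)%E.
Proof. by apply: potential_ge0 => y; rewrite indicE. Qed.

Lemma slice_mass_le1 s Q p : (slice_mass s Q p <= 1)%E.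
Proof.
apply: le_trans (integral_heat_pole_slice p s); apply: integral_le_pointwise => y.
  by rewrite lee_fin mulr_ge0 ?heat_pole_ge0// indicE.
by rewrite lee_fin ler_piMl ?heat_pole_ge0// indicE lern1 leq_b1.
Qed.

Lemma slice_mass_fin s Q p : slice_mass s Q p \is a fin_num.
Proof.
rewrite ge0_fin_numE ?slice_mass_ge0//.
by apply: le_lt_trans (slice_mass_le1 s Q p) _; rewrite ltry.
Qed.

Section cut_theory.
Variables (a : 'rV[R]_n) (s lam : R) (Q : set (n.-tuple mR)).
Hypotheses (mQ : measurable Q) (lam0 : 0 <= lam).
Hypothesis Qu : forall y, Q y -> lam <= exponential a (row_of_tuple y, s).

Let q_ge0 y : 0 <= exponential a (row_of_tuple y, s) - lam * \1_Q y.
Proof.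
rewrite indicE subr_ge0; case: (boolP (y \in Q)) => [|_].
  by rewrite inE mulr1 => /Qu.
by rewrite mulr0 ltW// exponential_gt0.
Qed.

Let mq : measurable_fun setT (fun y => exponential a (row_of_tuple y, s) - lam * \1_Q y).
Proof.
apply: measurable_funB; first exact: measurable_exponential_slice.
by apply: measurable_funM; [exact: measurable_cst|exact: measurable_indic].
Qed.

Lemma supercaloric_caloric_cut : supercaloric (caloric_cut a s lam Q).
Proof.
by apply: supercaloric_potential; [exact: mq|exact: q_ge0|exact: coord_measurable_slice].
Qed.

Lemma measurable_caloric_cut_slice s' :
  measurable_fun setT (fun y : n.-tuple mR => caloric_cut a s lam Q (row_of_tuple y, s')).
Proof.
by apply: (measurable_potential _ mq q_ge0 (coord_measurable_slice n s) (coord_measurable_slice n s')).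
Qed.

Lemma caloric_cutE p : s < p.2 ->
  (caloric_cut a s lam Q p + lam%:E * slice_mass s Q p = (exponential a p)%:E)%E.
Proof.
move=> sp; have t0 : 0 < p.2 - s by rewrite subr_gt0.
rewrite -(heat_semigroup_exponential a p t0).
rewrite (heat_semigroup_slice (b := fun y => exponential a (row_of_tuple y, s)) t0); last first.
  by move=> y; rewrite subKr.
rewrite /caloric_cut /slice_mass /potential subKr.
have mh := measurable_heat_pole_slice p s.
have m1 : measurable_fun setT (fun y : n.-tuple mR => (\1_Q y * heat_pole p (row_of_tuple y, s))%:E).
  by apply/measurable_EFinP; apply: measurable_funM; [exact: measurable_indic|exact: mh].
have p1 y : (0 <= (\1_Q y * heat_pole p (row_of_tuple y, s))%:E)%E.
  by rewrite lee_fin mulr_ge0 ?heat_pole_ge0// indicE.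
have m2 : measurable_fun setT (fun y : n.-tuple mR =>
    ((exponential a (row_of_tuple y, s) - lam * \1_Q y) * heat_pole p (row_of_tuple y, s))%:E).
  by apply/measurable_EFinP; apply: measurable_funM; [exact: mq|exact: mh].
have p2 y : (0 <= ((exponential a (row_of_tuple y, s) - lam * \1_Q y) * heat_pole p (row_of_tuple y, s))%:E)%E.
  by rewrite lee_fin; apply: mulr_ge0; [exact: q_ge0|exact: heat_pole_ge0].
rewrite -ge0_integralZl//.
rewrite -ge0_integralD//.
- by apply: eq_integral => y _; rewrite -EFinM -EFinD; congr (_%:E); ring.
- by move=> y _; rewrite mule_ge0// p1.
- by apply: emeasurable_funM => //; exact: measurable_cst.
Qed.

Lemma caloric_cut_ge p : s < p.2 ->
  ((exponential a p)%:E <= caloric_cut a s lam Q p + lam%:E * slice_mass s Q p)%E.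
Proof. by move=> /caloric_cutE ->. Qed.

(** On the slice the minimum is at most [u - lam] on [Q] and at most [u] elsewhere, so its extension
    from [s] lies below [caloric_cut]. Looking further back than [s] gives less, by
    [heat_semigroup_nonincreasing]; the real-valued slices required there come from the minimum with
    [u]. *)
Lemma hyperharmonic_cut_glue (v f : X -> \bar R) :
  supercaloric v ->
  (forall s', measurable_fun setT (fun y : n.-tuple mR => v (row_of_tuple y, s'))) ->
  (forall y, Q y -> (v (row_of_tuple y, s) <= (exponential a (row_of_tuple y, s) - lam)%:E)%E) ->
  supercaloric f -> (forall p, (caloric_cut a s lam Q p <= f p)%E) ->
  hyperharmonic (fun p => if p.2 <= s then Order.min (v p) (exponential a p)%:E else f p).
Proof.
move=> Sv mv vQ Sf cf.
pose phi p := Order.min (v p) (exponential a p)%:E.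
have v0 p : (0 <= v p)%E by case: Sv.
have Sphi : supercaloric phi by apply: supercaloric_min => //; exact: supercaloric_exponential.
have phi0 p : (0 <= phi p)%E by case: Sphi.
have phif p : phi p \is a fin_num.
  rewrite ge0_fin_numE ?phi0//; apply: (@le_lt_trans _ _ (exponential a p)%:E); last by rewrite ltry.
  by rewrite ge_min lexx orbT.
have phiE s' y : phi (row_of_tuple y, s') = (fine (phi (row_of_tuple y, s')))%:E by rewrite fineK.
have mphi s' : measurable_fun setT (fun y : n.-tuple mR => fine (phi (row_of_tuple y, s'))).
  apply: measurableT_comp; first exact: fine_measurable.
  apply: measurable_mine; first exact: mv.
  by apply/measurable_EFinP; exact: measurable_exponential_slice.
apply: hyperharmonic_glue => // t p t0 sp pts; apply: le_trans (cf p).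
have t1 : 0 < p.2 - s by rewrite subr_gt0.
apply: (@le_trans _ _ (heat_semigroup (p.2 - s) phi p)).
  have [e|ne] := eqVneq t (p.2 - s); first by rewrite e.
  apply: (heat_semigroup_nonincreasing Sphi t1 _ (mphi (p.2 - t))).
    by rewrite lt_neqAle eq_sym ne/=; lra.
  by move=> y; exact: phiE.
rewrite (heat_semigroup_slice t1 (b := fun y => fine (phi (row_of_tuple y, s)))); last first.
  by move=> y; rewrite subKr.
rewrite subKr; apply: integral_le_pointwise => y.
  by rewrite lee_fin mulr_ge0 ?heat_pole_ge0 ?fine_ge0.
rewrite lee_fin ler_wpM2r ?heat_pole_ge0// -lee_fin -phiE indicE.
case: (boolP (y \in Q)) => [|_].
  by rewrite inE mulr1 => /vQ vy; rewrite ge_min vy.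
by rewrite mulr0 subr0 ge_min lexx orbT.
Qed.

End cut_theory.

Definition harnack_const : R := 4 `^ (n%:R / 2) * expR n%:R.

Lemma harnack_const_gt0 : 0 < harnack_const.
Proof. by apply: mulr_gt0; [exact: powR_gt0|exact: expR_gt0]. Qed.

(* Twice the time elapsed since [s], as [heat_kernel_harnack] requires. *)
Definition upper_pole s (c : X * R) : X := (c.1.1, s + 2 * (c.1.2 + c.2 ^+ 2 / 2 - s)).

(** With [t] the time from [s] to [w], the pole is twice as high above [s] as the top of the cube,
    hence at a time between [2 t] and [2 (t + side^2) <= 4 t]. *)
Lemma heat_pole_harnack s (c : X * R) (w : X) (y : 'rV[R]_n) : cube c w ->
  s + c.2 ^+ 2 <= w.2 ->
  heat_pole w (y, s) <= harnack_const * heat_pole (upper_pole s c) (y, s).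
Proof.
move=> cw sw; have [c0 cx ct] := cw.
have r0 : 0 < c.2 ^+ 2 by rewrite exprn_gt0.
have ws : s < w.2 by lra.
move: ct; rewrite ler_norml => /andP[ct1 ct2].
rewrite !heat_poleE//=; last by lra.
apply: heat_kernel_harnack; first by lra.
- by lra.
- by lra.
apply: (@le_trans _ _ (\sum_(i < n) (c.2 ^+ 2))); last first.
  by rewrite sumr_const card_ord -[X in X <= _]mulr_natl ler_wpM2l//; lra.
apply: ler_sum => i _; have -> : (w.1 - y) ord0 i - (c.1.1 - y) ord0 i = w.1 ord0 i - c.1.1 ord0 i.
  by rewrite !mxE; ring.
rewrite -real_normK ?num_real// lerXn2r ?nnegrE ?(ltW c0)//.
by have := cx i; lra.
Qed.

Lemma slice_mass_harnack s Q (c : X * R) (w : X) : measurable Q -> cube c w ->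
  s + c.2 ^+ 2 <= w.2 ->
  (slice_mass s Q w <= harnack_const%:E * slice_mass s Q (upper_pole s c))%E.
Proof.
move=> mQ cw sw; rewrite /slice_mass /potential -ge0_integralZl//; last 3 first.
- apply/measurable_EFinP; apply: measurable_funM; first exact: measurable_indic.
  exact: measurable_heat_pole_slice.
- by move=> y _; rewrite lee_fin mulr_ge0 ?heat_pole_ge0// indicE.
- by rewrite lee_fin ltW// harnack_const_gt0.
apply: integral_le_pointwise => y.
  by rewrite lee_fin mulr_ge0 ?heat_pole_ge0// indicE.
rewrite -EFinM lee_fin mulrCA; apply: ler_wpM2l; first by rewrite indicE.
exact: heat_pole_harnack.
Qed.

Section return_density.
Variables (s : R) (g : nat -> X * R) (z : X).
Hypothesis g0 : forall k, 0 <= (g k).2.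

Let coef k := cube_const R n * (g k).2 ^+ n * harnack_const * heat_pole z (base (g k)).

Let coef_ge0 k : 0 <= coef k.
Proof.
apply: mulr_ge0; last exact: heat_pole_ge0.
apply: mulr_ge0; last exact/ltW/harnack_const_gt0.
by apply: mulr_ge0; [exact/ltW/cube_const_gt0|exact: exprn_ge0].
Qed.

(* Up to constants, the density at time [s] of the backward heat path from [z],
   summed over its visits to the cubes [g]. *)
Definition return_density (y : n.-tuple mR) : \bar R :=
  (\sum_(k <oo) (coef k * heat_pole (upper_pole s (g k)) (row_of_tuple y, s))%:E)%E.

Let term_ge0 k y : (0 <= (coef k * heat_pole (upper_pole s (g k)) (row_of_tuple y, s))%:E)%E.
Proof. by rewrite lee_fin mulr_ge0 ?coef_ge0 ?heat_pole_ge0. Qed.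

Let mterm k : measurable_fun setT (fun y : n.-tuple mR =>
  (coef k * heat_pole (upper_pole s (g k)) (row_of_tuple y, s))%:E).
Proof.
apply/measurable_EFinP; apply: measurable_funM; first exact: measurable_cst.
exact: measurable_heat_pole_slice.
Qed.

Lemma return_density_ge0 y : (0 <= return_density y)%E.
Proof. by apply: nneseries_ge0 => k _ _; exact: term_ge0. Qed.

Lemma measurable_return_density : measurable_fun setT return_density.
Proof. by apply: ge0_emeasurable_sum => [k y _ _|k _]; [exact: term_ge0|exact: mterm]. Qed.

Lemma integral_return_density : (\int[leb]_y return_density y <=
  (cube_const R n * harnack_const)%:E *
  \sum_(k <oo) ((g k).2 ^+ n * heat_pole z (base (g k)))%:E)%E.
Proof.
rewrite integral_nneseries//.
rewrite -nneseriesZl; last first.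
  by move=> k _; rewrite lee_fin mulr_ge0 ?heat_pole_ge0// exprn_ge0.
apply: lee_nneseries => [k _ _|k _]; first by apply: integral_ge0 => y _; exact: term_ge0.
under eq_integral do rewrite EFinM.
rewrite ge0_integralZl//; last 3 first.
- by apply/measurable_EFinP; exact: measurable_heat_pole_slice.
- by move=> y _; rewrite lee_fin heat_pole_ge0.
- by rewrite lee_fin coef_ge0.
apply: (@le_trans _ _ (coef k)%:E).
  rewrite -[leRHS]mule1; apply: lee_wpmul2l; first by rewrite lee_fin coef_ge0.
  exact: integral_heat_pole_slice.
by rewrite -EFinM lee_fin /coef le_eqVlt; apply/orP; left; apply/eqP; ring.
Qed.

(** Exchanging sum and integral writes the cost at [z] of repairing the deficit as an integral over
    [Q], to be compared pointwise with the gain [lam * slice_mass s Q z]. *)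
Lemma cube_potential_return lam Q : measurable Q -> 0 <= lam ->
  cube_potential g (fun k => lam * harnack_const * fine (slice_mass s Q (upper_pole s (g k)))) z =
  (lam%:E * \int[leb]_y ((\1_Q y)%:E * return_density y))%E.
Proof.
move=> mQ lam0; have h0 := harnack_const_gt0.
have i0 (y : n.-tuple mR) : (0 <= (\1_Q y)%:E :> \bar R)%E by rewrite lee_fin indicE.
have s0 k : 0 <= fine (slice_mass s Q (upper_pole s (g k))) by rewrite fine_ge0 ?slice_mass_ge0.
have mI k : measurable_fun setT (fun y : n.-tuple mR =>
    ((\1_Q y)%:E * (coef k * heat_pole (upper_pole s (g k)) (row_of_tuple y, s))%:E)%E).
  apply: emeasurable_funM; last exact: mterm.
  by apply/measurable_EFinP; exact: measurable_indic.
have I0 k (y : n.-tuple mR) :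
    (0 <= (\1_Q y)%:E * (coef k * heat_pole (upper_pole s (g k)) (row_of_tuple y, s))%:E)%E.
  by rewrite mule_ge0// term_ge0.
rewrite cube_potentialE//; last by move=> k; apply: mulr_ge0 => //; apply: mulr_ge0 => //; exact: ltW.
have -> : (\int[leb]_y ((\1_Q y)%:E * return_density y) =
    \sum_(k <oo) \int[leb]_y ((\1_Q y)%:E * (coef k * heat_pole (upper_pole s (g k)) (row_of_tuple y, s))%:E))%E.
  rewrite -integral_nneseries//; apply: eq_integral => y _.
  by rewrite nneseriesZl//; move=> k _; exact: term_ge0.
rewrite -nneseriesZl; last by move=> k _; apply: integral_ge0 => y _; exact: I0.
apply: eq_eseriesr => k _.
rewrite (eq_integral (fun y => (coef k)%:E * (\1_Q y * heat_pole (upper_pole s (g k)) (row_of_tuple y, s))%:E)%E); last first.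
  by move=> y _; rewrite -!EFinM; congr (_%:E); ring.
rewrite ge0_integralZl//; last 3 first.
- apply/measurable_EFinP; apply: measurable_funM; first exact: measurable_indic.
  exact: measurable_heat_pole_slice.
- by move=> y _; rewrite lee_fin mulr_ge0 ?heat_pole_ge0// indicE.
- by rewrite lee_fin coef_ge0.
rewrite -[(\int[_]_y _)%E]/(slice_mass s Q (upper_pole s (g k))) -(fineK (slice_mass_fin s Q _)) -!EFinM.
by congr (_%:E); rewrite /coef; ring.
Qed.

Lemma integral_return_density_le Q : measurable Q ->
  (forall y, Q y -> (return_density y <= (heat_pole z (row_of_tuple y, s) / 4)%:E)%E) ->
  (\int[leb]_y ((\1_Q y)%:E * return_density y) <= (1 / 4)%:E * slice_mass s Q z)%E.
Proof.
move=> mQ HQ; rewrite /slice_mass /potential -ge0_integralZl//; last 2 first.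
- apply/measurable_EFinP; apply: measurable_funM; first exact: measurable_indic.
  exact: measurable_heat_pole_slice.
- by move=> y _; rewrite lee_fin mulr_ge0 ?heat_pole_ge0// indicE.
apply: integral_le_pointwise => y.
  by rewrite mule_ge0 ?return_density_ge0// lee_fin indicE.
rewrite indicE; case: (boolP (y \in Q)) => [|_]; last by rewrite mul0e mul0r mule0.
by rewrite inE mul1e !mul1r => /HQ h; apply: (le_trans h); rewrite -EFinM lee_fin; lra.
Qed.

End return_density.

(** The kernel seen from [z] has mass 1 on the slice. At most [1 / 8] each is lost outside the box,
    where [E >= 1], and where [B] is large; so [5 / 8] remains on [Q]. *)
Lemma slice_mass_ge_half (z : X) (s b A e : R) (E B : n.-tuple mR -> \bar R) Q :
  s < z.2 -> 0 < b -> tail_const n b * (z.2 - s) <= 1 / 8 ->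
  0 <= A -> (forall y, heat_pole z (row_of_tuple y, s) <= A) ->
  measurable_fun setT E -> (forall y, 0 <= E y)%E -> (\int[leb]_y E y <= e%:E)%E ->
  A * e <= 1 / 8 ->
  measurable_fun setT B -> (forall y, 0 <= B y)%E -> (\int[leb]_y B y <= (1 / 32)%:E)%E ->
  measurable Q ->
  (forall y, (forall i, `|row_of_tuple y ord0 i - z.1 ord0 i| <= b) ->
    [\/ Q y, (1 <= E y)%E | ((heat_pole z (row_of_tuple y, s) / 4)%:E <= B y)%E]) ->
  ((1 / 2)%:E <= slice_mass s Q z)%E.
Proof.
move=> sz b0 tb A0 kA mE E0 Ee Ae mB B0 Be mQ cases.
have h0 : 0 < z.2 - s by rewrite subr_gt0.
set h := z.2 - s in h0 tb.
have C0 : 0 <= tail_const n b * h by rewrite mulr_ge0// ltW// tail_const_gt0.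
set C := tail_const n b * h in C0 tb.
have m2 : measurable_fun setT (fun y : n.-tuple mR => (heat_kernel (2 * h) (z.1 - row_of_tuple y))%:E).
  by apply/measurable_EFinP; exact: measurable_heat_kernel.
have p2 (y : n.-tuple mR) : (0 <= (heat_kernel (2 * h) (z.1 - row_of_tuple y))%:E)%E.
  by rewrite lee_fin heat_kernel_ge0.
have m1 : measurable_fun setT (fun y : n.-tuple mR => (\1_Q y * heat_pole z (row_of_tuple y, s))%:E).
  apply/measurable_EFinP; apply: measurable_funM; first exact: measurable_indic.
  exact: measurable_heat_pole_slice.
have p1 (y : n.-tuple mR) : (0 <= (\1_Q y * heat_pole z (row_of_tuple y, s))%:E)%E.
  by rewrite lee_fin mulr_ge0 ?heat_pole_ge0// indicE.
pose F y := ((\1_Q y * heat_pole z (row_of_tuple y, s))%:E +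
  (C%:E * (heat_kernel (2 * h) (z.1 - row_of_tuple y))%:E + (A%:E * E y + 4%:E * B y)))%E.
have kF : (\int[leb]_y (heat_pole z (row_of_tuple y, s))%:E <= \int[leb]_y F y)%E.
  apply: integral_le_pointwise => y; first by rewrite lee_fin heat_pole_ge0.
  have q1 : (0 <= C%:E * (heat_kernel (2 * h) (z.1 - row_of_tuple y))%:E)%E by rewrite mule_ge0.
  have q2 : (0 <= A%:E * E y)%E by rewrite mule_ge0.
  have q3 : (0 <= 4%:E * B y)%E by rewrite mule_ge0.
  have [far|near] := pselect (exists i, b <= `|(z.1 - row_of_tuple y) ord0 i|).
    have [i bi] := far; apply: (@le_trans _ _ (C%:E * (heat_kernel (2 * h) (z.1 - row_of_tuple y))%:E)%E).
      by rewrite -EFinM lee_fin heat_poleE//=; exact: heat_kernel_far bi.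
    by rewrite /F addeCA leeDl// !adde_ge0.
  have [|Qy|Ey|By] := cases y.
  - move=> i; rewrite leNgt; apply/negP => bi; apply: near; exists i.
    by rewrite !mxE -normrN opprB ltW//; move: bi; rewrite mxE.
  - rewrite /F indicE mem_set// mul1r leeDl// !adde_ge0//.
  - apply: (@le_trans _ _ (A%:E * E y)%E).
      apply: (@le_trans _ _ (A%:E * 1)%E); first by rewrite mule1 lee_fin.
      by apply: lee_wpmul2l.
    by rewrite /F addeA addeCA leeDl// !adde_ge0.
  - apply: (@le_trans _ _ (4%:E * B y)%E).
      apply: (@le_trans _ _ (4%:E * (heat_pole z (row_of_tuple y, s) / 4)%:E)%E).
        by rewrite -EFinM lee_fin mulrC divfK.
      by apply: lee_wpmul2l.
    by rewrite /F !addeA leeDr// !adde_ge0.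
have k1 : (\int[leb]_y (heat_pole z (row_of_tuple y, s))%:E = 1)%E.
  rewrite (eq_integral (fun y => (heat_kernel h (z.1 - row_of_tuple y))%:E)).
    by rewrite integral_heat_kernel.
  by move=> y _; rewrite heat_poleE.
have F1 : (\int[leb]_y F y <= slice_mass s Q z + (3 / 8)%:E)%E.
  have mC : measurable_fun setT (fun y : n.-tuple mR => (C%:E * (heat_kernel (2 * h) (z.1 - row_of_tuple y))%:E)%E).
    by apply: emeasurable_funM => //; exact: measurable_cst.
  have mA : measurable_fun setT (fun y => (A%:E * E y)%E).
    by apply: emeasurable_funM => //; exact: measurable_cst.
  have m4 : measurable_fun setT (fun y => (4%:E * B y)%E).
    by apply: emeasurable_funM => //; exact: measurable_cst.
  have pC (y : n.-tuple mR) : (0 <= C%:E * (heat_kernel (2 * h) (z.1 - row_of_tuple y))%:E)%E.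
    by rewrite mule_ge0.
  have pA y : (0 <= A%:E * E y)%E by rewrite mule_ge0.
  have p4 y : (0 <= 4%:E * B y)%E by rewrite mule_ge0.
  rewrite /F ge0_integralD//; last 2 first.
  - by move=> y _; rewrite !adde_ge0.
  - by apply: emeasurable_funD => //; exact: emeasurable_funD.
  apply: leeD; first exact: lexx.
  rewrite ge0_integralD//; last 2 first.
  - by move=> y _; rewrite adde_ge0.
  - exact: emeasurable_funD.
  rewrite ge0_integralD//.
  rewrite !ge0_integralZl//.
  rewrite integral_heat_kernel ?mulr_gt0// mule1.
  have -> : (3 / 8)%:E = ((1 / 8)%:E + ((1 / 8)%:E + (1 / 8)%:E))%E :> \bar R.
    by rewrite -!EFinD; congr (_%:E); lra.
  apply: leeD; first by rewrite lee_fin.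
  apply: leeD.
    apply: (@le_trans _ _ (A%:E * e%:E)%E); first exact: lee_wpmul2l.
    by rewrite -EFinM lee_fin.
  apply: (@le_trans _ _ (4%:E * (1 / 32)%:E)%E); first exact: lee_wpmul2l.
  by rewrite -EFinM lee_fin; lra.
rewrite k1 in kF; have := le_trans kF F1.
rewrite -(fineK (slice_mass_fin s Q z)) -EFinD !lee_fin; lra.
Qed.

End slice_cut.

(** * Thinness at a point of finite heat potential *)

Section thin_at.
Context (R : realType) (n : nat).
Local Notation X := (spacetime R n).
Local Notation mR := (measurableTypeR R).
Local Notation leb := (lebesgue_tuple R n).
Hypothesis n_gt0 : (0 < n)%N.
Local Notation mu := (mass_measure R n_gt0).
Local Notation U := (mass_type R n_gt0).

Lemma exponential_drift_ge alpha b s t (x y : 'rV[R]_n) : 0 <= alpha -> s <= t ->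
  (forall i, `|y ord0 i - x ord0 i| <= b) ->
  expR (alpha * (\sum_i x ord0 i - n%:R * b) + n%:R * alpha ^+ 2 * s) <=
  exponential (drift n alpha) (y, t).
Proof.
move=> a0 st xy; rewrite exponential_driftE ler_expR/=; apply: lerD.
  apply: ler_wpM2l => //; rewrite lerBlDr.
  have -> : n%:R * b = \sum_(i < n) b by rewrite sumr_const card_ord mulr_natl.
  rewrite -big_split; apply: ler_sum => i _ /=.
  by have := xy i; rewrite ler_norml => /andP[h _]; lra.
by apply: ler_wpM2l => //; apply: mulr_ge0 => //; exact: sqr_ge0.
Qed.

Variables (T : set X) (mT : measurable (T : set U)) (Tfin : (mass T < +oo)%E).
Variables (D : R) (D0 : 0 <= D).
Hypothesis Tbd : forall w, T w -> (forall i, `|w.1 ord0 i| <= D) /\ `|w.2| <= D.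

Section upper_competitor.
Variables (z : X) (a : 'rV[R]_n) (s gam k h A b lam e : R).
Let u := exponential a.
Hypotheses (sz : s < z.2) (gam0 : 0 < gam) (k0 : 0 < k) (kz : k < z.2 - s).
Hypotheses (h0 : 0 < h) (hz : h <= z.2 - (s + gam)).
Hypotheses (AE : A = (4 * pi * h) `^ (- (n%:R / 2))).
Hypotheses (b0 : 0 < b) (tb : tail_const n b * (z.2 - s) <= 1 / 8) (Ae : A * e <= 1 / 8).
Variables (v : X -> \bar R) (E : n.-tuple mR -> \bar R).
Hypothesis Sv : supercaloric v.
Hypothesis mv : forall s', measurable_fun setT (fun y : n.-tuple mR => v (row_of_tuple y, s')).
Hypothesis vT : forall w, T w -> w.2 <= s -> ((u w)%:E <= v w)%E.
Hypotheses (mE : measurable_fun setT E) (E0 : forall y, (0 <= E y)%E).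
Hypothesis Ee : (\int[leb]_y E y <= e%:E)%E.
Let W y := forall i, `|row_of_tuple y ord0 i - z.1 ord0 i| <= b.
Hypothesis vE : forall y, W y ->
  (v (row_of_tuple y, s) <= (u (row_of_tuple y, s) / 2)%:E)%E \/ (1 <= E y)%E.
Hypotheses (lam0 : 0 < lam) (lamu : forall y, W y -> lam <= u (row_of_tuple y, s) / 2).
Hypothesis slab : (mass (T `&` [set w : X | (s < w.2 <= s + gam)%R]) <
  (1 / (16 * cube_const R n * A))%:E)%E.
Hypothesis window : forall S : set X, measurable (S : set U) -> S `<=` T ->
  (forall w, S w -> s <= w.2 < z.2) ->
  (\int[mu]_(w in S) (heat_pole z w)%:E <=
    (1 / (64 * cube_const R n * harnack_const R n))%:E)%E.

(* Below [s] the competitor is [min v u]; above, it is the caloric extension of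
   [u - lam \1_Q] plus potentials of cubes which restore the deficit on [T] up
   to time [z.2 - k]. Seen from [z] the deficit is [lam * slice_mass s Q z], of
   which the restoring potentials cost at most a fixed fraction. *)
Lemma upper_competitor : exists w : X -> \bar R, [/\ hyperharmonic w,
  forall p, T p -> ((u p)%:E <= w p)%E &
  (heat_semigroup k w z <= (u z - lam / 8)%:E)%E].
Proof.
have C0 := cube_const_gt0 R n; have C1 := harnack_const_gt0 R n.
move: slab window gam0 k0 kz hz => slab' window' gam0' k0' kz' hz'.
set c0 := cube_const R n in C0 slab' window'; set c1 := harnack_const R n in C1 window'.
(* Together with the error of [efficient_cover] the part seen from [z] is at most [2 * eta]; times
   [c0 * c1] this is the [1 / 32] of [slice_mass_ge_half]. *)
pose eta := 1 / (64 * c0 * c1).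
have eta0 : 0 < eta by rewrite /eta; apply: divr_gt0 => //; apply: mulr_gt0 => //; exact: mulr_gt0.
have p0 := pi_gt0 R.
have A0 : 0 < A by rewrite AE powR_gt0// mulr_gt0// mulr_gt0.
pose T4 := T `&` [set w : X | s + gam < w.2 <= z.2 - k].
have mT4 : measurable (T4 : set U).
  apply: measurableI; first exact: mT.
  have := measurable_time_itv n_gt0 `]s + gam, z.2 - k].
  by congr (measurable _); apply/seteqP; split => w /=; rewrite in_itv.
have T4fin : (mass T4 < +oo)%E by apply: le_lt_trans Tfin; apply: le_mass => w [].
pose D' := D + \sum_i `|z.1 ord0 i|.
have D'0 : 0 <= D' by rewrite addr_ge0// sumr_ge0.
have T4bd w : T4 w -> k <= z.2 - w.2 /\ forall i, `|z.1 ord0 i - w.1 ord0 i| <= D'.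
  move=> [Tw /= /andP[w1 w2]]; split; first by lra.
  move=> i; apply: (le_trans (ler_normB _ _)); rewrite addrC; apply: lerD; first by have [+ _] := Tbd Tw.
  by rewrite (bigD1 i)//= lerDl sumr_ge0.
(* Forces [side^2 <= gam], so that points of [T4] are at least [side^2] above [s], as the Harnack
   inequality requires. *)
pose d4 := Num.min 1 gam; have d40 : 0 < d4 by rewrite lt_min ltr01.
have [g3 [[g3d g3c] g3m g3s]] := cover_meeting ltr01 slab'.
have [g4 [[g4d g4c] g4m g4s]] := efficient_cover mT4 k0 eta0 d40 D'0 T4fin T4bd.
have g30 j : 0 <= (g3 j).2 by have /andP[] := g3d j.
have g40 j : 0 <= (g4 j).2 by have /andP[] := g4d j.
have g4g j : (g4 j).2 ^+ 2 <= gam.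
  have /andP[q0] := g4d j; rewrite le_min => /andP[q1 q2].
  by apply: le_trans q2; rewrite expr2 ler_piMl.
have g4e : (\sum_(j <oo) ((g4 j).2 ^+ n * heat_pole z (base (g4 j)))%:E <= (2 * eta)%:E)%E.
  apply: (le_trans g4s); rewrite mulr_natl mulr2n EFinD; apply: leeD => //.
  apply: window' => //; first by move=> w [].
  by move=> w [_ /= /andP[w1 w2]]; apply/andP; split; lra.
pose B := return_density s g4 z.
have mB : measurable_fun setT B by exact: measurable_return_density.
have B0 y : (0 <= B y)%E by exact: return_density_ge0.
have Bint : (\int[leb]_y B y <= (1 / 32)%:E)%E.
  apply: (le_trans (integral_return_density s z g40)).
  apply: (@le_trans _ _ ((c0 * c1)%:E * (2 * eta)%:E)%E).
    by apply: lee_wpmul2l => //; rewrite lee_fin; apply/ltW/mulr_gt0.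
  rewrite -EFinM lee_fin /eta le_eqVlt; apply/orP; left; apply/eqP.
  by field; rewrite !gt_eqF.
(* The cubes [g4] and the density [B] are fixed before [Q]; only the weights [w4] depend on [Q].
   This permits removing from [Q] the points where [B] is large. *)
pose Q := [set y : n.-tuple mR | W y] `&`
  ([set y | (v (row_of_tuple y, s) <= (u (row_of_tuple y, s) / 2)%:E)%E] `&`
   [set y | (B y <= (heat_pole z (row_of_tuple y, s) / 4)%:E)%E]).
have mQ : measurable Q.
  apply: measurableI; [|apply: measurableI].
  - have -> : [set y : n.-tuple mR | W y] =
        \bigcap_(i in [set: 'I_n]) [set y : n.-tuple mR | `|tnth y i - z.1 ord0 i| <= b].
      apply/seteqP; split => y /= h' i; last by rewrite row_of_tupleE; exact: h'.
      by move=> _; have := h' i; rewrite row_of_tupleE.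
    apply: fin_bigcap_measurable => // i _.
    rewrite -[X in measurable X]setTI.
    apply: (measurable_fun_le (f := fun y : n.-tuple mR => `|tnth y i - z.1 ord0 i|) (g := cst b)) => //.
    apply: measurableT_comp => //; apply: measurable_funB; last exact: measurable_cst.
    exact: measurable_tnth.
  - rewrite -[X in measurable X]setTI.
    apply: (measurable_lee measurableT (f := fun y : n.-tuple mR => v (row_of_tuple y, s))
      (g := fun y : n.-tuple mR => (u (row_of_tuple y, s) / 2)%:E)); first exact: mv.
    apply/measurable_EFinP; apply: measurable_funM; last exact: measurable_cst.
    exact: measurable_exponential_slice.
  - rewrite -[X in measurable X]setTI.
    apply: (measurable_lee measurableT (f := B)
      (g := fun y : n.-tuple mR => (heat_pole z (row_of_tuple y, s) / 4)%:E)); first exact: mB.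
    apply/measurable_EFinP; apply: measurable_funM; last exact: measurable_cst.
    exact: measurable_heat_pole_slice.
have u0 w : 0 < u w by exact: exponential_gt0.
have Qu y : Q y -> lam <= exponential a (row_of_tuple y, s).
  by move=> [/lamu + _]; have := u0 (row_of_tuple y, s); rewrite -/u; lra.
have vQ y : Q y -> (v (row_of_tuple y, s) <= (exponential a (row_of_tuple y, s) - lam)%:E)%E.
  move=> [/lamu uy [/= vy _]]; apply: (le_trans vy); rewrite lee_fin -/u; lra.
have lam0' := ltW lam0.
pose cutQ := caloric_cut a s lam Q.
have Scut : supercaloric cutQ by exact: supercaloric_caloric_cut.
have mcut s' : measurable_fun setT (fun y : n.-tuple mR => cutQ (row_of_tuple y, s')).
  exact: measurable_caloric_cut_slice.
(* By [slice_mass_harnack] this dominates the deficit [lam * slice_mass s Q] at the points of [T4]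
   in the cube. *)
pose w4 j := lam * c1 * fine (slice_mass s Q (upper_pole s (g4 j))).
have w40 j : 0 <= w4 j.
  rewrite /w4; apply: mulr_ge0; last by rewrite fine_ge0 ?slice_mass_ge0.
  by apply: mulr_ge0 => //; exact: ltW.
(* In the slab just above [s] the deficit is bounded by [lam], since [slice_mass] is at most 1. *)
pose w3 (j : nat) := lam; have w30 j : 0 <= w3 j by exact: lam0'.
have S3 := supercaloric_cube_potential g30 w30.
have S4 := supercaloric_cube_potential g40 w40.
have M3 s' : measurable_fun setT (fun y : n.-tuple mR => cube_potential g3 w3 (row_of_tuple y, s')).
  exact: (measurable_cube_potential g30 w30 (coord_measurable_slice n s')).
have M4 s' : measurable_fun setT (fun y : n.-tuple mR => cube_potential g4 w4 (row_of_tuple y, s')).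
  exact: (measurable_cube_potential g40 w40 (coord_measurable_slice n s')).
pose f0 p := (cutQ p + (cube_potential g3 w3 p + cube_potential g4 w4 p))%E.
have Sf0 : supercaloric f0.
  apply: supercaloric_add => //; first exact: supercaloric_add.
  by move=> s'; apply: emeasurable_funD.
have cut0 p : (0 <= cutQ p)%E by case: Scut.
have pot30 p : (0 <= cube_potential g3 w3 p)%E by case: S3.
have pot40 p : (0 <= cube_potential g4 w4 p)%E by case: S4.
pose r := z.2 - k.
pose f p := (f0 p + infinite_after r p)%E.
have f0f p : (f0 p <= f p)%E by rewrite leeDl// infinite_after_ge0.
have cutf p : (cutQ p <= f p)%E.
  by apply: le_trans (f0f p); rewrite leeDl// adde_ge0.
exists (fun p => if p.2 <= s then Order.min (v p) (exponential a p)%:E else f p); split.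
- have Sf : supercaloric f by exact: supercaloric_add_infinite_after.
  by have := hyperharmonic_cut_glue Sv mv vQ Sf cutf.
- move=> p Tp; case: ifPn => [ps|]; first by rewrite le_min vT//= lexx.
  rewrite -ltNge => sp.
  have [pr|rp] := leP p.2 r; last first.
    apply: (@le_trans _ _ (infinite_after r p)); first by rewrite /infinite_after rp leey.
    by rewrite leeDr// adde_ge0// adde_ge0.
  apply: le_trans (f0f p); apply: (le_trans (caloric_cut_ge mQ lam0' Qu sp)).
  apply: leeD => //; have [pg|gp] := leP p.2 (s + gam).
    have [j _ pj] := g3c p (conj Tp (introT andP (conj sp pg))).
    apply: (@le_trans _ _ lam%:E).
      rewrite -[leRHS]mule1; apply: lee_wpmul2l; [by rewrite lee_fin|exact: slice_mass_le1].
    by apply: le_trans (cube_potential_ge g30 w30 pj) _; rewrite leeDl.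
  have [j _ pj] := g4c p (conj Tp (introT andP (conj gp pr))).
  apply: (@le_trans _ _ (w4 j)%:E); last first.
    by apply: le_trans (cube_potential_ge g40 w40 pj) _; rewrite leeDr.
  rewrite /w4 -mulrA EFinM; apply: lee_wpmul2l; first by rewrite lee_fin.
  rewrite EFinM fineK ?slice_mass_fin//; apply: slice_mass_harnack => //.
  by have := g4g j; lra.
(* The semigroup looks exactly at time [r = z.2 - k], where [infinite_after r] still vanishes
   because its inequality is strict. *)
have -> : heat_semigroup k (fun p => if p.2 <= s then Order.min (v p) (exponential a p)%:E else f p) z =
    heat_semigroup k f0 z.
  apply: eq_heat_semigroup => y; rewrite /= ifF; last by apply/negbTE; rewrite -ltNge; lra.
  by rewrite /f /infinite_after /= /r ltxx adde0.
have [_ _ Sf0z] := Sf0; apply: (le_trans (Sf0z k z k0)).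
have hs y : h <= z.2 - (row_of_tuple y, s).2 by rewrite /=; lra.
have half : ((1 / 2)%:E <= slice_mass s Q z)%E.
  apply: (slice_mass_ge_half sz b0 tb (ltW A0) _ mE E0 Ee Ae mB B0 Bint mQ).
    by move=> y; rewrite AE; exact: heat_pole_le.
  move=> y Wy; have [vy|] := vE Wy; last by move=> ?; constructor 2.
  have [By|/ltW] := leP (B y) (heat_pole z (row_of_tuple y, s) / 4)%:E; last by constructor 3.
  by constructor 1; split.
have pot3z : (cube_potential g3 w3 z <= (lam / 16)%:E)%E.
  rewrite (cube_potentialE g30 w30).
  apply: (@le_trans _ _ ((c0 * lam * A)%:E * cube_sum g3)%E).
    rewrite /cube_sum -nneseriesZl; last by move=> j _; rewrite lee_fin exprn_ge0.
    apply: lee_nneseries => [j _ _|j _].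
      rewrite lee_fin; apply: mulr_ge0; last exact: heat_pole_ge0.
      by apply: mulr_ge0 => //; apply: mulr_ge0; [exact: ltW|exact: exprn_ge0].
    rewrite -EFinM lee_fin; have [->|[w [Tw /= /andP[w1 w2]] wj]] := g3m j.
      by rewrite expr0n gtn_eqF// !(mulr0, mul0r).
    have bj := cube_base_lt wj.
    rewrite -/c0 /w3 (_ : c0 * (g3 j).2 ^+ n * lam * heat_pole z (base (g3 j)) =
      c0 * lam * heat_pole z (base (g3 j)) * (g3 j).2 ^+ n); last by ring.
    apply: ler_wpM2r; first exact: exprn_ge0.
    apply: ler_wpM2l; first by apply: mulr_ge0 => //; exact: ltW.
    by rewrite AE; apply: heat_pole_le => //; lra.
  apply: (@le_trans _ _ ((c0 * lam * A)%:E * (1 / (16 * c0 * A))%:E)%E).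
    apply: lee_wpmul2l; last exact: ltW g3s.
    by rewrite lee_fin; apply: mulr_ge0; [apply: mulr_ge0 => //; exact: ltW|exact: ltW].
  rewrite -EFinM lee_fin le_eqVlt; apply/orP; left; apply/eqP.
  by field; rewrite !gt_eqF.
have pot4z : (cube_potential g4 w4 z <= lam%:E * ((1 / 4)%:E * slice_mass s Q z))%E.
  rewrite /w4 (cube_potential_return s z g40 mQ lam0'); apply: lee_wpmul2l; first by rewrite lee_fin.
  by apply: integral_return_density_le => // y [_ []].
have cutz := caloric_cutE mQ lam0' Qu sz.
move: half pot3z pot4z cutz; rewrite /f0 -/cutQ -(fineK (slice_mass_fin s Q z)).
move: (fine (slice_mass s Q z)) => S; rewrite -!EFinM lee_fin => half pot3z pot4z cutz.
have cz : cutQ z = (u z - lam * S)%:E.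
  by rewrite EFinB /u -cutz addeK.
(* The balance is [- lam S + lam / 16 + lam S / 4] with [S >= 1 / 2], hence at most
   [- 5 / 16 * lam]. *)
rewrite cz; apply: (@le_trans _ _ ((u z - lam * S)%:E + ((lam / 16)%:E + (lam * (1 / 4 * S))%:E))%E).
  by apply: leeD => //; exact: leeD.
rewrite -!EFinD lee_fin.
have : lam * (1 / 2) <= lam * S by rewrite ler_wpM2l.
by lra.
Qed.

End upper_competitor.

(** The order of choices matters: window and [s], then the drift and with it [u], then [lam] and
    [gam], and only then [k]. The deficit [lam / 8] is therefore the same for all small [k]. *)
Lemma thin_at (z : X) : (\int[mu]_(w in T) (heat_pole z w)%:E < +oo)%E ->
  exists a, (regularized_reduit (fun w => (exponential a w)%:E) T z < (exponential a z)%:E)%E.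
Proof.
move=> Ifin.
have C0 := cube_const_gt0 R n; have C1 := harnack_const_gt0 R n.
have e1 : 0 < expR 1 :> R by exact: expR_gt0.
have p0 := pi_gt0 R.
have eta0 : 0 < 1 / (64 * cube_const R n * harnack_const R n).
  by apply: divr_gt0 => //; apply: mulr_gt0 => //; exact: mulr_gt0.
have [h0 h00 window] := heat_window mT eta0 Ifin.
(* As [s] is more than [h0 / 2 = 2 h] before [z] and [gam <= h], a time [h] remains between
   [s + gam] and [z]. *)
pose h := h0 / 4; have h_gt0 : 0 < h by rewrite divr_gt0.
pose A := (4 * pi * h) `^ (- (n%:R / 2)).
have A0 : 0 < A by rewrite powR_gt0// mulr_gt0// mulr_gt0.
pose e := 1 / (8 * A).
have e0 : 0 < e by apply: divr_gt0 => //; exact: mulr_gt0.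
have Ae : A * e <= 1 / 8.
  by rewrite le_eqVlt; apply/orP; left; apply/eqP; rewrite /e; field; rewrite gt_eqF.
have sl0 : 0 < e / (4 * cube_const R n * expR 1).
  by apply: divr_gt0 => //; apply: mulr_gt0 => //; exact: mulr_gt0.
have szh : z.2 - h0 < z.2 - h0 / 2 by lra.
have [s /andP[s1 s2] slice] := mass_small_slice mT Tfin szh sl0.
have q0 : 0 < 2 `^ (n%:R / 2) :> R by rewrite powR_gt0.
(* Since [b >= 1], one has [b^2 >= b >= 64 * 2^(n/2) * h0], which brings the tail below [1 / 8]. *)
pose b := 1 + 64 * 2 `^ (n%:R / 2) * h0.
have bq : 0 < 64 * 2 `^ (n%:R / 2) * h0 by apply: mulr_gt0 => //; exact: mulr_gt0.
have b1 : 1 <= b by rewrite lerDl ltW.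
have b0 : 0 < b by exact: lt_le_trans b1.
have tb : tail_const n b * (z.2 - s) <= 1 / 8.
  rewrite /tail_const mulrAC ler_pdivrMr ?exprn_gt0//.
  apply: (@le_trans _ _ (2 `^ (n%:R / 2) * 8 * h0)).
    by apply: ler_wpM2l; [apply/ltW/mulr_gt0|lra].
  have : b <= b ^+ 2 by rewrite expr2 ler_peMl// ltW.
  by rewrite /b; lra.
have [alpha al0 [v [Sv mv vT [E [mE E0 Ee vE]]]]] := lower_competitor mT Tfin z.1 e0 (ltW b0) D0 Tbd slice.
pose a := drift n alpha.
exists a; set u := exponential a.
(* Half of a lower bound of [u] on the box, valid at all times from [s] on; hence also
   [lam <= u z / 2]. *)
pose lam := expR (alpha * (\sum_i z.1 ord0 i - n%:R * b) + n%:R * alpha ^+ 2 * s) / 2.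
have lam0 : 0 < lam by rewrite divr_gt0// expR_gt0.
have lamu (y : n.-tuple mR) : (forall i, `|row_of_tuple y ord0 i - z.1 ord0 i| <= b) ->
    lam <= u (row_of_tuple y, s) / 2.
  move=> yb; rewrite /lam ler_pM2r ?invr_gt0//.
  exact: exponential_drift_ge.
have lamz : lam <= u z / 2.
  rewrite /lam ler_pM2r ?invr_gt0// (surjective_pairing z).
  by apply: exponential_drift_ge => //=; [lra|move=> i; rewrite subrr normr0 ltW].
have sb0 : (0 < (1 / (16 * cube_const R n * A))%:E)%E.
  by rewrite lte_fin; apply: divr_gt0 => //; apply: mulr_gt0 => //; exact: mulr_gt0.
have [gam /andP[gam0 gamh] slab] := mass_slab_above mT Tfin s sb0 h_gt0.
have C8 : 0 <= u z - lam / 8 by lra.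
apply: (@le_lt_trans _ _ (u z - lam / 8)%:E); last by rewrite lte_fin; lra.
apply: (regularized_reduit_le C8) => k1 k10.
pose k := Num.min (k1 / 2) h.
have k0 : 0 < k by rewrite lt_min divr_gt0//=.
have kh : k <= h by rewrite ge_min lexx orbT.
have kk1 : k < k1.
  by apply: (@le_lt_trans _ _ (k1 / 2)); [rewrite ge_min lexx|lra].
exists k; first by rewrite k0.
apply: (@upper_competitor z a s gam k h A b lam e _ gam0 k0 _ h_gt0 _ (erefl _) b0 tb Ae v E Sv mv vT mE E0 Ee vE lam0 lamu slab).
- lra.
- by rewrite /h in kh *; lra.
- by rewrite /h in gamh *; lra.
- move=> S mS ST Sw; apply: window => // w /Sw/andP[w1 w2].
  by apply/andP; split => //; lra.
Qed.

End thin_at.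

(** * Total thinness and semipolarity *)

Section thin_pieces.
Context (R : realType) (n : nat).
Local Notation X := (spacetime R n).
Hypothesis n_gt0 : (0 < n)%N.
Local Notation mu := (mass_measure R n_gt0).
Local Notation U := (mass_type R n_gt0).

Lemma regularized_reduit_le_set (u : X -> \bar R) (S T : set X) z : S `<=` T ->
  (regularized_reduit u S z <= regularized_reduit u T z)%E.
Proof.
move=> ST; apply: ereal_sup_le => _ [g [lg gS] <-]; exists g => //; split => // w.
apply: (le_trans (gS w)); apply: ereal_inf_le_tmp => _ [v [hv uv] <-].
by exists v => //; split => // p /ST; exact: uv.
Qed.

Lemma totally_thin_subset (S T : set X) : S `<=` T -> totally_thin T -> totally_thin S.
Proof.
move=> ST thT z; have [u su uz] := thT z; exists u => //.
exact: le_lt_trans (regularized_reduit_le_set u z ST) uz.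
Qed.

Lemma closed_cube (c : X * R) : closed (cube c).
Proof.
have [c0|c0] := ltP 0 c.2; last first.
  suff -> : cube c = set0 by exact: closed0.
  by apply/seteqP; split => // w []; rewrite ltNge c0.
have -> : cube c = (\bigcap_(i in [set: 'I_n])
    ((fun w : X => `|w.1 ord0 i - c.1.1 ord0 i|) @^-1` [set x | x <= c.2 / 2])) `&`
    ((fun w : X => `|w.2 - c.1.2|) @^-1` [set x | x <= c.2 ^+ 2 / 2]).
  apply/seteqP; split => w; first by move=> [_ h1 h2]; split => // i _; exact: h1.
  by move=> [h1 h2]; split => // i; exact: h1.
apply: closedI.
  apply: closed_bigI => i _; apply: preimage_closed; last exact: closed_le.
  move=> w _; apply: cvg_norm; apply: cvgB; last exact: cvg_cst.
  exact: continuous_space_coord.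
apply: preimage_closed; last exact: closed_le.
move=> w _; apply: cvg_norm; apply: cvgB; last exact: cvg_cst.
exact: cvg_snd.
Qed.

(* [heat_kernel_far] allows doubling the time until it reaches the threshold
   [(tail_const n b)^-1], where the uniform bound applies. *)
Lemma heat_kernel_off_diagonal t b (x : 'rV[R]_n) i : 0 < t -> 0 < b ->
  b <= `|x ord0 i| -> heat_kernel t x <= (4 * pi * (tail_const n b)^-1) `^ (- (n%:R / 2)).
Proof.
move=> t0 b0 bx; have c0 := @tail_const_gt0 _ n _ b0.
set c := tail_const n b in c0 *; have ci : 0 < c^-1 by rewrite invr_gt0.
have p0 := pi_gt0 R.
have big (s : R) : c^-1 <= s -> heat_kernel s x <= (4 * pi * c^-1) `^ (- (n%:R / 2)).
  move=> cs; have s0 : 0 < s by exact: lt_le_trans cs.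
  apply: (le_trans (heat_kernel_le _ s0)); apply: powR_antitone.
  - by rewrite divr_ge0.
  - by rewrite mulr_gt0// mulr_gt0.
  - by rewrite ler_pM2l// mulr_gt0.
have [N HN] : exists N, c^-1 <= 2 ^+ N * t.
  exists (Num.truncn (c^-1 / t)).+1.
  rewrite -ler_pdivrMr//; have /andP[_ /ltW h] := truncn_itv (divr_ge0 (ltW ci) (ltW t0)).
  apply: (le_trans h); rewrite -natrX ler_nat; exact/ltnW/ltn_expl.
elim: N t t0 HN => [|N IH] t t0 HN; first by apply: big; rewrite expr0 mul1r in HN.
have [ct|tc] := leP c^-1 t; first exact: big.
apply: (@le_trans _ _ (heat_kernel (2 * t) x)).
  apply: (le_trans (heat_kernel_far t0 b0 bx)); rewrite -/c ler_piMl ?heat_kernel_ge0//.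
  by rewrite mulrC -ler_pdivlMr// mul1r ltW.
by apply: IH; [rewrite mulr_gt0|rewrite mulrA -exprSr].
Qed.

(** Poles in [S] are away from [z] either in time, where the kernel is bounded by its normalisation,
    or in space, where [heat_kernel_off_diagonal] applies. *)
Lemma heat_pole_bounded_off (S : set X) (z : X) : closed S -> ~ S z ->
  exists C : R, forall w, S w -> heat_pole z w <= C.
Proof.
move=> cS Sz.
have [e e0 He] : exists2 e : R, 0 < e & forall w : X,
    (forall i, `|w.1 ord0 i - z.1 ord0 i| < e) -> `|w.2 - z.2| < e -> (~` S) w.
  by apply: nbhs_box; apply: open_nbhs_nbhs; split => //; exact: closed_openC.
pose C1 := (4 * pi * (tail_const n e)^-1) `^ (- (n%:R / 2)) : R.
pose C2 := (4 * pi * e) `^ (- (n%:R / 2)) : R.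
exists (C1 + C2) => w Sw.
have C10 : 0 <= C1 by exact: powR_ge0.
have C20 : 0 <= C2 by exact: powR_ge0.
have [zw|wz] := leP z.2 w.2; first by rewrite heat_pole0// addr_ge0.
have [far|near] := leP e (z.2 - w.2).
  by apply: (le_trans (heat_pole_le e0 far)); rewrite lerDr.
have [[i ei]|nex] := pselect (exists i, e <= `|w.1 ord0 i - z.1 ord0 i|).
  rewrite heat_poleE//; apply: (@le_trans _ _ C1); last by rewrite lerDl.
  apply: heat_kernel_off_diagonal => //; first by rewrite subr_gt0.
  by rewrite !mxE distrC; exact: ei.
exfalso; apply: (He w) => //; last by rewrite distrC gtr0_norm ?subr_gt0.
by move=> i; rewrite ltNge; apply/negP => h; apply: nex; exists i.
Qed.

(** The potential of [S] is finite everywhere: on [S] by the bound [M], off the closed set [S]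
    because a bounded kernel is integrated against a finite mass. So [thin_at] applies at each
    point. *)
Lemma thin_of_potential_bounded (S K : set X) (D M : R) (mK : measurable (K : set U)) (Kfin : (mu K < +oo)%E) :
  measurable (S : set U) -> closed S -> S `<=` K ->
  0 <= D -> (forall w, S w -> (forall i, `|w.1 ord0 i| <= D) /\ `|w.2| <= D) ->
  (forall w, S w -> (potential (mfrestr mK Kfin) (cst 1%R) (id : U -> X) w <= M%:E)%E) ->
  totally_thin S.
Proof.
move=> mS cS SK D0 SD SM z.
have Sfin : (mass S < +oo)%E by exact: (le_lt_trans (le_mass SK) Kfin).
have mf : measurable_fun setT (fun w : U => (heat_pole z w)%:E).
  apply/measurable_EFinP; apply: measurable_heat_pole; first exact: coord_measurable_cst.
  exact: coord_measurable_mass_type.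
suff Ifin : (\int[mu]_(w in S) (heat_pole z w)%:E < +oo)%E.
  have [a Ha] := thin_at mS Sfin D0 SD Ifin.
  by exists (fun w => (exponential a w)%:E); [exact: superharmonic_exponential|exact: Ha].
have [Sz|Sz] := pselect (S z).
  apply: (@le_lt_trans _ _ M%:E); last exact: ltry.
  apply: le_trans (SM z Sz).
  have -> : (\int[mu]_(w in S) (heat_pole z w)%:E =
      \int[mfrestr mK Kfin]_(w in S) (heat_pole z w)%:E)%E.
    apply: eq_measure_integral => B mB BS.
    by rewrite [RHS](_ : _ = mu (B `&` K))// setIidl//; exact: subset_trans BS SK.
  rewrite /potential; under [leRHS]eq_integral do rewrite mul1r.
  apply: (ge0_subset_integral _ mS measurableT mf) => // w _.
  by rewrite lee_fin heat_pole_ge0.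
have [C HC] := heat_pole_bounded_off cS Sz.
have C0 : 0 <= Num.max C 0 by rewrite le_max lexx orbT.
apply: (@le_lt_trans _ _ (\int[mu]_(w in S) (Num.max C 0)%:E)%E).
  apply: (ge0_le_integral mu mS).
  - by move=> w _; rewrite lee_fin heat_pole_ge0.
  - exact: measurable_funTS.
  - exact: measurable_cst.
  - by move=> w Sw; rewrite lee_fin le_max HC.
rewrite integral_cst; last exact: mS.
rewrite mass_measureE -(fineK (x := mass S)); first by rewrite -EFinM ltry.
by rewrite ge0_fin_numE ?mass_ge0.
Qed.

End thin_pieces.

(** * Countable decomposition of a set of finite mass *)

Section semipolar.
Context (R : realType) (n : nat).
Local Notation X := (spacetime R n).
Hypothesis n_gt0 : (0 < n)%N.
Local Notation mu := (mass_measure R n_gt0).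
Local Notation U := (mass_type R n_gt0).
Variables (A : set X) (Afin : (mass A < +oo)%E).

(* [K i] is a finite union of cubes at every scale, hence compact, and misses at
   most mass [1 / i.+1] of the hull [A'] of [A]. *)
Lemma compact_exhaustion : exists (A' : set X) (K : nat -> set X),
  [/\ A `<=` A', forall i, K i `<=` A', mass (A' `\` \bigcup_i K i) = 0%E,
      (mass A' < +oo)%E &
      forall i, [/\ measurable (K i : set U), closed (K i) &
        exists2 D : R, 0 <= D & forall w, K i w -> (forall l, `|w.1 ord0 l| <= D) /\ `|w.2| <= D]].
Proof.
have Af : mass A \is a fin_num by rewrite ge0_fin_numE ?mass_ge0.
pose M := fine (mass A) + 1.
have AM : (mass A < M%:E)%E by rewrite /M EFinD fineK// lteDl// lte_fin.
have scale0 k : 0 < k.+1%:R^-1 :> R by rewrite invr_gt0.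
have /choice[g Hg] : forall k : nat, exists g : nat -> X * R,
    cube_cover k.+1%:R^-1 A g /\ (cube_sum g < M%:E)%E.
  by move=> k; have [g g1 g2] := mass_cover (scale0 k) AM; exists g.
(* A measurable hull: the coverings of [A] chosen at all scales also cover [A'], so its mass is
   still at most [M]. *)
pose A' : set X := \bigcap_k \bigcup_j cube (g k j).
have AA' : A `<=` A' by move=> w Aw k _; have [[_ gA] _] := Hg k; exact: gA.
have A'M : (mass A' <= M%:E)%E.
  apply: ge_ereal_sup => _ [d /= d0 <-].
  have [k _ /(_ k (leqnn k)) /= kd] := near_infty_natSinv_lt (PosNum d0).
  have [[gd _] gM] := Hg k; apply: le_trans (ltW gM).
  apply: ereal_inf_lbound; exists (g k) => //; split; last by move=> w; apply.
  by move=> j; have /andP[-> h] := gd j; apply: (le_trans h); exact: ltW.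
have A'fin : (mass A' < +oo)%E by apply: (le_lt_trans A'M); rewrite ltry.
have mA' : measurable (A' : set U).
  apply: bigcapT_measurable => k; apply: bigcup_measurable => j _.
  exact: measurable_cube.
pose F k J : set X := \bigcup_(j in [set j | (j <= J)%N]) cube (g k j).
have mF k J : measurable (F k J : set U).
  by apply: bigcup_measurable => j _; exact: measurable_cube.
have cF k J : closed (F k J).
  apply: closed_bigcup; last by move=> j _; exact: closed_cube.
  by apply: (sub_finite_set (B := `I_J.+1)) => // j.
(* The factors [2^(k+1)] make the losses over all scales [k] add up to at most [1 / i.+1]. *)
have /choice[J HJ] : forall ik : nat * nat, exists J,
    (mass (A' `\` F ik.2 J) < (ik.1.+1%:R^-1 / (2 ^ ik.2.+1)%:R)%:E)%E.
  move=> [i k] /=; apply: (mass_nonincreasing_lt (n_gt0 := n_gt0) (T := A')) => //.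
  - by move=> m; apply: measurableD.
  - move=> m w [Aw nF]; split => // -[j /= jm wj]; apply: nF.
    by exists j => //=; exact: leqW.
  - suff -> : \bigcap_m (A' `\` F k m) = set0.
      by rewrite mass0// lte_fin divr_gt0// ltr0n expn_gt0.
    apply/seteqP; split => // w Hw.
    have [Aw _] := Hw 0%N I; have [j _ wj] := Aw k I.
    by have [_] := Hw j I; apply; exists j => /=.
pose K i : set X := \bigcap_k F k (J (i, k)).
exists A', K; split => //.
- by move=> i w Kw k _; have [j _ wj] := Kw k I; exists j.
- apply/eqP; rewrite eq_le mass_ge0 andbT.
  apply/lee_addgt0Pr => e e0; rewrite add0e.
  have [i _ /(_ i (leqnn i)) /= ie] := near_infty_natSinv_lt (PosNum e0).
  apply: (@le_trans _ _ (i.+1%:R^-1)%:E); last by rewrite lee_fin ltW.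
  apply: (@le_trans _ _ (mass (\bigcup_k (A' `\` F k (J (i, k)))))).
    apply: le_mass => w [Aw nK]; apply: contrapT => nE; apply: nK; exists i => // k _.
    by apply: contrapT => nF; apply: nE; exists k.
  have H := mass_sigma_subadditive (fun k => A' `\` F k (J (i, k))).
  apply: (le_trans H).
  apply: le_trans (epsilon_trick0 xpredT (ltW (scale0 i))).
  by apply: lee_nneseries => [k _ _|k _]; [exact: mass_ge0|exact: ltW (HJ (i, k))].
- move=> i; split.
  + exact: bigcapT_measurable.
  + by apply: closed_bigI => k _; exact: cF.
  (* A single scale suffices for boundedness: [K i] lies in the finitely many cubes kept at scale
     0. *)
  + pose b (c : X * R) := \sum_l `|c.1.1 ord0 l| + `|c.1.2| + c.2 + c.2 ^+ 2.
    have b0 j : 0 <= b (g 0%N j).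
      have [[gd _] _] := Hg 0%N; have /andP[q0 _] := gd j.
      by rewrite /b !addr_ge0// ?sumr_ge0// sqr_ge0.
    exists (\sum_(j < (J (i, 0%N)).+1) b (g 0%N j)); first by rewrite sumr_ge0.
    move=> w Kw; have [j /= jJ [c0 cx ct]] := Kw 0%N I.
    have jb : b (g 0%N j) <= \sum_(j < (J (i, 0%N)).+1) b (g 0%N j).
      rewrite -ltnS in jJ; rewrite (bigD1 (Ordinal jJ))//= lerDl.
      by rewrite sumr_ge0.
    have s0 : 0 <= \sum_l `|(g 0%N j).1.1 ord0 l| by rewrite sumr_ge0.
    have q2 : 0 <= (g 0%N j).2 ^+ 2 by rewrite sqr_ge0.
    have n2 := normr_ge0 (g 0%N j).1.2.
    split=> [l|]; apply: le_trans jb.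
      have sl : `|(g 0%N j).1.1 ord0 l| <= \sum_l `|(g 0%N j).1.1 ord0 l|.
        by rewrite (bigD1 l)//= lerDl sumr_ge0.
      have := ler_normD (w.1 ord0 l - (g 0%N j).1.1 ord0 l) ((g 0%N j).1.1 ord0 l).
      by rewrite subrK; have := cx l; rewrite /b; lra.
    have := ler_normD (w.2 - (g 0%N j).1.2) (g 0%N j).1.2.
    by rewrite subrK; move: ct; rewrite /b; lra.
Qed.

Lemma mass_finite_semipolar : semipolar A.
Proof.
have [A' [K [AA' KA' K0 A'fin HK]]] := compact_exhaustion.
have mK i : measurable (K i : set U) by have [] := HK i.
have Kfin i : (mu (K i) < +oo)%E by apply: le_lt_trans A'fin; exact: le_mass.
pose N i := potential (mfrestr (mK i) (Kfin i)) (cst 1) (id : U -> X).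
have mid := coord_measurable_mass_type R n_gt0.
have m1 : measurable_fun setT (cst 1 : U -> R) by exact: measurable_cst.
have p1 (y : U) : 0 <= (cst 1 : U -> R) y by [].
(* Index [(0, 0)] is the null remainder and [(i + 1, 0)] the infinity set of [N i] in [K i]; a
   positive second index [m + 1] gives the sublevel set at height [m]. *)
pose piece i m := match m, i with
  | 0%N, 0%N => A' `\` \bigcup_i K i
  | 0%N, i'.+1 => K i' `&` [set w | N i' w = +oo%E]
  | m'.+1, _ => K i `&` [set w | (N i w <= m'%:R%:E)%E]
  end.
have thin i m : totally_thin (piece i m).
  case: m i => [[|i]|m i] /=.
  - by apply: polar_totally_thin; exact: mass0_polar.
  - apply: (@totally_thin_subset _ _ _ [set w | N i w = +oo%E]); first exact: subIsetr.
    by apply: polar_totally_thin; exact: potential_infinite_polar.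
  - have [_ cK [D D0 KD]] := HK i.
    apply: (thin_of_potential_bounded (mK := mK i) (Kfin := Kfin i) (D := D) (M := m%:R)).
    + apply: measurableI; first exact: mK.
      rewrite -[X in measurable X]setTI; apply: emeasurable_fun_infty_c; first exact: measurableT.
      exact: (measurable_potential _ m1 p1 mid mid).
    + apply: closedI => //.
      (* Lower semicontinuity of the potential makes its sublevel sets closed. *)
      have /lower_semicontinuousP/(_ m%:R) h := @lower_semicontinuous_potential _ _ _ _ (mfrestr (mK i) (Kfin i)) _ _ m1 p1 mid.
      have -> : [set w | (N i w <= m%:R%:E)%E] = ~` [set w | (m%:R%:E < N i w)%E].
        by apply/seteqP; split => w /=; [move=> q; apply/negP; rewrite -leNgt|move/negP; rewrite -leNgt].
      exact: open_closedC.
    + exact: subIsetl.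
    + exact: D0.
    + by move=> w [Kw _]; exact: KD.
    + by move=> w [].
(* The pieces live in the hull, hence the intersection with [A]; indices that decode to nothing
   repeat the piece [(0, 0)]. *)
exists (fun k => A `&` piece (odflt (0, 0)%N (unpickle k)).1 (odflt (0, 0)%N (unpickle k)).2).
  move=> k; apply: totally_thin_subset (thin _ _); exact: subIsetr.
apply/seteqP; split => [w Aw|w [k _ []]//].
suff [i [m wim]] : exists i m, piece i m w.
  by exists (pickle (i, m)) => //; rewrite pickleK.
have [[i _ Kw]|nK] := pselect ((\bigcup_i K i) w); last first.
  by exists 0%N, 0%N; split => //; exact: AA'.
have [Nw|Nw] := eqVneq (N i w) +oo%E; first by exists i.+1, 0%N.
have Nf : N i w \is a fin_num.
  by rewrite ge0_fin_numE ?lt_neqAle ?Nw ?leey//; exact: potential_ge0.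
(* One successor to exceed the value of [N i], one for the shift of the second index in [piece]. *)
exists i, (Num.truncn (fine (N i w))).+2; split => //=.
rewrite -(fineK Nf) lee_fin ltW//.
have N0 : 0 <= fine (N i w) by rewrite fine_ge0//; exact: potential_ge0.
by have /andP[] := truncn_itv N0.
Qed.

End semipolar.

Theorem theorem5p5 (R : realType) (n : nat) (n_ge1 : (1 <= n)%N)
    (A : set (spacetime R n)) :
  ((parabolic_measure A < +oo)%E -> semipolar A) /\
  (parabolic_measure A = 0%E -> polar A).
Proof.
split=> hA.
  by apply: mass_finite_semipolar => //; exact: le_lt_trans (mass_le_parabolic n_ge1 A) hA.
apply: mass0_polar => //; apply/eqP; rewrite eq_le mass_ge0 andbT -hA.
exact: mass_le_parabolic.
Qed.
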